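(* Let $a,c\in\mathbb{R}$ with $a+c>0$ and $a<0$. For real $\alpha,\gamma$ with $|\alpha|<\gamma$ let $(Z_t^{(\alpha,\gamma)})_{t\ge0}$ denote the real-valued Markov process with initial distribution $$\mathbb{P}(Z_0^{(\alpha,\gamma)}\in dx)=\frac{4}{2^\gamma\,\Gamma\left(\frac{\gamma-\alpha}{2}\right)\Gamma\left(\frac{\alpha+\gamma}{2}\right)}\,e^{-\gamma x}K_\alpha(e^{-x})\,dx$$ and transition probabilities $$\mathbb{P}(Z_t^{(\alpha,\gamma)}\in dy\mid Z_s^{(\alpha,\gamma)}=x)=\frac{e^{-\alpha^2t/4}K_\alpha(e^{-y})}{e^{-\alpha^2s/4}K_\alpha(e^{-x})}\,p_{t-s}(x,y)\,dy,\qquad 0\le s<t.$$ Then, as $T\to\infty$, the finite dimensional distributions of $$\frac{1}{\sqrt T}\left(Z_{tT}^{(a/\sqrt T,\,c/\sqrt T)}\right)_{t\ge0}$$ converge weakly to those of $(\rho_t^{(a,c)})_{t\ge0}$, where $(\rho_t)_{t\ge 0}=(\rho_t^{(a,c)})_{t\ge0}$ is a Markov process with transition probabilities $$\mathbb{P}(\rho_t\in dy\mid\rho_s=x)=\frac{e^{-a^2t/4}\sinh(ay)}{e^{-a^2s/4}\sinh(ax)}\,g_{t-s}(x,y)\,dy,\qquad x>0,\ y>0,\ 0\le s<t,$$ with $$g_t(x,y)=\frac{2}{\pi}\int_0^\infty e^{-tu^2/4}\sin(xu)\sin(yu)\,du=\frac{1}{\sqrt{\pi t}}\left(e^{-(x-y)^2/t}-e^{-(x+y)^2/t}\right),\quad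 x,y,t>0,$$ and with the initial distribution $\mathbb{P}(\rho_0^{(a,c)}\in dx)=\mu_{a,c}(dx)$, where $$\mu_{a,c}(dx)=\frac{c^2-a^2}{2a}\left(e^{(a-c)x}-e^{-(a+c)x}\right)\mathbf{1}_{\{x>0\}}\,dx$$ is the law of the linear combination $\frac{1}{a+c}\gamma_1+\frac{1}{c-a}\tilde\gamma_1$ of a pair of independent exponential random variables $\gamma_1,\tilde\gamma_1$ of mean $1$.
   Context: For $x>0$ and complex $z$, $K_z(x)=\int_0^\infty e^{-x\cosh w}\cosh(zw)\,dw$ is the modified Bessel function. The Yakubovich heat kernel is $$p_t(x,y)=\frac{2}{\pi}\int_0^\infty e^{-tu^2/4}K_{iu}(e^{-x})K_{iu}(e^{-y})\frac{du}{|\Gamma(iu)|^2},\quad x,y\in\mathbb{R},\ t>0.$$ *)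

(* Defs.v *)
From HB Require Import structures.
From mathcomp Require Import all_boot all_order all_algebra.
From mathcomp Require Import complex.
From mathcomp Require Import all_classical all_reals all_analysis.

Set Implicit Arguments.
Unset Strict Implicit.
Unset Printing Implicit Defensive.

Import Order.TTheory GRing.Theory Num.Theory.
Import numFieldNormedType.Exports.

Local Open Scope classical_set_scope.
Local Open Scope ring_scope.
Local Open Scope complex_scope.

Section special_functions.
Variable R : realType.
Implicit Types (z : R[i]) (x y t u : R).
Local Notation mu := (@lebesgue_measure R).

Definition coshR x : R := (expR x + expR (- x)) / 2.

Definition sinhR x : R := (expR x - expR (- x)) / 2.

Definition cexp z : R[i] :=
  (expR (complex.Re z))%:C * (cos (complex.Im z) +i* sin (complex.Im z)).

Definition ccosh z : R[i] := (cexp z + cexp (- z)) / 2%:R.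

Definition cintegral (D : set R) (f : R -> R[i]) : R[i] :=
  (\int[mu]_(x in D) complex.Re (f x)) +i* (\int[mu]_(x in D) complex.Im (f x)).

(* \int_0^oo r ^ (z - 1) * e ^ (- r) dr, convergent for Re z > 0 *)
Definition euler_gamma z : R[i] :=
  cintegral `]0, +oo[ (fun r => cexp ((z - 1) * (ln r)%:C) * (expR (- r))%:C).

(* Number of applications of Gamma(z) = Gamma(z + 1) / z needed to move z into
   the half-plane Re z > 0: it is 0 if Re z > 0, and 1 if Re z = 0. *)
Definition gamma_shift z : nat :=
  if 0 < complex.Re z then 0%N else (Num.truncn (- complex.Re z)).+1.

Definition cGamma z : R[i] :=
  euler_gamma (z + (gamma_shift z)%:R) / \prod_(k < gamma_shift z) (z + k%:R).

Definition besselK z x : R[i] :=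
  cintegral `[0, +oo[
    (fun w => (expR (- (x * coshR w)))%:C * ccosh (z * w%:C)).

(* K_z and Gamma are real for real z; complex.Re only changes the type. *)
Definition besselKr (alpha x : R) : R := complex.Re (besselK alpha%:C x).

Definition Gammar x : R := complex.Re (cGamma x%:C).

Definition normc_sq z : R := complex.Re z ^+ 2 + complex.Im z ^+ 2.

(* K_{iu} is real-valued, so complex.Re only changes the type. *)
Definition heat_kernel t x y : R :=
  2 / pi * \int[mu]_(u in `]0, +oo[)
    (expR (- (t * u ^+ 2 / 4))
     * complex.Re (besselK (0 +i* u) (expR (- x)) * besselK (0 +i* u) (expR (- y)))
     / normc_sq (cGamma (0 +i* u))).

Definition Z_init_density (alpha gamma x : R) : R :=
  4 / (2 `^ gamma * Gammar ((gamma - alpha) / 2) * Gammar ((alpha + gamma) / 2))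
  * expR (- (gamma * x)) * besselKr alpha (expR (- x)).

Definition Z_trans_density (alpha s t x y : R) : R :=
  (expR (- (alpha ^+ 2 * t / 4)) * besselKr alpha (expR (- y)))
  / (expR (- (alpha ^+ 2 * s / 4)) * besselKr alpha (expR (- x)))
  * heat_kernel (t - s) x y.

Definition g_kernel t x y : R :=
  2 / pi * \int[mu]_(u in `]0, +oo[)
    (expR (- (t * u ^+ 2 / 4)) * sin (x * u) * sin (y * u)).

Definition rho_trans_density (a s t x y : R) : R :=
  (expR (- (a ^+ 2 * t / 4)) * sinhR (a * y))
  / (expR (- (a ^+ 2 * s / 4)) * sinhR (a * x))
  * g_kernel (t - s) x y.

Definition mu_density (a c x : R) : R :=
  (c ^+ 2 - a ^+ 2) / (2 * a) * (expR ((a - c) * x) - expR (- ((a + c) * x)))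
  * \1_(`]0, +oo[%classic : set R) x.

Definition density_law (f : R -> R) (B : set R) : \bar R :=
  (\int[mu]_(x in B) (f x)%:E)%E.

End special_functions.

Section processes.
Variable R : realType.

(* Processes are indexed by times t >= 0; their values at negative times are
   irrelevant. *)
Definition natural_filtration d (Om : measurableType d) (X : R -> Om -> R)
    (s : R) : set (set Om) :=
  <<s [set A | exists r B, [/\ 0 <= r <= s, measurable B & A = X r @^-1` B]] >>.

(* X is a Markov process with state space D, initial law mu0 and transition
   probabilities P(X_t \in dy | X_s = x) = q s t x y dy on D, i.e.,
   P(X_t \in B | F_s) = \int_(B `&` D) q s t X_s y dy almost surely, F being the
   natural filtration. *)
Definition markov_process d (Om : measurableType d) (P : probability Om R)
    (X : R -> Om -> R) (D : set R) (mu0 : set R -> \bar R)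
    (q : R -> R -> R -> R -> R) : Prop :=
  [/\ forall t, 0 <= t -> measurable_fun setT (X t),
      forall t, 0 <= t -> {ae P, forall w, D (X t w)},
      forall B, measurable B -> P (X 0 @^-1` B) = mu0 B &
      forall s t, 0 <= s -> s < t ->
      forall A, natural_filtration X s A ->
      forall B, measurable B ->
        P (A `&` X t @^-1` B) =
        (\int[P]_(w in A) density_law (q s t (X s w)) (B `&` D))%E].

(* Weak convergence, as T -> +oo, of all finite dimensional distributions of
   X_T, defined on a probability space that may depend on T, to those of Y. *)
Definition fdd_cvg (d : R -> measure_display)
    (Om : forall T, measurableType (d T)) (P : forall T, probability (Om T) R)
    (X : forall T, R -> Om T -> R)
    d' (Om' : measurableType d') (P' : probability Om' R)
    (Y : R -> Om' -> R) : Prop :=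
  forall (n : nat) (t : 'I_n -> R), (forall i, 0 <= t i) ->
  forall f : 'rV[R]_n -> R, continuous f ->
    (exists M, forall v, `|f v| <= M) ->
    ('E_(P T)[fun w => f (\row_i X T (t i) w)] @[T --> +oo%R] -->
     'E_P'[fun w => f (\row_i Y (t i) w)])%E.

Definition independent_RV2 d (Om : measurableType d) (P : probability Om R)
    (X Y : {RV P >-> R}) : Prop :=
  forall A B, measurable A -> measurable B ->
    P (X @^-1` A `&` Y @^-1` B) = (P (X @^-1` A) * P (Y @^-1` B))%E.

(* exponential_prob is parameterized by the rate, so the mean is 1 *)
Definition is_exp1 d (Om : measurableType d) (P : probability Om R)
    (X : {RV P >-> R}) : Prop :=
  forall B, measurable B -> distribution P X B = exponential_prob (1 : R) B.

End processes.

(* Main.v *)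
Require Import Defs.
From HB Require Import structures.
From mathcomp Require Import all_boot all_order all_algebra.
From mathcomp Require Import complex.
From mathcomp Require Import all_classical all_reals all_analysis.
From mathcomp Require Import measurable_realfun ring lra zify.

Set Implicit Arguments.
Unset Strict Implicit.
Unset Printing Implicit Defensive.

Import Order.TTheory GRing.Theory Num.Theory.
Import numFieldNormedType.Exports.

Local Open Scope classical_set_scope.
Local Open Scope ring_scope.

(** Put e = 1 / sqrt T. After rescaling, time is multiplied by 1 / e^2, space by
    e, and the parameters are a e and c e; the process is still Markov and its
    initial and transition densities are explicit. The convergence of finite
    dimensional distributions rests on two independent facts.

    The first is that it is enough to let the densities converge pointwise and
    boundedly on compact subsets of (0, oo). By the Markov property and bounded
    convergence the probability that the process lies in prescribed bounded
    cells of (0, oo) at prescribed times then converges ([cvg_chain]). A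
    nonnegative continuous function is approximated from below, almost surely
    for the limit process, by step functions on a grid of such cells, so its
    expectations satisfy a lower semicontinuity estimate; applied to M + f and
    to M - f with |f| <= M, this gives convergence ([cvg_expectation_of_cells]).
    Mass cannot escape to the complement of (0, oo) or to infinity because the
    limit process carries total mass 1 on (0, oo).

    The second fact is the convergence of the densities. After the substitution
    w -> w / e,
      e K_(a e)(exp(- x / e)) =
        int_0^oo exp(- exp(- x / e) cosh(w / e)) cosh(a w) dw,
    and since exp(- x / e) cosh(w / e) is comparable to exp((w - x) / e), the
    double exponential tends to the indicator of w < x. The limit is
    sinh(a x) / a for a real index a e, and sin(v x) / v for an imaginary index
    i e v ([cvg_damped_integral]). In the heat kernel the two factors 1 / v are
    compensated by 1 / |Gamma(i e v)|^2 = (e v)^2 / |Gamma(1 + i e v)|^2, and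
    Gamma(1 + i e v) tends to 1. To dominate the integrand one needs that
    1 / |Gamma(1 + i u)|^2 is at most a polynomial times exp(eps u^2), for every
    eps > 0; this follows from the functional equation and a lower bound for
    |Gamma(n + 1 + i u)| with n of order u^2 ([inv_gamma_modulus_le]). The
    constants of the initial density converge because x Gamma(x) tends to 1 at 0.

    The closed form of g_t is the cosine transform of the Gaussian
    ([gaussian_cosineE]) after writing the product of sines as a difference of
    cosines. The law of the combination of two exponential variables is a
    convolution of densities ([sum_exponentials_law]). *)

(** * Parametric integrals and affine substitution *)

Section integration_tools.
Context (R : realType).
Local Notation mu := (@lebesgue_measure R).

Lemma Rintegral_dct d (T : measurableType d) (m : {measure set T -> \bar R})
    (D : set T) (f_ : nat -> T -> R) (f g : T -> R) :
  measurable D ->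
  (forall n, measurable_fun D (f_ n)) -> measurable_fun D f ->
  {ae m, forall x, D x -> f_ ^~ x @ \oo --> f x} ->
  m.-integrable D (EFin \o g) ->
  (forall n x, D x -> `|f_ n x| <= g x) ->
  (\int[m]_(x in D) f_ n x) @[n --> \oo] --> \int[m]_(x in D) f x.
Proof.
move=> mD mf_ mf cvf ig fg.
have [fi _ cvi] : [/\ m.-integrable D (EFin \o f),
    (fun n => \int[m]_(x in D) `|(f_ n x)%:E - (f x)%:E|)%E @ \oo --> 0%E &
    (fun n => \int[m]_(x in D) (f_ n x)%:E)%E @ \oo -->
      (\int[m]_(x in D) (f x)%:E)%E].
  apply: (dominated_convergence mD _ _ _ ig).
  - by move=> n; exact/measurable_EFinP.
  - exact/measurable_EFinP.
  - apply: filterS cvf => x h Dx.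
    by apply: cvg_EFin; [exact: nearW|exact: h].
  - by apply: aeW => x n Dx; rewrite lee_fin; exact: fg.
by apply: fine_cvg; rewrite fineK//; exact: integrable_fin_num.
Qed.

Lemma integrable_dominated d (T : measurableType d)
    (m : {measure set T -> \bar R}) (D : set T) (f g : T -> R) :
  measurable D -> measurable_fun D f -> m.-integrable D (EFin \o g) ->
  (forall x, D x -> `|f x| <= g x) -> m.-integrable D (EFin \o f).
Proof.
move=> mD mf ig fg; apply: (le_integrable mD _ _ ig).
- exact/measurable_EFinP.
- by move=> x Dx; rewrite /= lee_fin (le_trans (fg _ Dx))// ler_norm.
Qed.

(** For a nonnegative integrand on the whole space this is part of the
    Fubini-Tonelli theorem. In general the integrand is cut off by the indicator
    of D and split into its positive and negative parts. *)
Lemma measurable_integral_param d1 d2 (T1 : measurableType d1)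
    (T2 : measurableType d2) (m : {sigma_finite_measure set T2 -> \bar R})
    (D : set T2) (f : T1 * T2 -> R) :
  measurable D -> measurable_fun setT f ->
  measurable_fun setT (fun x => (\int[m]_(y in D) (f (x, y))%:E)%E).
Proof.
move=> mD mf.
pose h (p : T1 * T2) := (f p * \1_D p.2)%R.
have mh : measurable_fun setT (EFin \o h).
  apply/measurable_EFinP/measurable_funM => //.
  by apply: measurableT_comp => //; exact: measurable_snd.
have -> : (fun x => (\int[m]_(y in D) (f (x, y))%:E)%E) =
    (fun x => (\int[m]_y (EFin \o h)^\+ (x, y) -
               \int[m]_y (EFin \o h)^\- (x, y)))%E.
  apply/funext => x; rewrite integral_mkcond integralE.
  congr (_ - _)%E; apply: eq_integral => y _;
    rewrite ?funeposE ?funenegE /patch /h /= indicE;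
    by case: (y \in D); rewrite /= ?mulr1 ?mulr0.
apply: emeasurable_funB.
- apply: (@measurable_fun_fubini_tonelli_F _ _ _ _ _ m ((EFin \o h)^\+%E)) => //.
    exact: measurable_funepos.
- apply: (@measurable_fun_fubini_tonelli_F _ _ _ _ _ m ((EFin \o h)^\-%E)) => //.
    exact: measurable_funeneg.
Qed.

Lemma measurable_Rintegral_param d1 d2 (T1 : measurableType d1)
    (T2 : measurableType d2) (m : {sigma_finite_measure set T2 -> \bar R})
    (D : set T2) (f : T1 * T2 -> R) :
  measurable D -> measurable_fun setT f ->
  measurable_fun setT (fun x => \int[m]_(y in D) f (x, y)).
Proof.
move=> mD mf; apply: (measurableT_comp (f := fine)) => //.
exact: measurable_integral_param.
Qed.

(** The image of c mu under x -> c x + b gives half-open intervals their length,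
    which determines Lebesgue measure. *)
Lemma lebesgue_measure_affine (c b : R) (c0 : 0 < c) (A : set R) : measurable A ->
  (mu A = c%:E * mu ((fun x => (c * x + b)%R) @^-1` A))%E.
Proof.
move=> mA.
have mcf : measurable_fun setT (fun x : R => c * x + b) by exact: measurable_funD.
have c0' : 0 <= c := ltW c0.
have : pushforward (mscale (NngNum c0') mu)
    ((fun x : R => c * x + b) : _ -> measurableTypeR R) A = mu A; last by move <-.
apply/esym/lebesgue_measure_unique => //= _ [[x y]] _ <-.
rewrite /pushforward /mscale /= lebesgue_measure_itv /=.
have -> : (fun r : R => c * r + b) @^-1` `]x, y] = `](x - b) / c, (y - b) / c]%classic.
  apply/seteqP; split => r /=; rewrite !in_itv/=;
    by rewrite ltr_pdivrMr// ler_pdivlMr// ltrBlDr lerBrDr mulrC.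
rewrite /= lebesgue_measure_itv /= !lte_fin ltr_pM2r ?invr_gt0// ltrD2r.
case: ifPn => // _; last by rewrite mule0.
rewrite -!EFinB -EFinM; congr EFin; field; exact: lt0r_neq0.
Qed.

(** Valid also when the integral is infinite or of the form oo - oo: positive
    and negative parts are treated separately, and multiplication by c > 0
    commutes with their difference. *)
Lemma integral_affine (c b : R) (c0 : 0 < c) (D : set R) (h : R -> \bar R) :
  measurable D -> measurable_fun D h ->
  (\int[mu]_(x in D) h x =
   c%:E * \int[mu]_(x in (fun x => (c * x + b)%R) @^-1` D) h (c * x + b)%R)%E.
Proof.
move=> mD mh.
have mcf : measurable_fun (setT : set (measurableTypeR R))
    ((fun x : R => c * x + b) : measurableTypeR R -> measurableTypeR R).
  exact: measurable_funD.
have c0' : 0 <= c := ltW c0.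
have pos (k : R -> \bar R) : measurable_fun D k -> (forall x, 0 <= k x)%E ->
    (\int[mu]_(x in D) k x =
     c%:E * \int[mu]_(x in (fun x => (c * x + b)%R) @^-1` D) k (c * x + b)%R)%E.
  move=> mk k0.
  have mD' : measurable ((fun x => c * x + b) @^-1` D).
    by rewrite -[X in measurable X]setTI; exact: mcf.
  have mkc : measurable_fun ((fun x => c * x + b) @^-1` D) (fun x => k (c * x + b)).
    apply: (measurable_comp mD _ mk); first by move=> _ [x /= Dx <-].
    exact: measurable_funTS.
  apply: (etrans _ (@ge0_integral_mscale _ _ R mu _ mD' (NngNum c0')
    (fun x => k (c * x + b)) mkc (fun x _ => k0 _))).
  apply: (etrans _ (@ge0_integral_pushforward _ _ _ _ R _ mcf
    (mscale (NngNum c0') mu) D k mD mk (fun x _ => k0 x))).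
  apply: eq_measure_integral => A mA _.
  exact: lebesgue_measure_affine.
rewrite integralE pos//; last exact: measurable_funepos.
rewrite pos//; last exact: measurable_funeneg.
rewrite [in RHS]integralE.
set A := (X in (c%:E * X - _)%E).
set B := (X in (_ - c%:E * X)%E).
have A0 : (0 <= A)%E by exact: integral_ge0.
have B0 : (0 <= B)%E by exact: integral_ge0.
have -> : (\int[mu]_(x in (fun x => (c * x + b)%R) @^-1` D)
    (fun x => h (c * x + b)%R)^\+ x = A)%E.
  by apply: eq_integral => x _; rewrite !funeposE.
have -> : (\int[mu]_(x in (fun x => (c * x + b)%R) @^-1` D)
    (fun x => h (c * x + b)%R)^\- x = B)%E.
  by apply: eq_integral => x _; rewrite !funenegE.
move: A B A0 B0 => [x| |] [y| |] //= _ _.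
- by congr EFin; rewrite mulrBr.
- by rewrite /= gt0_muleNy ?gt0_muley ?lte_fin.
- by rewrite /= !gt0_muley ?lte_fin.
- by rewrite /= !gt0_muley ?lte_fin//= gt0_muleNy ?lte_fin.
Qed.

Lemma integral_scale (c : R) (c0 : 0 < c) (D : set R) (h : R -> \bar R) :
  measurable D -> measurable_fun D h ->
  (\int[mu]_(x in D) h x =
   c%:E * \int[mu]_(x in (fun x => (c * x)%R) @^-1` D) h (c * x)%R)%E.
Proof.
move=> mD mh; rewrite (integral_affine 0 c0 mD mh).
by under eq_fun do rewrite addr0; under eq_integral do rewrite addr0.
Qed.

Lemma Rintegral_scale (c : R) (c0 : 0 < c) (D : set R) (h : R -> R) :
  measurable D -> measurable_fun D h ->
  \int[mu]_(x in D) h x =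
   c * \int[mu]_(x in (fun x => c * x) @^-1` D) h (c * x).
Proof.
move=> mD mh; rewrite /Rintegral (integral_scale c0)//; last exact/measurable_EFinP.
set I := (\int[mu]_(x in _) _)%E; case: I => [r| |] //=.
- by rewrite gt0_muley ?lte_fin// mulr0.
- by rewrite gt0_muleNy ?lte_fin// mulr0.
Qed.

End integration_tools.

(** * Integration against densities *)

Section density_transfer.
Import HBNNSimple.
Context (R : realType).
Local Notation mu := (@lebesgue_measure R).
Context d (Om : measurableType d) (P : {measure set Om -> \bar R}).
Variables (X : Om -> R) (E : set Om) (D : set R).
Hypothesis mX : measurable_fun setT X.
Hypothesis mE : measurable E.
Hypothesis mD : measurable D.

Let mpre B : measurable B -> measurable (X @^-1` B).
Proof. by move=> mB; rewrite -[X in measurable X]setTI; exact: mX. Qed.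

Let mED : measurable (E `&` X @^-1` D).
Proof. by apply: measurableI => //; exact: mpre. Qed.

(** Both sides are linear in h and continuous along increasing limits, and for
    indicators h the equality is the hypothesis on g. *)
Lemma ge0_integral_comp_density (g h : R -> R) :
  measurable_fun D g -> (forall x, 0 <= g x) ->
  (forall B, measurable B -> B `<=` D ->
    P (E `&` X @^-1` B) = (\int[mu]_(x in B) (g x)%:E)%E) ->
  measurable_fun setT h -> (forall x, 0 <= h x) ->
  (\int[P]_(w in E `&` X @^-1` D) (h (X w))%:E =
   \int[mu]_(x in D) (h x * g x)%:E)%E.
Proof.
move=> mg g0 Pg mh h0.
have mEh : measurable_fun setT (EFin \o h) by exact/measurable_EFinP.
pose f_ := nnsfun_approx measurableT mEh.
have simple (f : {nnsfun R >-> R}) :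
    (\int[P]_(w in E `&` X @^-1` D) (f (X w))%:E =
     \int[mu]_(x in D) (f x * g x)%:E)%E.
  have my y : measurable (f @^-1` [set y]).
    by rewrite -[X in measurable X]setTI; apply: (measurable_funPT f).
  under eq_integral do rewrite fimfunE -fsumEFin//.
  rewrite ge0_integral_fsum//; last 2 first.
  - move=> y; apply/measurable_EFinP/measurable_funM => //.
    by apply: measurableT_comp => //; exact: measurable_funTS.
  - by move=> y w _; rewrite EFinM nnfun_muleindic_ge0.
  under [RHS]eq_integral.
    move=> x xD; rewrite EFinM fimfunE -fsumEFin// muleC ge0_mule_fsumr; last first.
      by move=> r; rewrite EFinM nnfun_muleindic_ge0.
    over.
  rewrite [RHS]ge0_integral_fsum//; last 2 first.
  - move=> y; apply: emeasurable_funM; first exact/measurable_EFinP.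
    by apply/measurable_EFinP/measurable_funTS/measurable_funM => //; (apply: measurable_indic; exact: my).
  - move=> y x _; rewrite EFinM mule_ge0 ?lee_fin//.
    by rewrite -lee_fin EFinM nnfun_muleindic_ge0.
  apply: eq_fsbigr => y _.
  have [y0|y0] := leP 0 y; last first.
    rewrite (preimage_nnfun0 f y0) indic0 integral0_eq; last first.
      by move=> w _; rewrite /= mulr0.
    by rewrite integral0_eq// => x _; rewrite /= mulr0 mule0.
  under eq_integral do rewrite EFinM.
  rewrite ge0_integralZl_EFin//; last first.
    apply/measurable_EFinP; apply: measurableT_comp; first exact: measurable_indic.
    exact: measurable_funTS.
  under [RHS]eq_integral do rewrite EFinM muleCA.
  rewrite ge0_integralZl_EFin//; last 2 first.
  - by move=> w _; rewrite mule_ge0// lee_fin.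
  - apply: emeasurable_funM; first exact/measurable_EFinP.
    by apply/measurable_EFinP; apply: measurable_indic; exact: my.
  congr (_ * _)%E.
  transitivity (P (E `&` X @^-1` (D `&` f @^-1` [set y]))).
    have mXy : measurable (X @^-1` (f @^-1` [set y])) by exact: (mpre (my y)).
    rewrite [RHS](_ : _ = P (X @^-1` (f @^-1` [set y]) `&` (E `&` X @^-1` D))).
      rewrite -(integral_indic P mED mXy).
      by apply: eq_integral => w _; rewrite !indicE.
    by rewrite preimage_setI setIA [in RHS]setIC.
  rewrite Pg; [|exact: (measurableI _ _ mD (my y))|by move=> ? []].
  rewrite [RHS]integral_mkcond [LHS]integral_mkcond; apply: eq_integral => x _.
  rewrite /patch in_setI indicE; case: (x \in D) => //=.
  by case: (x \in _) => /=; rewrite ?mule1 ?mule0.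
transitivity (limn (fun n => \int[P]_(w in E `&` X @^-1` D) (f_ n (X w))%:E))%E.
  rewrite -monotone_convergence//=.
  - apply: eq_integral => w _; apply/esym/cvg_lim => //=.
    by apply: cvg_nnsfun_approx => // x _; rewrite lee_fin.
  - move=> n; apply/measurable_EFinP.
    by apply: measurableT_comp => //; exact: measurable_funTS.
  - by move=> n x _; rewrite lee_fin.
  - by move=> x _ a b ab; rewrite lee_fin//; exact/lefP/nd_nnsfun_approx.
transitivity (limn (fun n => \int[mu]_(x in D) (f_ n x * g x)%:E))%E; last first.
  rewrite -monotone_convergence//=.
  - apply: eq_integral => x _; apply/cvg_lim => //=.
    rewrite EFinM; under eq_fun do rewrite EFinM.
    apply: cvgeZr => //.
    by apply: cvg_nnsfun_approx => // y _; rewrite lee_fin.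
  - move=> n; apply/measurable_EFinP.
    by apply: measurable_funM => //; apply: measurable_funTS; exact: (measurable_funPT (f_ n)).
  - by move=> n x _; rewrite lee_fin mulr_ge0.
  - move=> x _ a b ab; rewrite lee_fin ler_wpM2r//.
    by have /lefP := nd_nnsfun_approx measurableT mEh ab; apply.
by congr (limn _); apply/funext => n; exact: simple.
Qed.

(** The event that X lies where phi is negative has nonnegative probability, so
    phi is nonnegative almost everywhere on D and may be replaced by its positive
    part; then h is split into its positive and negative parts. *)
Lemma integral_comp_density (phi h : R -> R) :
  measurable_fun D phi ->
  (forall B, measurable B -> B `<=` D ->
    P (E `&` X @^-1` B) = (\int[mu]_(x in B) (phi x)%:E)%E) ->
  measurable_fun setT h ->
  (\int[P]_(w in E `&` X @^-1` D) (h (X w))%:E =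
   \int[mu]_(x in D) (h x * phi x)%:E)%E.
Proof.
move=> mphi Pphi mh.
pose g x := Num.max (phi x) 0.
have mg : measurable_fun D g by exact: measurable_maxr.
have g0 x : 0 <= g x by rewrite le_max lexx orbT.
pose N := D `&` phi @^-1` `]-oo, 0[.
have mN : measurable N by apply: mphi.
have ND : N `<=` D by move=> x [].
have mphiN : measurable_fun N (EFin \o phi).
  by apply/measurable_EFinP; exact: measurable_funS mphi.
have intN : (\int[mu]_(x in N) `|(EFin \o phi) x| = 0)%E.
  apply/eqP; rewrite eq_le integral_ge0 ?andbT; last by move=> x _; exact: abse_ge0.
  have : (0 <= \int[mu]_(x in N) (phi x)%:E)%E by rewrite -Pphi.
  rewrite (eq_integral (fun x : measurableTypeR R => - `|(EFin \o phi) x|)%E); last first.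
    move=> x; rewrite inE => -[_ /=]; rewrite in_itv /= => p0.
    by rewrite /= ltr0_norm ?opprK.
  rewrite integralN ?oppe_ge0//=.
  rewrite (_ : (\int[mu]_(x in N) (fun x => `|(phi x)%:E|)^\- x = 0)%E)//.
    by rewrite oppe0; exact: fin_num_adde_defl.
  apply: integral0_eq => x _; rewrite funenegE; apply/max_idPr.
  by rewrite leeNl oppe0 abse_ge0.
have aephi : {ae mu, forall x, D x -> phi x = g x}.
  have /(ae_eq_integral_abs mu mN mphiN) := intN.
  apply: filterS => x h0 Dx; rewrite /g; have [//|p0] := leP 0 (phi x).
  suff [] : (EFin \o phi) x = 0%:E by [].
  by apply: h0; split => //=; rewrite in_itv.
have Pg B : measurable B -> B `<=` D ->
    P (E `&` X @^-1` B) = (\int[mu]_(x in B) (g x)%:E)%E.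
  move=> mB BD; rewrite Pphi//; apply: ae_eq_integral => //.
  - by apply/measurable_EFinP; exact: measurable_funS mphi.
  - by apply/measurable_EFinP; exact: measurable_funS mg.
  - by apply: negligibleS aephi => x; apply: contra_not => e Bx; rewrite /= e//; exact: BD.
have mhD : measurable_fun D h by exact: measurable_funTS.
rewrite (ae_eq_integral (fun x : measurableTypeR R => (h x * g x)%:E)) //; last 3 first.
- by apply/measurable_EFinP; exact: measurable_funM.
- by apply/measurable_EFinP; exact: measurable_funM.
- by apply: negligibleS aephi => x; apply: contra_not => e Dx; rewrite /= e.
rewrite integralE [RHS]integralE.
pose hp x := Num.max (h x) 0; pose hn x := Num.max (- h x) 0.
have mhp : measurable_fun setT hp by exact: measurable_maxr.
have mhn : measurable_fun setT hn by apply: measurable_maxr => //; exact: measurableT_comp.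
congr (_ - _)%E.
- rewrite (eq_integral (fun w => (hp (X w))%:E)); last first.
    by move=> w _; rewrite funeposE -EFin_max.
  rewrite (ge0_integral_comp_density mg g0 Pg mhp); last first.
    by move=> x; rewrite le_max lexx orbT.
  by apply: eq_integral => x _; rewrite funeposE -EFin_max -[0 in RHS](mul0r (g x)) maxr_pMl.
- rewrite (eq_integral (fun w => (hn (X w))%:E)); last first.
    by move=> w _; rewrite funenegE -EFinN -EFin_max.
  rewrite (ge0_integral_comp_density mg g0 Pg mhn); last first.
    by move=> x; rewrite le_max lexx orbT.
  apply: eq_integral => x _.
  by rewrite funenegE -EFinN -EFin_max -mulNr -[0 in RHS](mul0r (g x)) maxr_pMl.
Qed.

End density_transfer.

Section bounded_integrals.
Context (R : realType).
Local Notation mu := (@lebesgue_measure R).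

Lemma integrable_bounded d (T : measurableType d) (m : {measure set T -> \bar R})
    (D : set T) (f : T -> R) (K : R) :
  measurable D -> (m D < +oo)%E -> measurable_fun D f ->
  (forall x, D x -> `|f x| <= K) -> m.-integrable D (EFin \o f).
Proof.
move=> mD Doo mf fK.
apply: (@integrable_dominated _ _ _ m D f (cst K)) => //.
apply/integrableP; split; first exact/measurable_EFinP/measurable_cst.
rewrite (eq_integral (cst `|K|%:E))//.
by rewrite integral_cst// lte_mul_pinfty.
Qed.

Lemma Rintegral_bounded d (T : measurableType d) (m : {measure set T -> \bar R})
    (D : set T) (f : T -> R) (K : R) :
  measurable D -> (m D < +oo)%E -> measurable_fun D f ->
  (forall x, D x -> `|f x| <= K) ->
  `|\int[m]_(x in D) f x| <= K * fine (m D).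
Proof.
move=> mD Doo mf fK.
have fi := integrable_bounded mD Doo mf fK.
apply: (le_trans (le_normr_Rintegral mD fi)).
rewrite -Rintegral_cst//; apply: le_Rintegral => //.
- apply: (@integrable_bounded _ _ _ _ _ K) => //; first exact: measurableT_comp.
  by move=> x Dx; rewrite normr_id fK.
- exact: (@integrable_bounded _ _ _ _ _ `|K|).
Qed.

Lemma integral_rect_swap (F : R * R -> R) (C B : set R) (K : R) :
  measurable_fun setT F -> measurable C -> measurable B ->
  (mu C < +oo)%E -> (mu B < +oo)%E ->
  (forall x y, C x -> B y -> `|F (x, y)| <= K) ->
  (\int[mu]_(x in C) (\int[mu]_(y in B) F (x, y))%:E =
   \int[mu]_(y in B) (\int[mu]_(x in C) F (x, y))%:E)%E.
Proof.
move=> mF mC mB Coo Boo FK.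
have mFx x : measurable_fun setT (fun y => F (x, y)).
  exact: measurable_fun_pair2 mF.
have mFy y : measurable_fun setT (fun x => F (x, y)).
  exact: measurable_fun_pair1 mF.
have Ex x : C x -> ((\int[mu]_(y in B) F (x, y))%:E = \int[mu]_(y in B) (F (x, y))%:E)%E.
  move=> Cx; rewrite /Rintegral fineK//; apply: integrable_fin_num => //.
  apply: (@integrable_bounded _ _ mu _ (fun y => F (x, y)) K) => //.
    exact: (measurable_funTS (mFx x)).
  by move=> y By; exact: FK.
have Ey y : B y -> ((\int[mu]_(x in C) F (x, y))%:E = \int[mu]_(x in C) (F (x, y))%:E)%E.
  move=> By; rewrite /Rintegral fineK//; apply: integrable_fin_num => //.
  apply: (@integrable_bounded _ _ mu _ (fun x => F (x, y)) K) => //.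
    exact: (measurable_funTS (mFy y)).
  by move=> x Cx; exact: FK.
pose G (p : measurableTypeR R * measurableTypeR R) : \bar R := (F p)%:E.
have mCB : measurable (C `*` B) by exact: measurableX.
have Gi : (mu \x mu)%E.-integrable setT (G \_ (C `*` B)).
  apply: (@integrable_mkcond _ _ _ (mu \x mu)%E _ G mCB).1.
  apply: (@integrable_bounded _ _ (mu \x mu)%E (C `*` B) F K) => //.
  - apply: (@le_lt_trans _ _ (mu C * mu B)%E).
      by rewrite -(product_measure1E mu mu mC mB).
    by rewrite lte_mul_pinfty// ge0_fin_numE.
  - exact: (measurable_funTS mF).
  - by move=> [x y] [/= Cx By]; exact: FK.
have := Fubini Gi.
rewrite [X in X = _ -> _](_ : _ = (\int[mu]_(x in C) (\int[mu]_(y in B) F (x, y))%:E)%E).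
rewrite [X in _ = X -> _](_ : _ = (\int[mu]_(y in B) (\int[mu]_(x in C) F (x, y))%:E)%E).
  by [].
- rewrite [RHS]integral_mkcond; apply: eq_integral => y _.
  rewrite /patch; case: ifPn => yB.
    rewrite Ey; last exact: set_mem.
    rewrite [RHS]integral_mkcond.
    by apply: eq_integral => x _; rewrite /patch in_setX /= yB andbT.
  by rewrite integral0_eq// => x _; rewrite /patch in_setX /= (negbTE yB) andbF.
- rewrite [RHS]integral_mkcond; apply: eq_integral => x _.
  rewrite /patch; case: ifPn => xC.
    rewrite Ex; last exact: set_mem.
    rewrite [RHS]integral_mkcond.
    by apply: eq_integral => y _; rewrite /patch in_setX /= xC.
  by rewrite integral0_eq// => y _; rewrite /patch in_setX /= (negbTE xC).
Qed.

End bounded_integrals.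

(** * Markov processes observed at finitely many times *)

Section markov_chain_densities.
Context (R : realType).
Local Notation mu := (@lebesgue_measure R).

Section filtration.
Context d (Om : measurableType d).
Implicit Types (X : R -> Om -> R) (s t : R) (A : set Om) (B : set R).

Lemma natural_filtration_measurable X s A :
  (forall t, 0 <= t -> measurable_fun setT (X t)) ->
  natural_filtration X s A -> measurable A.
Proof.
move=> mX; apply: smallest_sub; first exact: sigma_algebra_measurable.
move=> _ [r [B [/andP[r0 _] mB ->]]].
by rewrite -[X in measurable X]setTI; exact: mX.
Qed.

Lemma natural_filtration_preimage X s B :
  0 <= s -> measurable B -> natural_filtration X s (X s @^-1` B).
Proof.
move=> s0 mB; apply: sub_sigma_algebra; exists s, B; split => //.
by rewrite s0 lexx.
Qed.

Lemma natural_filtrationI X s A A' :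
  natural_filtration X s A -> natural_filtration X s A' ->
  natural_filtration X s (A `&` A').
Proof. exact: (@measurableI _ (g_sigma_algebraType _)). Qed.

Lemma natural_filtrationT X s : natural_filtration X s setT.
Proof. exact: (@measurableT _ (g_sigma_algebraType _)). Qed.

Lemma natural_filtration_le X s t A : s <= t ->
  natural_filtration X s A -> natural_filtration X t A.
Proof.
move=> st; apply: smallest_sub; first exact: smallest_sigma_algebra.
move=> _ [r [B [/andP[r0 rs] mB ->]]].
apply: sub_sigma_algebra; exists r, B; split => //.
by rewrite r0 (le_trans rs).
Qed.

End filtration.

(** If phi is the density of [X s] on the event A, then after restricting [X s] to
    C the density of [X t] on C' is y -> int_C phi(x) q(x, y) dx, by the Markov
    property at time s and Fubini's theorem. The restriction to sets of finite
    measure on which everything is bounded makes all integrals finite. *)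
Lemma markov_density_step d (Om : measurableType d) (P : probability Om R)
    (X : R -> Om -> R) (D : set R) (mu0 : set R -> \bar R)
    (q : R -> R -> R -> R -> R) (s t : R) (A : set Om) (C C' : set R)
    (phi : R -> R) (K M : R) :
  markov_process P X D mu0 q ->
  0 <= s -> s < t -> natural_filtration X s A ->
  measurable C -> (mu C < +oo)%E ->
  measurable C' -> (mu C' < +oo)%E -> C' `<=` D ->
  measurable_fun setT phi -> (forall x, C x -> `|phi x| <= K) ->
  (forall B, measurable B -> B `<=` C ->
    P (A `&` X s @^-1` B) = (\int[mu]_(x in B) (phi x)%:E)%E) ->
  measurable_fun setT (fun p : R * R => q s t p.1 p.2) ->
  (forall x y, C x -> C' y -> `|q s t x y| <= M) ->
  forall B, measurable B -> B `<=` C' ->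
    P ((A `&` X s @^-1` C) `&` X t @^-1` B) =
    (\int[mu]_(y in B) (\int[mu]_(x in C) (phi x * q s t x y))%:E)%E.
Proof.
move=> [mX _ _ XM] s0 st FA mC Coo mC' C'oo C'D mphi phiK Pphi mq qM B mB BC'.
have Boo : (mu B < +oo)%E.
  by apply: le_lt_trans C'oo; apply: le_measure; rewrite ?inE.
have mA := natural_filtration_measurable mX FA.
have FA' : natural_filtration X s (A `&` X s @^-1` C).
  by apply: natural_filtrationI => //; exact: natural_filtration_preimage.
rewrite (XM _ _ s0 st _ FA' _ mB) (setIidl (subset_trans BC' C'D)).
pose H x := \int[mu]_(y in B) q s t x y.
have mH : measurable_fun setT H.
  exact: (measurable_Rintegral_param mu (f := fun p : R * R => q s t p.1 p.2)).
rewrite (eq_integral (fun w => (H (X s w))%:E)); last first.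
  move=> w; rewrite inE => -[_ /= Cw]; rewrite /density_law /H /Rintegral fineK//.
  apply: integrable_fin_num => //.
  apply: (@integrable_bounded _ _ _ mu _ (q s t (X s w)) M) => //.
    apply: measurable_funTS; exact: (measurable_fun_pair2 _ mq).
  by move=> y By; apply: qM => //; exact: BC'.
rewrite (@integral_comp_density R _ _ P (X s) A C (mX _ s0) mA mC phi H)//; last first.
  exact: measurable_funTS.
rewrite (eq_integral (fun x : measurableTypeR R => (\int[mu]_(y in B) (phi x * q s t x y))%:E)).
  apply: (@integral_rect_swap _ (fun p : R * R => phi p.1 * q s t p.1 p.2) C B (K * M)) => //.
    by apply: measurable_funM => //; exact: measurableT_comp.
  by move=> x y Cx By /=; rewrite normrM ler_pM// ?phiK// qM//; exact: BC'.
move=> x; rewrite inE => Cx; congr EFin; rewrite mulrC /H RintegralZl//.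
apply: (@integrable_bounded _ _ _ mu _ (q s t x) M) => //.
  apply: measurable_funTS; exact: (measurable_fun_pair2 _ mq).
by move=> y By; apply: qM => //; exact: BC'.
Qed.

End markov_chain_densities.

Section chain_convergence.
Context (R : realType).
Local Notation mu := (@lebesgue_measure R).

Definition chain_event d (Om : measurableType d) (X : R -> Om -> R)
    (l : seq (R * set R)) : set Om :=
  foldr (fun p E => X p.1 @^-1` p.2 `&` E) setT l.

Fixpoint increasing_chain (I : set R) (s : R) (l : seq (R * set R)) : Prop :=
  if l is (t, C) :: l' then
    [/\ s < t, measurable C, C `<=` I & increasing_chain I t l']
  else True.

(** The hypotheses of the bounded convergence theorem on a set of finite
    measure. *)
Definition bounded_cvg_on (T : Type) (I : set T) (f_ : nat -> T -> R) (f : T -> R) :=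
  [/\ exists K, forall n x, I x -> `|f_ n x| <= K,
      exists K, forall x, I x -> `|f x| <= K &
      forall x, I x -> f_ ^~ x @ \oo --> f x].

Variables (d_ : nat -> measure_display) (Om_ : forall n, measurableType (d_ n)).
Variables (P_ : forall n, probability (Om_ n) R) (X_ : forall n, R -> Om_ n -> R).
Arguments X_ : clear implicits.
Variables (D_ : nat -> set R) (f_ : nat -> R -> R).
Variables (q_ : nat -> R -> R -> R -> R -> R).
Variables (d : measure_display) (Om : measurableType d).
Variables (P : probability Om R) (X : R -> Om -> R).
Variables (D : set R) (f : R -> R).
Variables (q : R -> R -> R -> R -> R).
Variable I : set R.

Hypothesis M_ : forall n,
  markov_process (P_ n) (X_ n) (D_ n) (density_law (f_ n)) (q_ n).
Hypothesis MX : markov_process P X D (density_law f) q.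
Hypothesis mI : measurable I.
Hypothesis Ioo : (mu I < +oo)%E.
Hypothesis ID_ : forall n, I `<=` D_ n.
Hypothesis ID : I `<=` D.
Hypothesis mf_ : forall n, measurable_fun setT (f_ n).
Hypothesis mf : measurable_fun setT f.
Hypothesis f_f : bounded_cvg_on I f_ f.
Hypothesis mq_ : forall n s t, 0 <= s -> s < t ->
  measurable_fun setT (fun p : R * R => q_ n s t p.1 p.2).
Hypothesis mq : forall s t, 0 <= s -> s < t ->
  measurable_fun setT (fun p : R * R => q s t p.1 p.2).
Hypothesis q_q : forall s t, 0 <= s -> s < t ->
  bounded_cvg_on (I `*` I) (fun n p => q_ n s t p.1 p.2) (fun p => q s t p.1 p.2).

Let finite_cell C : measurable C -> C `<=` I -> (mu C < +oo)%E.
Proof.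
move=> mC CI; apply: le_lt_trans Ioo.
by apply: le_measure; rewrite ?inE.
Qed.

Let bounded_cvgS (C : set R) g_ (g : R -> R) : C `<=` I -> bounded_cvg_on I g_ g ->
  bounded_cvg_on C g_ g.
Proof.
move=> CI [[K gK] [K' gK'] gg]; split.
- by exists K => n x Cx; apply/gK/CI.
- by exists K' => x Cx; apply/gK'/CI.
- by move=> x Cx; apply/gg/CI.
Qed.

Let bounded_Rintegral_cvg (C : set R) g_ (g : R -> R) :
  measurable C -> C `<=` I ->
  (forall n, measurable_fun setT (g_ n)) -> measurable_fun setT g ->
  bounded_cvg_on C g_ g ->
  (\int[mu]_(x in C) g_ n x) @[n --> \oo] --> \int[mu]_(x in C) g x.
Proof.
move=> mC CI mg_ mg [[K gK] _ gg].
apply: (@Rintegral_dct R _ _ mu C g_ g (cst K)) => //.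
- by move=> n; exact: (measurable_funTS (mg_ n)).
- exact: (measurable_funTS mg).
- exact: aeW.
- apply: (@integrable_bounded _ _ _ mu C (cst K) `|K|) => //.
  exact: finite_cell.
Qed.

(** Induction on the list of later times. What is carried along is a density of
    the current position on the event that the earlier cells have been visited,
    for each process of the sequence and for the limit: [markov_density_step]
    produces the next densities, and bounded convergence shows that they again
    converge boundedly. *)
Let cvg_chain_from l : forall s (C : set R) (A_ : forall n, set (Om_ n)) (A : set Om)
    (phi_ : nat -> R -> R) (phi : R -> R),
  0 <= s -> measurable C -> C `<=` I -> increasing_chain I s l ->
  (forall n, natural_filtration (X_ n) s (A_ n)) -> natural_filtration X s A ->
  (forall n, measurable_fun setT (phi_ n)) -> measurable_fun setT phi ->
  bounded_cvg_on C phi_ phi ->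
  (forall n B, measurable B -> B `<=` C ->
    P_ n (A_ n `&` X_ n s @^-1` B) = (\int[mu]_(x in B) (phi_ n x)%:E)%E) ->
  (forall B, measurable B -> B `<=` C ->
    P (A `&` X s @^-1` B) = (\int[mu]_(x in B) (phi x)%:E)%E) ->
  P_ n (A_ n `&` (X_ n s @^-1` C `&` chain_event (X_ n) l)) @[n --> \oo] -->
  P (A `&` (X s @^-1` C `&` chain_event X l)).
Proof.
elim: l => [|[t C'] l IH] s C A_ A phi_ phi s0 mC CI okl FA_ FA mphi_ mphi bc HA_ HA.
  have [[K phiK] [K' phiK'] phiphi] := bc.
  rewrite /= setIT HA//.
  have e n : (\int[mu]_(x in C) (phi_ n x)%:E)%E = (\int[mu]_(x in C) phi_ n x)%:E.
    rewrite /Rintegral fineK//; apply: integrable_fin_num => //.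
    apply: (@integrable_bounded _ _ _ mu _ (phi_ n) K) => //; first exact: finite_cell.
      exact: (measurable_funTS (mphi_ n)).
    by move=> x; exact: phiK.
  have -> : (\int[mu]_(x in C) (phi x)%:E)%E = (\int[mu]_(x in C) phi x)%:E.
    rewrite /Rintegral fineK//; apply: integrable_fin_num => //.
    apply: (@integrable_bounded _ _ _ mu _ phi K') => //; first exact: finite_cell.
    exact: (measurable_funTS mphi).
  rewrite [X in X @ _ --> _](_ : _ = fun n => (\int[mu]_(x in C) phi_ n x)%:E).
    apply: cvg_EFin; first exact: nearW.
    exact: bounded_Rintegral_cvg.
  by apply/funext => n; rewrite setIT HA_// e.
case: okl => st mC' C'I okl.
have t0 : 0 <= t by rewrite (le_trans s0)// ltW.
pose psi_ n y := \int[mu]_(x in C) (phi_ n x * q_ n s t x y).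
pose psi y := \int[mu]_(x in C) (phi x * q s t x y).
have mq_y n y : measurable_fun setT (fun x => q_ n s t x y).
  exact: (measurable_fun_pair1 _ (mq_ n s0 st)).
have mqy y : measurable_fun setT (fun x => q s t x y).
  exact: (measurable_fun_pair1 _ (mq s0 st)).
have [[M qM] [M' qM'] qq] := q_q s0 st.
have [[K phiK] [K' phiK'] phiphi] := bc.
have bpsi : bounded_cvg_on C' psi_ psi.
  have B1 n x y : C x -> C' y -> `|phi_ n x * q_ n s t x y| <= K * M.
    move=> Cx Cy; rewrite normrM ler_pM// ?phiK//.
    by apply: (qM n (x, y)); split; [exact: CI|exact: C'I].
  have B2 x y : C x -> C' y -> `|phi x * q s t x y| <= K' * M'.
    move=> Cx Cy; rewrite normrM ler_pM// ?phiK'//.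
    by apply: (qM' (x, y)); split; [exact: CI|exact: C'I].
  split.
  - exists (K * M * fine (mu C)) => n y Cy.
    apply: Rintegral_bounded => //; first exact: finite_cell.
      exact: (measurable_funTS (measurable_funM (mphi_ n) (mq_y n y))).
    by move=> x Cx; exact: B1.
  - exists (K' * M' * fine (mu C)) => y Cy.
    apply: Rintegral_bounded => //; first exact: finite_cell.
      exact: (measurable_funTS (measurable_funM mphi (mqy y))).
    by move=> x Cx; exact: B2.
  - move=> y Cy; apply: bounded_Rintegral_cvg => //.
    + by move=> n; exact: measurable_funM.
    + exact: measurable_funM.
    + split; [by exists (K * M) => n x Cx; exact: B1
             |by exists (K' * M') => x Cx; exact: B2|].
      move=> x Cx; apply: cvgM; first exact: phiphi.
      by apply: (qq (x, y)); split; [exact: CI|exact: C'I].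
rewrite /= setIA; under eq_fun do rewrite setIA.
apply: (IH t C' _ _ psi_ psi) => //.
- move=> n; apply: natural_filtration_le (ltW st) _.
  by apply: natural_filtrationI => //; exact: natural_filtration_preimage.
- apply: natural_filtration_le (ltW st) _.
  by apply: natural_filtrationI => //; exact: natural_filtration_preimage.
- move=> n; apply: (measurable_Rintegral_param mu (f := fun p : R * R => phi_ n p.2 * q_ n s t p.2 p.1)) => //.
  apply: measurable_funM; first exact: measurableT_comp.
  rewrite (_ : (fun p : R * R => _) =
    (fun p : R * R => q_ n s t p.1 p.2) \o (fun p => (p.2, p.1)))//.
  by apply: measurableT_comp; [exact: mq_|exact: measurable_fun_pair].
- apply: (measurable_Rintegral_param mu (f := fun p : R * R => phi p.2 * q s t p.2 p.1)) => //.
  apply: measurable_funM; first exact: measurableT_comp.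
  rewrite (_ : (fun p : R * R => _) =
    (fun p : R * R => q s t p.1 p.2) \o (fun p => (p.2, p.1)))//.
  by apply: measurableT_comp; [exact: mq|exact: measurable_fun_pair].
- move=> n; apply: (markov_density_step (M_ n) s0 st (FA_ n) mC
    (finite_cell mC CI) mC' (finite_cell mC' C'I) (subset_trans C'I (@ID_ n))
    (mphi_ n) (phiK n) (HA_ n) (mq_ n s0 st) (M := M)).
  by move=> x y Cx Cy; apply: (qM n (x, y)); split; [exact: CI|exact: C'I].
- apply: (markov_density_step MX s0 st FA mC
    (finite_cell mC CI) mC' (finite_cell mC' C'I) (subset_trans C'I ID)
    mphi phiK' HA (mq s0 st) (M := M')).
  by move=> x y Cx Cy; apply: (qM' (x, y)); split; [exact: CI|exact: C'I].
Qed.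

Lemma cvg_chain (C : set R) l :
  measurable C -> C `<=` I -> increasing_chain I 0 l ->
  P_ n (chain_event (X_ n) ((0, C) :: l)) @[n --> \oo] -->
  P (chain_event X ((0, C) :: l)).
Proof.
move=> mC CI okl.
rewrite /= -[X in P X]setTI; under eq_fun do rewrite -[X in P_ _ X]setTI.
apply: (cvg_chain_from (phi_ := f_) (phi := f)) => //.
- by move=> n; exact: natural_filtrationT.
- exact: natural_filtrationT.
- exact: bounded_cvgS.
- by move=> n B mB _; have [_ _ + _] := M_ n; rewrite setTI; apply.
- by move=> B mB _; have [_ _ + _] := MX; rewrite setTI; apply.
Qed.

End chain_convergence.

(** * From cells to bounded continuous functions *)

Section continuous_functions_of_rows.
Context (R : realType).

Lemma continuous_rV_near (N : nat) (f : 'rV[R]_N -> R) (v : 'rV[R]_N) (e : R) :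
  continuous f -> 0 < e ->
  exists2 de : R, 0 < de &
    forall v' : 'rV[R]_N, (forall i, `|v 0 i - v' 0 i| < de) -> `|f v - f v'| < e.
Proof.
move=> cf e0.
have /cvgr_dist_lt/(_ _ e0)/nbhs_ballP[de /= de0 H] := cf v.
exists de => // v' Hv; apply: H; split => // i j.
by rewrite (ord1 i); exact: Hv.
Qed.

(** Rounding each coordinate down to a multiple of 1 / (h + 1) gives functions
    with countably many values, which converge to the given one by continuity. *)
Lemma measurable_fun_rV d (Om : measurableType d) (N : nat)
    (f : 'rV[R]_N -> R) (X : 'I_N -> Om -> R) :
  continuous f -> (forall i, measurable_fun setT (X i)) ->
  measurable_fun setT (fun w => f (\row_i X i w)).
Proof.
move=> cf mX.
pose rnd (h : nat) (x : R) : R := (Num.floor (h.+1%:R * x))%:~R / h.+1%:R.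
apply: (@measurable_fun_cvg _ _ R _ (fun h w => f (\row_i rnd h (X i w)))).
- move=> h _ B mB; rewrite setTI.
  pose cell (k : {ffun 'I_N -> int}) : set Om :=
    \bigcap_(i in [set: 'I_N]) X i @^-1` [set x | Num.floor (h.+1%:R * x) = k i].
  rewrite (_ : _ @^-1` B = \bigcup_(k : {ffun 'I_N -> int})
     (cell k `&` [set _ | B (f (\row_i ((k i)%:~R / h.+1%:R)))])).
    apply: countable_bigcupT_measurable; first exact: countableP.
    move=> k.
    apply: measurableI; last first.
      by have [/= Bk|/= Bk] := pselect (B (f (\row_i ((k i)%:~R / h.+1%:R))));
        [rewrite (_ : [set _ | _] = setT)|rewrite (_ : [set _ | _] = set0)] => //;
        apply/seteqP; split.
    apply: fin_bigcap_measurable => // i _.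
    rewrite -[X in measurable X]setTI; apply: mX => //.
    rewrite (_ : [set x | _] = `[(k i)%:~R / h.+1%:R, (k i + 1)%:~R / h.+1%:R[%classic)//.
    apply/seteqP; split => x /=; rewrite in_itv/=.
      move=> <-; rewrite ler_pdivrMr// ltr_pdivlMr// mulrC.
      exact: floor_itv.
    rewrite ler_pdivrMr// ltr_pdivlMr// mulrC => kx.
    exact/floor_def.
  apply/seteqP; split => w /=.
    move=> Bw; exists [ffun i => Num.floor (h.+1%:R * X i w)] => //.
    split; first by move=> i _ /=; rewrite ffunE.
    rewrite /=; congr (B (f _)): Bw; apply/rowP => i; by rewrite !mxE /rnd ffunE.
  move=> [k _ [kw]]; rewrite /=; congr (B (f _)).
  by apply/rowP => i; rewrite !mxE /rnd (kw i).
- move=> w _; apply/cvgrPdist_lt => e e0.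
  have [de de0 H] := continuous_rV_near (\row_i X i w) cf e0.
  near=> h; apply: H => i; rewrite !mxE /rnd.
  have h0 : 0 < h.+1%:R :> R by [].
  have := floor_itv (h.+1%:R * X i w); set k := (Num.floor _) => /andP[k1 k2].
  rewrite ger0_norm; last by rewrite subr_ge0 ler_pdivrMr// mulrC.
  apply: (@lt_trans _ _ h.+1%:R^-1).
    rewrite ltrBlDr -[X in X + _]mul1r -mulrDl ltr_pdivlMr// mulrC.
    by rewrite addrC -(intrD _ k 1).
  near: h; exact: near_infty_natSinv_lt (PosNum de0).
Unshelve. all: by end_near. Qed.

End continuous_functions_of_rows.

Section chain_events.
Context (R : realType).

Lemma chain_event_map (J : Type) (js : seq J) (tau : J -> R) (C : J -> set R)
    d (Om : measurableType d) (X : R -> Om -> R) (w : Om) :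
  chain_event X [seq (tau j, C j) | j <- js] w <->
  foldr (fun j Q => C j (X (tau j) w) /\ Q) True js.
Proof. by elim: js => //= j js IH; split => -[Cj /IH]. Qed.

Lemma chain_event_enum (m : nat) (tau : 'I_m -> R) (C : 'I_m -> set R)
    d (Om : measurableType d) (X : R -> Om -> R) (w : Om) :
  chain_event X [seq (tau j, C j) | j <- enum 'I_m] w <->
  forall j, C j (X (tau j) w).
Proof.
have -> : (forall j, C j (X (tau j) w)) <->
    (forall j, j \in enum 'I_m -> C j (X (tau j) w)).
  by split=> [h j _|h j]; apply: h; rewrite ?mem_enum.
rewrite chain_event_map; elim: (enum _) => //= j js IH; split.
  by move=> [Cj /IH Cjs] i; rewrite inE => /predU1P[->//|/Cjs].
move=> h; split; first by apply: h; rewrite inE eqxx.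
by apply/IH => i ijs; apply: h; rewrite inE ijs orbT.
Qed.

Lemma increasing_chain_map (I : set R) (J : Type) (js : seq J) (tau : J -> R)
    (C : J -> set R) (s : R) :
  (forall j, measurable (C j) /\ C j `<=` I) ->
  path <%R s [seq tau j | j <- js] ->
  increasing_chain I s [seq (tau j, C j) | j <- js].
Proof.
by move=> hC; elim: js s => //= j js IH s /andP[sj /IH]; have [] := hC j.
Qed.

End chain_events.

Section grid_step_functions.
Context (R : realType) (N m : nat) (sigma : 'I_N -> 'I_m) (tau : 'I_m -> R).
Variables (g : 'rV[R]_N -> R) (M : R).
Hypothesis g0 : forall v : 'rV[R]_N, 0 <= g v.
Hypothesis gM : forall v, g v <= M.
Hypothesis cg : continuous g.

(** For k < (h + 1)^2 these cells fill the interval from 1 / (h + 1) to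
    h + 1 + 1 / (h + 1): they keep away from 0 and exhaust (0, oo) as h grows. *)
Definition grid_cell (h k : nat) : set R :=
  `[k.+1%:R / h.+1%:R, k.+2%:R / h.+1%:R[.

Local Notation index h := {ffun 'I_m -> 'I_(h.+1 * h.+1)}.

Definition grid_inf (h : nat) (k : index h) : R :=
  inf [set g v | v in [set v : 'rV[R]_N | forall i, grid_cell h (k (sigma i)) (v 0 i)]].

Definition grid_chain (h : nat) (k : index h) : seq (R * set R) :=
  [seq (tau j, grid_cell h (k j)) | j <- enum 'I_m].

Lemma measurable_grid_cell h k : measurable (grid_cell h k).
Proof. exact: measurable_itv. Qed.

Lemma grid_cell_sub h (k : 'I_(h.+1 * h.+1)) :
  grid_cell h k `<=` `[h.+1%:R^-1, h.+2%:R].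
Proof.
move=> x; rewrite /grid_cell /= !in_itv /= => /andP[kx xk].
have h0 : 0 < h.+1%:R :> R by [].
apply/andP; split.
  by rewrite (le_trans _ kx)// ler_pdivlMr// mulVf// ler1n.
rewrite (le_trans (ltW xk))// ler_pdivrMr// -natrM ler_nat.
by have := ltn_ord k; move: (nat_of_ord k) => n; rewrite [(h.+2 * _)%N]mulSn; lia.
Qed.

Lemma grid_cell_uniq h (k k' : nat) x :
  grid_cell h k x -> grid_cell h k' x -> k = k'.
Proof.
wlog kk' : k k' / (k <= k')%N.
  by move=> H kx k'x; have /orP[] := leq_total k k' => kk';
    [exact: H|apply/esym; exact: H].
rewrite /grid_cell /= !in_itv /= => /andP[_ xk] /andP[k'x _].
have := le_lt_trans k'x xk; rewrite ltr_pM2r ?invr_gt0// ltr_nat; lia.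
Qed.

Lemma grid_cell_nonempty h (k : index h) :
  [set v : 'rV[R]_N | forall i, grid_cell h (k (sigma i)) (v 0 i)] !=set0.
Proof.
exists (\row_i ((k (sigma i)).+1%:R / h.+1%:R)) => i /=.
rewrite mxE /grid_cell /= in_itv /= lexx /=.
by rewrite ltr_pM2r ?invr_gt0// ltr_nat.
Qed.

Lemma grid_inf_ge0 h (k : index h) : 0 <= grid_inf k.
Proof.
apply: lb_le_inf; last by move=> _ [v _ <-]; exact: g0.
by have [v hv] := grid_cell_nonempty k; exists (g v), v.
Qed.

Lemma grid_inf_le h (k : index h) (v : 'rV[R]_N) :
  (forall i, grid_cell h (k (sigma i)) (v 0 i)) -> grid_inf k <= g v.
Proof.
move=> hv; apply: ge_inf; last by exists v.
by exists 0 => _ [u _ <-]; exact: g0.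
Qed.

Context d (Om : measurableType d) (P : probability Om R) (X : R -> Om -> R).
Hypothesis mX : forall j, measurable_fun setT (X (tau j)).

(** The infimum over a product of cells makes the step function a minorant, so
    that only lower bounds have to pass to the limit. *)
Definition grid_step (h : nat) (w : Om) : R :=
  \sum_(k : index h) grid_inf k * \1_(chain_event X (grid_chain k)) w.

Let G (w : Om) := g (\row_i X (tau (sigma i)) w).

Lemma measurable_grid_event h (k : index h) :
  measurable (chain_event X (grid_chain k)).
Proof.
rewrite /grid_chain; elim: (enum _) => [|j js IH] /=; first exact: measurableT.
apply: measurableI => //.
by rewrite -[X in measurable X]setTI; apply: mX => //; exact: measurable_grid_cell.
Qed.

Lemma grid_step_on h (k : index h) w : chain_event X (grid_chain k) w ->
  grid_step h w = grid_inf k.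
Proof.
move=> kw; rewrite /grid_step (bigD1 k)//= indicE mem_set// mulr1 big1 ?addr0//.
move=> k' k'k; rewrite indicE memNset ?mulr0// => k'w.
move: k'k => /eqP; apply; apply/ffunP => j; apply/val_inj.
move/chain_event_enum : kw => /(_ j) /= kw.
move/chain_event_enum : k'w => /(_ j) /= k'w.
exact: grid_cell_uniq k'w kw.
Qed.

Lemma grid_step_bounds h w : 0 <= grid_step h w <= G w.
Proof.
have [[k kw]|nk] := pselect (exists k : index h, chain_event X (grid_chain k) w).
  rewrite (grid_step_on kw) grid_inf_ge0 /= grid_inf_le// => i.
  by move/chain_event_enum : kw => /(_ (sigma i)) /=; rewrite mxE.
rewrite /grid_step big1 ?lexx ?g0// => k _.
by rewrite indicE memNset ?mulr0// => kw; apply: nk; exists k.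
Qed.

Lemma measurable_grid_step h : measurable_fun setT (grid_step h).
Proof.
apply: measurable_sum => k; apply: measurable_funM => //.
exact/measurable_indic/measurable_grid_event.
Qed.

Lemma Rintegral_grid_step h : \int[P]_w grid_step h w =
  \sum_(k : index h) grid_inf k * fine (P (chain_event X (grid_chain k))).
Proof.
have mk := @measurable_grid_event h.
rewrite /Rintegral /grid_step.
under eq_integral do rewrite -sumEFin.
rewrite ge0_integral_sum//; last 2 first.
- move=> k; apply/measurable_EFinP/measurable_funM => //; exact: measurable_indic.
- by move=> k w _; rewrite lee_fin mulr_ge0// grid_inf_ge0.
rewrite [X in fine X](_ : _ = \sum_(k : index h)
    (grid_inf k * fine (P (chain_event X (grid_chain k))))%:E)%E.
  by rewrite sumEFin.
apply: eq_bigr => k _; under eq_integral do rewrite EFinM.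
rewrite ge0_integralZl_EFin//; last 2 first.
- exact/measurable_EFinP/measurable_indic.
- exact: grid_inf_ge0.
by rewrite integral_indic// setIT EFinM fineK// fin_num_measure.
Qed.

(** A path that is positive at the given times is eventually in the range of the
    grid, and each product of cells is then so small that continuity bounds the
    oscillation of g by e / 2. *)
Lemma cvg_grid_step w : (forall j, 0 < X (tau j) w) ->
  grid_step h w @[h --> \oo] --> G w.
Proof.
move=> X0; apply/cvgrPdist_lt => e e0.
have [de de0 H] := continuous_rV_near (\row_i X (tau (sigma i)) w) cg (divr_gt0 e0 (ltr0n _ 2)).
have hX : \forall h \near \oo, forall j, h.+1%:R^-1 <= X (tau j) w.
  apply: filter_forall => j; near=> h; apply/ltW; near: h.
  exact: near_infty_natSinv_lt (PosNum (X0 j)).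
have Xh : \forall h \near \oo, forall j, X (tau j) w < h.+1%:R.
  apply: filter_forall => j.
  have Xj0 : 0 < (X (tau j) w)^-1 by rewrite invr_gt0.
  near=> h; rewrite -ltf_pV2 ?posrE//; near: h.
  exact: near_infty_natSinv_lt (PosNum Xj0).
near=> h.
have h0 : 0 < h.+1%:R :> R by [].
have hXh : forall j, h.+1%:R^-1 <= X (tau j) w by near: h.
have Xhh : forall j, X (tau j) w < h.+1%:R by near: h.
have hde : h.+1%:R^-1 < de by near: h; exact: near_infty_natSinv_lt (PosNum de0).
pose x j := h.+1%:R * X (tau j) w.
have x1 j : 1 <= x j by rewrite -(mulfV (lt0r_neq0 h0)) ler_pM2l.
have x0 j : 0 <= x j by rewrite (le_trans _ (x1 j)).
have xt j := truncn_itv (x0 j).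
have t0 j : (0 < Num.truncn (x j))%N.
  rewrite -ltnS -(ltr_nat R).
  by have /andP[_] := xt j; apply: le_lt_trans.
have kj j : ((Num.truncn (x j)).-1 < h.+1 * h.+1)%N.
  apply: (leq_ltn_trans (leq_pred _)); rewrite -(ltr_nat R) natrM.
  have /andP[tx _] := xt j; apply: (le_lt_trans tx).
  by rewrite /x ltr_pM2l.
(* cells start at 1 / (h + 1), so the cell with index k begins at the multiple
   k + 1 of 1 / (h + 1) *)
pose k : index h := [ffun j => Ordinal (kj j)].
have kw : chain_event X (grid_chain k) w.
  apply/chain_event_enum => j; rewrite /grid_cell /= in_itv /= ffunE /= prednK//.
  have /andP[tx xt'] := xt j.
  by rewrite ler_pdivrMr// ltr_pdivlMr// mulrC tx.
rewrite (grid_step_on kw) ger0_norm ?subr_ge0; last first.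
  by rewrite -(grid_step_on kw); have /andP[] := grid_step_bounds h w.
apply: (@le_lt_trans _ _ (e / 2)); last by rewrite ltr_pdivrMr// ltr_pMr// ltr1n.
rewrite lerBlDl -lerBlDr; apply: lb_le_inf.
  by have [v hv] := grid_cell_nonempty k; exists (g v), v.
move=> _ [v hv <-]; rewrite lerBlDr -lerBlDl (le_trans (ler_norm _))//.
apply/ltW/H => i; rewrite mxE; apply: lt_trans hde.
have := hv i; rewrite /grid_cell /= in_itv /=.
move/chain_event_enum : kw => /(_ (sigma i)).
rewrite /grid_cell /= in_itv /=; set a := (nat_of_ord (k (sigma i))).+1; move=> /andP[a1 a2] /andP[b1 b2].
have ea : a.+1%:R / h.+1%:R = a%:R / h.+1%:R + h.+1%:R^-1 :> R.
  by rewrite -(natr1 a) mulrDl mul1r.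
rewrite ea in a2 b2; rewrite ltr_norml.
have c1 := lt_le_trans a2 (lerD b1 (lexx _)).
have c2 := lt_le_trans b2 (lerD a1 (lexx _)).
by rewrite ltrBlDl c1 ltrNl opprB ltrBlDl c2.
Unshelve. all: by end_near. Qed.

End grid_step_functions.

Section weak_convergence_from_cells.
Context (R : realType) (N m : nat) (sigma : 'I_N -> 'I_m) (tau : 'I_m -> R).
Variables (d_ : nat -> measure_display) (Om_ : forall n, measurableType (d_ n)).
Variables (P_ : forall n, probability (Om_ n) R) (X_ : forall n, R -> Om_ n -> R).
Arguments X_ : clear implicits.
Context d (Om : measurableType d) (P : probability Om R) (X : R -> Om -> R).
Hypothesis mX_ : forall n j, measurable_fun setT (X_ n (tau j)).
Hypothesis mX : forall j, measurable_fun setT (X (tau j)).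
Hypothesis X_gt0 : forall j, {ae P, forall w, 0 < X (tau j) w}.
Hypothesis cells : forall h (k : {ffun 'I_m -> 'I_(h.+1 * h.+1)}),
  P_ n (chain_event (X_ n) (grid_chain tau k)) @[n --> \oo] -->
  P (chain_event X (grid_chain tau k)).

Let prob_lty d0 (Om0 : measurableType d0) (P0 : probability Om0 R) :
  (P0 setT < +oo)%E.
Proof. by apply: (@le_lt_trans _ _ 1%E); [exact: probability_le1|rewrite ltry]. Qed.

Let integrable_comp d0 (Om0 : measurableType d0) (P0 : probability Om0 R)
    (X0 : R -> Om0 -> R) (g : 'rV[R]_N -> R) (M : R) :
  (forall j, measurable_fun setT (X0 (tau j))) -> continuous g ->
  (forall v, `|g v| <= M) ->
  P0.-integrable setT (EFin \o (fun w => g (\row_i X0 (tau (sigma i)) w))).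
Proof.
move=> mX0 cg gM; apply: (@integrable_bounded _ _ _ P0 _ _ M) => //.
  exact: prob_lty.
by apply: measurable_fun_rV => // i; exact: mX0.
Qed.

(** The expectation of a grid step function is a finite combination of
    probabilities of cells, hence converges. Under the limit law the step
    functions approximate g almost surely, because the limit process is positive. *)
Let lower (g : 'rV[R]_N -> R) (M e : R) :
  continuous g -> (forall v, 0 <= g v) -> (forall v, g v <= M) -> 0 < e ->
  \forall n \near \oo,
    \int[P]_w g (\row_i X (tau (sigma i)) w) - e <=
    \int[P_ n]_w g (\row_i X_ n (tau (sigma i)) w).
Proof.
move=> cg g0 gM e0.
have gM' v : `|g v| <= M by rewrite ger0_norm.
have cvg_step : (\int[P]_w grid_step sigma tau g X h w) @[h --> \oo] -->
    \int[P]_w g (\row_i X (tau (sigma i)) w).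
  apply: (@Rintegral_dct R _ _ P _ _ _ (cst M)) => //.
  - by move=> h; exact: measurable_grid_step.
  - by apply: measurable_fun_rV => // i.
  - have : {ae P, forall w j, 0 < X (tau j) w} by exact: filter_forall.
    apply: filterS => w Xw _; exact: cvg_grid_step.
  - by apply: (@integrable_bounded _ _ _ P _ _ `|M|) => //; exact: prob_lty.
  - move=> h w _; have /andP[s0 sg] := grid_step_bounds sigma tau g0 X h w.
    by rewrite ger0_norm// (le_trans sg).
have e20 : 0 < e / 2 by rewrite divr_gt0.
have : \forall h \near \oo, \int[P]_w g (\row_i X (tau (sigma i)) w) - e / 2 <
    \int[P]_w grid_step sigma tau g X h w.
  by apply: cvgr_gt cvg_step _ _; rewrite ltrBlDr ltrDl.
move=> [h _ /(_ h (leqnn h)) /= hS].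
have cvg_sum : (\int[P_ n]_w grid_step sigma tau g (X_ n) h w) @[n --> \oo] -->
    \int[P]_w grid_step sigma tau g X h w.
  rewrite Rintegral_grid_step//; under eq_fun do rewrite Rintegral_grid_step//.
  apply: cvg_big => [|k _]; first exact: add_continuous.
  apply: cvgM; first exact: cvg_cst.
  apply: fine_cvg; rewrite fineK; first exact: cells.
  by rewrite fin_num_measure//; exact: measurable_grid_event.
have : \forall n \near \oo, \int[P]_w grid_step sigma tau g X h w - e / 2 <
    \int[P_ n]_w grid_step sigma tau g (X_ n) h w.
  by apply: cvgr_gt cvg_sum _ _; rewrite ltrBlDr ltrDl.
apply: filterS => n Sn.
have : \int[P_ n]_w grid_step sigma tau g (X_ n) h w <=
    \int[P_ n]_w g (\row_i X_ n (tau (sigma i)) w).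
  apply: le_Rintegral => //.
  - apply: (@integrable_bounded _ _ _ (P_ n) _ _ M) => //; first exact: prob_lty.
      exact: measurable_grid_step.
    move=> w _; have /andP[s0 sg] := grid_step_bounds sigma tau g0 (X_ n) h w.
    by rewrite ger0_norm// (le_trans sg).
  - exact: integrable_comp gM'.
  - by move=> w _; have /andP[] := grid_step_bounds sigma tau g0 (X_ n) h w.
have -> : e = e / 2 + e / 2 by rewrite -splitr.
lra.
Qed.

(** Apply the lower bound to the nonnegative functions M + f and M - f: since all
    measures have total mass 1, the constants M cancel and the two bounds meet. *)
Lemma cvg_expectation_of_cells (f : 'rV[R]_N -> R) (M : R) :
  continuous f -> (forall v, `|f v| <= M) ->
  ('E_(P_ n)[fun w => f (\row_i X_ n (tau (sigma i)) w)] @[n --> \oo] -->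
   'E_P[fun w => f (\row_i X (tau (sigma i)) w)])%E.
Proof.
move=> cf fM.
have EE d0 (Om0 : measurableType d0) (P0 : probability Om0 R) (X0 : R -> Om0 -> R) :
  (forall j, measurable_fun setT (X0 (tau j))) ->
  ('E_P0[fun w => f (\row_i X0 (tau (sigma i)) w)] =
   (\int[P0]_w f (\row_i X0 (tau (sigma i)) w))%:E)%E.
  move=> mX0; rewrite unlock /Rintegral fineK//.
  by apply: integrable_fin_num => //; exact: (integrable_comp P0 mX0 cf fM).
rewrite EE//; under eq_fun do rewrite EE//.
apply: cvg_EFin; first exact: nearW.
apply/cvgrPdist_le => e e0 /=.
have shift (s : R) d0 (Om0 : measurableType d0) (P0 : probability Om0 R) (X0 : R -> Om0 -> R) :
  (forall j, measurable_fun setT (X0 (tau j))) ->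
  \int[P0]_w (M + s * f (\row_i X0 (tau (sigma i)) w)) =
  M + s * \int[P0]_w f (\row_i X0 (tau (sigma i)) w).
  move=> mX0.
  have fi := integrable_comp P0 mX0 cf fM.
  rewrite RintegralD//; last 2 first.
  - by apply: (@integrable_bounded _ _ _ P0 _ _ `|M|) => //; exact: prob_lty.
  - have := integrable_comp P0 (g := fun v => s * f v) (M := `|s| * M) mX0.
    apply; first by move=> v; exact: cvgM (cvg_cst s) (cf v).
    by move=> v; rewrite normrM ler_wpM2l.
  rewrite Rintegral_cst// RintegralZl//; congr (_ + _).
  by rewrite -[RHS]mulr1; congr (_ * _); exact: (congr1 fine (probability_setT P0)).
have bnd v : - M <= f v <= M by rewrite -ler_norml.
have cs s : continuous (fun v => M + s * f v).
  by move=> v; exact: cvgD (cvg_cst M) (cvgM (cvg_cst s) (cf v)).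
have := lower (M := M + M) (cs 1) _ _ e0.
have := lower (M := M + M) (cs (-1)) _ _ e0.
rewrite !shift//.
have q1 v : 0 <= M + 1 * f v by have := bnd v; rewrite mul1r; lra.
have q2 v : M + 1 * f v <= M + M by have := bnd v; rewrite mul1r; lra.
have q3 v : 0 <= M + -1 * f v by have := bnd v; rewrite mulN1r; lra.
have q4 v : M + -1 * f v <= M + M by have := bnd v; rewrite mulN1r; lra.
move=> /(_ q3 q4) L1 /(_ q1 q2) L2.
near=> n.
have : M + 1 * (\int[P]_w f (\row_i X (tau (sigma i)) w)) - e <=
    \int[P_ n]_w (M + 1 * f (\row_i X_ n (tau (sigma i)) w)) by near: n.
have : M + -1 * (\int[P]_w f (\row_i X (tau (sigma i)) w)) - e <=
    \int[P_ n]_w (M + -1 * f (\row_i X_ n (tau (sigma i)) w)) by near: n.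
rewrite !shift// => A1 A2; rewrite ler_norml; apply/andP; split; lra.
Unshelve. all: by end_near. Qed.

End weak_convergence_from_cells.

Section finite_dimensional_convergence.
Context (R : realType).
Local Notation mu := (@lebesgue_measure R).

(** The given times may be unordered and repeated; they are listed increasingly,
    starting from 0 because the initial law is known there. *)
Lemma sorted_times (N : nat) (t : 'I_N -> R) : (forall i, 0 <= t i) ->
  exists (m : nat) (tau : m.+1.-tuple R) (sigma : 'I_N -> 'I_m.+1),
    [/\ forall i, t i = tnth tau (sigma i), forall j, 0 <= tnth tau j &
        exists s, (tau = 0 :: s :> seq R) /\ path <%R 0 s].
Proof.
move=> t0; pose ts := sort <=%R (undup (0 :: codom t)).
have mem_ts x : (x \in ts) = (x \in 0 :: codom t) by rewrite mem_sort mem_undup.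
have ts_ge0 x : x \in ts -> 0 <= x.
  by rewrite mem_ts inE => /predU1P[->//|/codomP[i ->]]; exact: t0.
have ts_sorted : sorted <%R ts.
  by rewrite lt_sorted_uniq_le sort_uniq undup_uniq sort_le_sorted.
have [s ts0] : exists s, ts = 0 :: s.
  have ts0 : 0 \in ts by rewrite mem_ts inE eqxx.
  case: ts ts_ge0 ts_sorted ts0 {mem_ts} => // x s ge0 xs.
  rewrite inE => /predU1P[->|s0]; first by exists s.
  have := order_path_min lt_trans xs => /allP/(_ _ s0).
  by rewrite ltNge ge0// inE eqxx.
have sz : size ts == (size s).+1 by rewrite ts0.
have ti i : exists j : 'I_(size s).+1, t i = tnth (Tuple sz) j.
  have : t i \in ts by rewrite mem_ts inE codom_f orbT.
  by move=> /(tnthP (Tuple sz)).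
have [sigma sigmaE] := choice ti.
exists (size s), (Tuple sz), sigma; split => //.
- by move=> j; apply: ts_ge0; exact: (mem_tnth j (Tuple sz)).
- by exists s; split => //; move: ts_sorted; rewrite ts0.
Qed.

Variables (d_ : nat -> measure_display) (Om_ : forall n, measurableType (d_ n)).
Variables (P_ : forall n, probability (Om_ n) R) (X_ : forall n, R -> Om_ n -> R).
Arguments X_ : clear implicits.
Variables (f_ : nat -> R -> R).
Variables (q_ : nat -> R -> R -> R -> R -> R).
Variables (d : measure_display) (Om : measurableType d).
Variables (P : probability Om R) (X : R -> Om -> R) (f : R -> R).
Variables (q : R -> R -> R -> R -> R).

Hypothesis M_ : forall n,
  markov_process (P_ n) (X_ n) setT (density_law (f_ n)) (q_ n).
Hypothesis MX : markov_process P X `]0, +oo[ (density_law f) q.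
Hypothesis mf_ : forall n, measurable_fun setT (f_ n).
Hypothesis mf : measurable_fun setT f.
Hypothesis f_f : forall lo hi : R, 0 < lo -> bounded_cvg_on `[lo, hi] f_ f.
Hypothesis mq_ : forall n (s t : R), 0 <= s -> s < t ->
  measurable_fun setT (fun p : R * R => q_ n s t p.1 p.2).
Hypothesis mq : forall s t : R, 0 <= s -> s < t ->
  measurable_fun setT (fun p : R * R => q s t p.1 p.2).
Hypothesis q_q : forall lo hi s t : R, 0 < lo -> 0 <= s -> s < t ->
  bounded_cvg_on (`[lo, hi] `*` `[lo, hi])
    (fun n p => q_ n s t p.1 p.2) (fun p => q s t p.1 p.2).

(** For a fixed grid all cells lie in one compact interval of (0, oo), which is
    where convergence of the densities is assumed. *)
Lemma cvg_expectation_of_densities (N : nat) (t : 'I_N -> R)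
    (g : 'rV[R]_N -> R) (M : R) :
  (forall i, 0 <= t i) -> continuous g -> (forall v, `|g v| <= M) ->
  ('E_(P_ n)[fun w => g (\row_i X_ n (t i) w)] @[n --> \oo] -->
   'E_P[fun w => g (\row_i X (t i) w)])%E.
Proof.
move=> t0 cg gM.
have [m [tau [sigma [tE tau0 [s [taus s_sorted]]]]]] := sorted_times t0.
have -> : (fun w => g (\row_i X (t i) w)) =
    (fun w => g (\row_i X (tnth tau (sigma i)) w)).
  by apply/funext => w; congr g; apply/rowP => i; rewrite !mxE tE.
rewrite (_ : (fun n => _) = fun n => 'E_(P_ n)[fun w => g (\row_i X_ n (tnth tau (sigma i)) w)])%E; last first.
  apply/funext => n; congr ('E_(_)[_])%E.
  by apply/funext => w; congr g; apply/rowP => i; rewrite !mxE tE.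
apply: (@cvg_expectation_of_cells R N m.+1 sigma (tnth tau) _ _ P_ X_ _ _ P X _ _ _ _ g M) => //.
- by move=> n j; have [mX _ _ _] := M_ n; exact: mX.
- by move=> j; have [mX _ _ _] := MX; exact: mX.
- move=> j; have [_ XD _ _] := MX; apply: filterS (XD _ (tau0 j)) => w /=.
  by rewrite in_itv/= andbT.
- move=> h k; pose I : set R := `[h.+1%:R^-1, h.+2%:R]%classic.
  have Ioo : (mu I < +oo)%E.
    by rewrite /I lebesgue_measure_itv; case: ifP => // _; rewrite -EFinD ltry.
  have h0 : 0 < h.+1%:R^-1 :> R by [].
  have ID : I `<=` `]0, +oo[.
    by move=> x; rewrite /I /= !in_itv /= andbT => /andP[hx _]; exact: lt_le_trans hx.
  have cellI j : measurable (grid_cell h (k j) : set R) /\ grid_cell h (k j) `<=` I.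
    by split; [exact: measurable_grid_cell|exact: grid_cell_sub].
  rewrite /grid_chain enum_ordSl /= -map_comp.
  have -> : tnth tau ord0 = 0 by rewrite (tnth_nth 0) taus.
  apply: (@cvg_chain R d_ Om_ P_ X_ (fun=> setT) f_ q_ d Om P X `]0, +oo[ f q I) => //.
  + exact: measurable_itv.
  + exact: (f_f _ h0).
  + by move=> s1 t1 s0 st; exact: (q_q _ h0 s0 st).
  + by have [] := cellI ord0.
  + apply: (increasing_chain_map (tau := tnth tau \o lift ord0)
      (C := fun j => grid_cell h (k (lift ord0 j)))) => //.
    have := map_tnth_enum tau; rewrite taus enum_ordSl /= -map_comp => -[_ ->].
    exact: s_sorted.
Qed.

End finite_dimensional_convergence.

(** * Scaling space and time in a Markov process *)

Section scaled_markov_process.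
Context (R : realType).
Local Notation mu := (@lebesgue_measure R).

(** A positive factor can be taken out even if h is not integrable, as it commutes
    with the difference of the integrals of the positive and negative parts. *)
Lemma integralZl_gt0 (c : R) (D : set R) (h : R -> R) : 0 < c ->
  measurable D -> measurable_fun D h ->
  (\int[mu]_(x in D) (c * h x)%:E = c%:E * \int[mu]_(x in D) (h x)%:E)%E.
Proof.
move=> c0 mD mh; transitivity (c%:E * \int[mu]_(x in D) (EFin \o h) x)%E => //.
rewrite integralE [in RHS]integralE.
have mEh : measurable_fun D (EFin \o h) by exact/measurable_EFinP.
rewrite (eq_integral (fun x : measurableTypeR R => c%:E * (EFin \o h)^\+ x)%E); last first.
  move=> x _; rewrite !funeposE /= -!EFin_max -EFinM.
  by rewrite -[in LHS](mulr0 c) maxr_pMr// ltW.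
rewrite ge0_integralZl_EFin//; [|exact: measurable_funepos|exact: ltW].
rewrite [X in (_ - X)%E](eq_integral (fun x : measurableTypeR R => c%:E * (EFin \o h)^\- x)%E); last first.
  move=> x _; rewrite !funenegE /= -!EFin_max -EFinM.
  by rewrite -mulrN -[in LHS](mulr0 c) maxr_pMr// ltW.
rewrite ge0_integralZl_EFin//; [|exact: measurable_funeneg|exact: ltW].
set A := (X in (c%:E * X - _)%E).
set B := (X in (_ - c%:E * X)%E).
rewrite [X in (_ = _ * (X - _))%E](_ : _ = A)//.
rewrite [X in (_ = _ * (_ - X))%E](_ : _ = B)//.
have A0 : (0 <= A)%E by exact: integral_ge0.
have B0 : (0 <= B)%E by exact: integral_ge0.
move: A B A0 B0 => [x| |] [y| |] //= _ _.
- by congr EFin; rewrite mulrBr.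
- by rewrite /= gt0_muleNy ?gt0_muley ?lte_fin.
- by rewrite /= !gt0_muley ?lte_fin.
- by rewrite /= !gt0_muley ?lte_fin//= gt0_muleNy ?lte_fin.
Qed.

Lemma density_law_scale (e : R) (h : R -> R) (B : set R) : 0 < e ->
  measurable_fun setT h -> measurable B ->
  density_law (fun x => e^-1 * h (x / e)) B =
  density_law h ((fun x => e * x) @^-1` B).
Proof.
move=> e0 mh mB; rewrite /density_law.
have mpre : measurable ((fun x : R => e * x) @^-1` B).
  by rewrite -[X in measurable X]setTI; apply: (mulrl_measurable e).
have ei0 : 0 < e^-1 by rewrite invr_gt0.
have mhe : measurable_fun setT (fun x : R => h (x / e)).
  by apply: measurableT_comp => //; apply: measurable_funM.
rewrite (@integralZl_gt0 e^-1 B (fun x => h (x / e)))//; last exact: measurable_funTS.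
rewrite (integral_scale ei0 mpre); last by apply/measurable_EFinP; exact: measurable_funTS.
congr (_ * _)%E; rewrite (_ : _ @^-1` (_ @^-1` B) = B).
  by apply: eq_integral => x _; rewrite mulrC.
apply/seteqP; split => x /=; by rewrite mulVKf// lt0r_neq0.
Qed.

(** The past of the rescaled process before s is contained in the past of Z
    before s T, so the Markov property of Z applies; the densities are obtained
    by substitution. *)
Lemma markov_process_scale d (Om : measurableType d) (P : probability Om R)
    (Z : R -> Om -> R) (f : R -> R) (q : R -> R -> R -> R -> R) (e T : R) :
  0 < e -> 0 < T ->
  measurable_fun setT f ->
  (forall s t x, 0 <= s -> s < t -> measurable_fun setT (q s t x)) ->
  markov_process P Z setT (density_law f) q ->
  markov_process P (fun t w => e * Z (t * T) w) setT
    (density_law (fun x => e^-1 * f (x / e)))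
    (fun s t x y => e^-1 * q (s * T) (t * T) (x / e) (y / e)).
Proof.
move=> e0 T0 mf mq [mZ ZD Z0 ZM].
have mpre (B : set R) : measurable B -> measurable ((fun x => e * x) @^-1` B).
  by move=> mB; rewrite -[X in measurable X]setTI; apply: (mulrl_measurable e).
split.
- move=> t t0; apply: measurable_funM => //; apply: mZ.
  by rewrite mulr_ge0// ltW.
- by move=> t t0; exact: aeW.
- move=> B mB; rewrite density_law_scale// -Z0; last exact: mpre.
  by rewrite mul0r.
- move=> s t s0 st A FA B mB.
  have sT0 : 0 <= s * T by rewrite mulr_ge0// ltW.
  have stT : s * T < t * T by rewrite ltr_pM2r.
  have FA' : natural_filtration Z (s * T) A.
    move: FA; apply: smallest_sub; first exact: smallest_sigma_algebra.
    move=> _ [r [C [/andP[r0 rs] mC ->]]].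
    apply: sub_sigma_algebra; exists (r * T), ((fun x => e * x) @^-1` C).
    split; [|exact: mpre|by []].
    by rewrite mulr_ge0 ?(ltW T0)//= ler_pM2r.
  have := ZM _ _ sT0 stT _ FA' _ (mpre _ mB).
  rewrite (_ : (fun w => e * Z (t * T) w) @^-1` B = Z (t * T) @^-1` ((fun x => e * x) @^-1` B))//.
  move=> ->; apply: eq_integral => w _; rewrite !setIT.
  rewrite [RHS]density_law_scale//; last exact: mq.
  by rewrite [e * _ / e]mulrAC divff ?mul1r// lt0r_neq0.
Qed.

End scaled_markov_process.

(** * Bessel and gamma functions as real integrals *)

Section special_functions_as_real_integrals.
Context (R : realType).
Local Notation mu := (@lebesgue_measure R).
Implicit Types (u x r w alpha : R).
Local Open Scope complex_scope.

(** K_(i u)(x), by cosh(i u w) = cos(u w). *)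
Definition cos_bessel (u x : R) : R :=
  \int[mu]_(w in `[0, +oo[) (expR (- (x * coshR w)) * cos (u * w)).

(** With [gamma_im]: the real and imaginary parts of Gamma(1 + i u), by
    r^(i u) = cos(u ln r) + i sin(u ln r). *)
Definition gamma_re (u : R) : R :=
  \int[mu]_(r in `]0, +oo[) (cos (u * ln r) * expR (- r)).

Definition gamma_im (u : R) : R :=
  \int[mu]_(r in `]0, +oo[) (sin (u * ln r) * expR (- r)).

Lemma ccosh_imaginary u w : ccosh ((0 +i* u) * w%:C) = (cos (u * w))%:C.
Proof.
rewrite /ccosh /cexp /=.
rewrite !(mul0r, mulr0, add0r, subr0, addr0, oppr0, sub0r, expR0).
rewrite cosN sinN.
by apply/eqP; rewrite eq_complex /=; apply/andP; split; apply/eqP; field.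
Qed.

Lemma ccosh_real alpha w : ccosh (alpha%:C * w%:C) = (coshR (alpha * w))%:C.
Proof.
rewrite /ccosh /cexp /coshR /=.
rewrite !(mul0r, mulr0, add0r, subr0, addr0, oppr0, sub0r, expR0, cos0, sin0).
by apply/eqP; rewrite eq_complex /=; apply/andP; split; apply/eqP; field.
Qed.

Lemma besselK_imaginary u x : besselK (0 +i* u) x = (cos_bessel u x)%:C.
Proof.
rewrite /besselK /cintegral; congr (_ +i* _).
  apply: eq_Rintegral => w _; rewrite ccosh_imaginary /=.
  by rewrite mulr0 subr0.
rewrite /Rintegral integral0_eq// => w _; rewrite ccosh_imaginary /=.
by rewrite mulr0 mul0r addr0.
Qed.

Lemma besselKr_integral alpha x : besselKr alpha x =
  \int[mu]_(w in `[0, +oo[) (expR (- (x * coshR w)) * coshR (alpha * w)).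
Proof.
apply: (@eq_Rintegral _ _ _ mu _ _ (fun w =>
  complex.Re ((expR (- (x * coshR w)))%:C * ccosh (alpha%:C * w%:C)))) => w _.
by rewrite ccosh_real /= mulr0 subr0.
Qed.

Lemma normc_sqM (z1 z2 : R[i]) : normc_sq (z1 * z2) = normc_sq z1 * normc_sq z2.
Proof. by case: z1 z2 => [a b] [c d]; rewrite /normc_sq /=; ring. Qed.

Lemma normc_sqV (z : R[i]) : normc_sq z^-1 = (normc_sq z)^-1.
Proof.
case: z => [a b]; rewrite /normc_sq /=.
have [e0|e0] := eqVneq (a ^+ 2 + b ^+ 2) 0; last by field.
have /andP[/eqP -> /eqP ->] : (a ^+ 2 == 0) && (b ^+ 2 == 0).
  by rewrite -paddr_eq0 ?sqr_ge0// e0.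
by rewrite !(addr0, invr0, mulr0, oppr0) expr0n /= addr0.
Qed.

(** On the imaginary axis one step of the functional equation leads to Euler's
    integral: Gamma(i u) = Gamma(1 + i u) / (i u). *)
Lemma normc_sq_cGamma u : 0 < u ->
  normc_sq (cGamma (0 +i* u)) = (gamma_re u ^+ 2 + gamma_im u ^+ 2) / u ^+ 2.
Proof.
move=> u0; rewrite /cGamma /gamma_shift /= ltxx oppr0 truncn0.
rewrite big_ord1 /= normc_sqM normc_sqV.
congr (_ / _); last first.
  rewrite /normc_sq /=; ring.
rewrite /normc_sq /euler_gamma /cintegral /=.
congr (_ ^+ 2 + _ ^+ 2).
  apply: eq_Rintegral => r _.
  by rewrite !(add0r, subr0, addr0, subrr, mul0r, mulr0, oppr0, expR0, mul1r).
apply: eq_Rintegral => r _.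
by rewrite !(add0r, subr0, addr0, subrr, mul0r, mulr0, oppr0, expR0, mul1r).
Qed.

Lemma Gammar_integral x : 0 < x -> Gammar x =
  \int[mu]_(r in `]0, +oo[) (expR ((x - 1) * ln r) * expR (- r)).
Proof.
move=> x0; rewrite /Gammar /cGamma /gamma_shift /= x0.
rewrite big_ord0 divr1 /euler_gamma /=.
apply: eq_Rintegral => r _.
by rewrite !(addr0, subr0, add0r, mul0r, mulr0, oppr0, cos0, sin0, mulr1).
Qed.

End special_functions_as_real_integrals.

(** * The limit of rescaled Bessel functions *)

Section damped_integrals.
Context (R : realType).
Local Notation mu := (@lebesgue_measure R).
Implicit Types (a e x w r l v : R).

Lemma coshR_ge1 x : 1 <= coshR x.
Proof.
rewrite /coshR ler_pdivlMr// mul1r expRN.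
have x0 := expR_gt0 x.
rewrite -subr_ge0 (_ : _ - 2 = (expR x - 1) ^+ 2 / expR x).
  by rewrite divr_ge0 ?sqr_ge0// ltW.
by field; exact: lt0r_neq0.
Qed.

Lemma coshR_le w : 0 <= w -> coshR w <= expR w.
Proof.
move=> w0; rewrite /coshR ler_pdivrMr// mulr_natr mulr2n lerD2l ler_expR; lra.
Qed.

Lemma coshR_ge w : expR w / 2 <= coshR w.
Proof. by rewrite /coshR ler_pM2r// lerDl expR_ge0. Qed.

Lemma coshR_norm w : coshR `|w| = coshR w.
Proof.
have [w0|w0] := leP 0 w; first by rewrite ger0_norm.
by rewrite ltr0_norm// /coshR opprK addrC.
Qed.

Lemma measurable_coshR : measurable_fun setT (@coshR R).
Proof.
apply: measurable_funM => //; apply: measurable_funD => //.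
by apply: measurableT_comp => //; exact: measurableT_comp.
Qed.

Lemma measurable_coshRM a : measurable_fun setT (fun w : R => coshR (a * w)).
Proof.
by apply: measurableT_comp; [exact: measurable_coshR|exact: mulrl_measurable].
Qed.

Lemma abs_coshR_le a w : `|coshR (a * w)| <= coshR (a * w) :> R.
Proof. by rewrite ger0_norm// (le_trans _ (coshR_ge1 _)). Qed.

Lemma measurable_cos : measurable_fun setT (@cos R).
Proof. by apply: continuous_measurable_fun; exact: continuous_cos. Qed.

Lemma measurable_sin : measurable_fun setT (@sin R).
Proof. by apply: continuous_measurable_fun; exact: continuous_sin. Qed.

(** The exponential factor in the integral for K at exp(- x / e), after the
    substitution w -> w / e. For w >= 0 its exponent lies between
    exp((w - x) / e) / 2 and exp((w - x) / e). *)
Definition damp e x w : R := expR (- (expR (- (x / e)) * coshR (w / e))).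

Lemma measurable_damp e :
  measurable_fun setT (fun p : R * R => damp e p.1 p.2).
Proof.
apply: measurableT_comp => //; apply: measurableT_comp => //.
apply: measurable_funM.
  do 2 apply: measurableT_comp => //; exact: measurable_funM.
by apply: (measurableT_comp measurable_coshR); exact: measurable_funM.
Qed.

Lemma damp_ge0 e x w : 0 <= damp e x w. Proof. exact: expR_ge0. Qed.

Lemma damp_exponent_ge e x w :
  expR ((w - x) / e) / 2 <= expR (- (x / e)) * coshR (w / e).
Proof.
rewrite (_ : expR ((w - x) / e) / 2 = expR (- (x / e)) * (expR (w / e) / 2)).
  by rewrite ler_pM2l ?expR_gt0// coshR_ge.
by rewrite mulrBl expRD; ring.
Qed.

Lemma damp_exponent_le e x w : 0 < e -> 0 <= w ->
  expR (- (x / e)) * coshR (w / e) <= expR (- ((x - w) / e)).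
Proof.
move=> e0 w0.
rewrite (_ : - ((x - w) / e) = - (x / e) + w / e); last by ring.
by rewrite expRD ler_pM2l ?expR_gt0// coshR_le// divr_ge0// ltW.
Qed.

Lemma damp_le1 e x w : damp e x w <= 1.
Proof.
rewrite -expR0 ler_expR oppr_le0 mulr_ge0 ?expR_ge0//.
exact: le_trans (coshR_ge1 _).
Qed.

(** A bound uniform in e <= 1. The summand 1/2 makes the right-hand side at least
    1 when w < r; for w >= r the exponent of [damp] is smallest at e = 1. *)
Lemma damp_dominated e x w r : 0 < e -> e <= 1 -> x <= r ->
  damp e x w <= expR (2^-1 - expR (w - r) / 2).
Proof.
move=> e0 e1 xr; have [wr|rw] := ltP w r.
  apply: (le_trans (damp_le1 _ _ _)); rewrite -[leLHS]expR0 ler_expR.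
  by rewrite subr_ge0 -[leRHS]mul1r ler_pM2r// -[leRHS]expR0 ler_expR subr_le0 ltW.
rewrite ler_expR; apply: (@le_trans _ _ (- (expR (w - r) / 2))); last by rewrite lerDr.
rewrite lerN2; apply: le_trans (damp_exponent_ge _ _ _).
rewrite ler_pM2r// ler_expR ler_pdivlMr//.
apply: (@le_trans _ _ (w - r)); last by rewrite lerD2l lerN2.
by rewrite ler_piMr// subr_ge0.
Qed.

(** The tangent line of exp gives exp(w - r) >= la (1 + w - r - ln la) for every
    la > 0; the choice la = 2 (|a| + 1) pays for both cosh(a w) and exp(w). *)
Lemma coshR_double_exponential a r : exists2 K : R, 0 <= K &
  forall w, 0 <= w ->
    expR (2^-1 - expR (w - r) / 2) * coshR (a * w) <= K * expR (- w).
Proof.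
pose b := `|a| + 1; pose la := 2 * b.
have b0 : 0 < b by rewrite /b ltr_wpDl.
have la0 : 0 < la by rewrite mulr_gt0.
exists (expR (2^-1 + b * (r + ln la - 1))); first exact: expR_ge0.
move=> w w0; rewrite -expRD.
apply: (@le_trans _ _ (expR (2^-1 - expR (w - r) / 2) * expR (`|a| * w))).
  rewrite ler_pM2l ?expR_gt0// -coshR_norm normrM (ger0_norm w0).
  by rewrite coshR_le// mulr_ge0.
rewrite -expRD ler_expR.
have : la * (1 + (w - r - ln la)) <= expR (w - r).
  rewrite -[in leRHS](subrK (ln la) (w - r)) expRD lnK ?posrE// mulrC.
  by rewrite ler_pM2r// expR_ge1Dx.
by rewrite /la /b; lra.
Qed.

Lemma integrable_expRN : mu.-integrable `[0, +oo[ (EFin \o (fun w => expR (- w))).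
Proof.
apply/integrableP; split.
  by apply/measurable_EFinP/measurable_funTS; exact: measurableT_comp.
under eq_integral do rewrite /= ger0_norm ?expR_ge0//.
rewrite (@ge0_continuous_FTC2y R (fun w => expR (- w)) (fun w => - expR (- w)) 0 0).
- by rewrite oppr0 expR0 EFinN oppeK add0e ltry.
- by move=> w _; exact: expR_ge0.
- apply: continuous_subspaceT => w; apply: continuous_comp; first exact: opp_continuous.
  exact: continuous_expR.
- by rewrite -oppr0; apply: cvgN; exact: cvgr_expR.
- by move=> w _.
- apply: cvg_at_right_filter; apply: cvgN; apply: continuous_comp; first exact: opp_continuous.
  exact: continuous_expR.
- move=> w _; rewrite derive1E derive_val; ring.
Qed.

End damped_integrals.

Section damped_limits.
Context (R : realType).
Local Notation mu := (@lebesgue_measure R).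
Implicit Types (a e x y w r l v : R).

Lemma expRN_le_inv y : 0 < y -> expR (- y) <= y^-1.
Proof.
move=> y0; rewrite expRN lef_pV2 ?posrE ?expR_gt0//.
by apply: le_trans (expR_ge1Dx y); rewrite lerDr.
Qed.

(** Away from w = x the difference is exponentially small in 1 / e; the cruder
    rate exp(- y) <= 1 / y is enough. *)
Lemma damp_near_indicator e x w : 0 < e -> 0 <= w -> w != x ->
  `|damp e x w - (w < x)%R%:R| <= 2 * e / `|x - w|.
Proof.
move=> e0 w0; rewrite neq_lt => /orP[wx|xw].
  have xw0 : 0 < x - w by rewrite subr_gt0.
  rewrite wx /= ler0_norm ?subr_le0 ?damp_le1// opprB gtr0_norm//.
  set y := expR (- (x / e)) * coshR (w / e).
  have y1 : 1 - damp e x w <= y.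
    by rewrite lerBlDr -lerBlDl; have := expR_ge1Dx (- y); rewrite /damp -/y; lra.
  apply: (le_trans y1); apply: (le_trans (damp_exponent_le x e0 w0)).
  apply: (le_trans (expRN_le_inv _)); first exact: divr_gt0.
  by rewrite invf_div -mulrA ler_peMl ?divr_ge0 ?(ltW e0) ?(ltW xw0)// ler1n.
have xw0 : 0 < w - x by rewrite subr_gt0.
rewrite ltNge (ltW xw) /= subr0 ger0_norm ?damp_ge0// distrC gtr0_norm//.
apply: (@le_trans _ _ (expR (- ((w - x) / (2 * e))))).
  rewrite ler_expR lerN2; apply: le_trans (damp_exponent_ge _ _ _).
  rewrite invfM mulrCA mulrC ler_pM2r//.
  by apply: le_trans (expR_ge1Dx _); rewrite lerDr.
apply: (le_trans (expRN_le_inv _)); first by rewrite divr_gt0// mulr_gt0.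
by rewrite invf_div.
Qed.

Lemma lebesgue_measure_bounded_itv (b c : bool) x y :
  (mu [set` Interval (BSide b x) (BSide c y)] < +oo)%E.
Proof. by rewrite lebesgue_measure_itv; case: ifP => // _; rewrite -EFinD ltry. Qed.

Definition damped_integral (k : R -> R) e x : R :=
  \int[mu]_(w in `[0, +oo[) (damp e x w * k w).

Lemma measurable_damp_w e x : measurable_fun setT (damp e x).
Proof. exact: (measurable_fun_pair2 _ (measurable_damp e)). Qed.

Lemma damped_integrand_dominated a r : exists2 K : R, 0 <= K &
  forall (k : R -> R) e x w, (forall w, `|k w| <= coshR (a * w)) ->
    0 < e -> e <= 1 -> x <= r -> 0 <= w ->
    `|damp e x w * k w| <= K * expR (- w).
Proof.
have [K K0 KP] := coshR_double_exponential a r.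
exists K => // k e x w k_le e0 e1 xr w0; rewrite normrM ger0_norm ?damp_ge0//.
by apply: le_trans (KP _ w0); rewrite ler_pM ?damp_ge0// damp_dominated.
Qed.

Let integrableKe (K : R) : mu.-integrable `[0, +oo[ (EFin \o (fun w => K * expR (- w))).
Proof.
have := @integrableZl _ _ R mu `[0, +oo[ (measurable_itv _) K _ (@integrable_expRN R).
by [].
Qed.

Lemma damped_integrable a (k : R -> R) e x :
  measurable_fun setT k -> (forall w, `|k w| <= coshR (a * w)) ->
  0 < e -> e <= 1 ->
  mu.-integrable `[0, +oo[ (EFin \o (fun w => damp e x w * k w)).
Proof.
move=> mk k_le e0 e1; have [K K0 KP] := damped_integrand_dominated a x.
apply: (@integrable_dominated _ _ _ mu _ _ (fun w => K * expR (- w))) => //.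
  exact: (measurable_funTS (measurable_funM (measurable_damp_w e x) mk)).
by move=> w; rewrite /= in_itv /= andbT => w0; exact: KP.
Qed.

(** One constant serves for all k with |k| <= cosh(a w), in particular for the
    functions cos(v w) for all v. *)
Lemma damped_integral_bounded a r : exists K : R,
  forall (k : R -> R) e x, measurable_fun setT k ->
    (forall w, `|k w| <= coshR (a * w)) ->
    0 < e -> e <= 1 -> x <= r -> `|damped_integral k e x| <= K.
Proof.
have [K K0 KP] := damped_integrand_dominated a r.
exists (\int[mu]_(w in `[0, +oo[) (K * expR (- w))) => k e x mk k_le e0 e1 xr.
have di := damped_integrable x mk k_le e0 e1.
apply: (le_trans (le_normr_Rintegral _ _)) => //.
apply: le_Rintegral => //; first by have /integrable_norm := di; exact.
by move=> w; rewrite /= in_itv /= andbT => w0; exact: KP.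
Qed.

(** The factor [damp] tends to the indicator of w < x except at w = x, and the
    integrands are dominated by a multiple of exp(- w). *)
Lemma cvg_damped_integral a (k : R -> R) (e_ : nat -> R) x :
  measurable_fun setT k -> (forall w, `|k w| <= coshR (a * w)) -> 0 < x ->
  (forall n, 0 < e_ n) -> (forall n, e_ n <= 1) -> e_ n @[n --> \oo] --> 0 ->
  damped_integral k (e_ n) x @[n --> \oo] --> \int[mu]_(w in `[0, x]) k w.
Proof.
move=> mk k_le x0 e0 e1 ecvg; have [K K0 KP] := damped_integrand_dominated a x.
have -> : \int[mu]_(w in `[0, x]) k w =
    \int[mu]_(w in `[0, +oo[) ((w < x)%R%:R * k w).
  rewrite -Rintegral_itv_bndo_bndc; last first.
    have [K' K'0 KP'] : exists2 K' : R, 0 <= K' & forall w, 0 <= w -> w <= x -> `|k w| <= K'.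
      exists (expR (`|a| * x)); first exact: expR_ge0.
      move=> w w0 wx; apply: (le_trans (k_le w)).
      rewrite -coshR_norm normrM (ger0_norm w0) (le_trans (coshR_le _)) ?mulr_ge0//.
      by rewrite ler_expR ler_wpM2l.
    apply: (@integrable_bounded _ _ _ mu _ k K') => //.
    - exact: lebesgue_measure_bounded_itv.
    - exact: (measurable_funTS mk).
    - by move=> w; rewrite /= in_itv /= => /andP[w0 wx]; apply: KP' => //; rewrite ltW.
  rewrite Rintegral_mkcond [RHS]Rintegral_mkcond; apply: eq_Rintegral => w _.
  rewrite /patch !mem_setE !in_itv /= andbT.
  by case: (0 <= w) => //=; case: (w < x); rewrite ?mul1r ?mul0r.
apply: (@Rintegral_dct R _ _ mu _ _ _ (fun w => K * expR (- w))) => //.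
- by move=> n; exact: (measurable_funTS (measurable_funM (measurable_damp_w _ _) mk)).
- apply: measurable_funTS; apply: measurable_funM => //.
  rewrite (_ : (fun w => _) = \1_(`]-oo, x[%classic : set R)); first exact: measurable_indic.
  by apply/funext => w; rewrite indicE mem_setE in_itv.
- exists [set x]; split => //; first exact: lebesgue_measure_set1.
  move=> w /= nw; apply: contrapT => wx; apply: nw; rewrite in_itv /= andbT => w0.
  apply: cvgM; last exact: cvg_cst.
  apply/cvgrPdist_le => eps eps0.
  have wx' : w != x by apply/eqP.
  have xw0 : 0 < `|x - w| by rewrite normr_gt0 subr_eq0 eq_sym.
  near=> n; rewrite distrC; apply: (le_trans (damp_near_indicator _ _ _)) => //.
  rewrite ler_pdivrMr// mulrC -ler_pdivlMr//.
  by near: n; apply: (cvgr_le _ ecvg); rewrite divr_gt0// mulr_gt0.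
- by move=> n w; rewrite /= in_itv /= andbT => w0; exact: KP.
Unshelve. all: by end_near. Qed.

(** For w <= l <= x the exponent of [damp] is at most 1, and cosh is at least 1.
    This keeps the denominators of the transition densities away from 0. *)
Lemma damped_integral_lower a e x l : 0 < e -> e <= 1 -> 0 < l -> l <= x ->
  l * expR (-1) <= damped_integral (fun w => coshR (a * w)) e x.
Proof.
move=> e0 e1 l0 lx.
have mk := measurable_coshRM a; have kle := abs_coshR_le a.
have -> : l * expR (-1) = \int[mu]_(w in `[0, l]) expR (-1).
  have ml : mu (`[0, l]%classic : set R) = l%:E.
    by rewrite lebesgue_measure_itv /= lte_fin l0 oppr0 adde0.
  by rewrite Rintegral_cst// mulrC; congr (_ * _); exact: (esym (congr1 fine ml)).
rewrite Rintegral_mkcond /damped_integral [leRHS]Rintegral_mkcond.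
apply: le_Rintegral => //.
- rewrite -restrict_EFin.
  apply: (@integrable_mkcond _ _ R mu `[0, l]%classic _ (measurable_itv _)).1.
  apply: (@integrable_bounded _ _ _ mu _ (cst (expR (-1))) (expR (-1))) => //.
    exact: lebesgue_measure_bounded_itv.
  by move=> w _; rewrite ger0_norm ?expR_ge0.
- rewrite -restrict_EFin.
  apply: (@integrable_mkcond _ _ R mu `[0, +oo[%classic _ (measurable_itv _)).1.
  exact: (damped_integrable x mk kle).
- move=> w _; rewrite /patch !mem_setE !in_itv /= andbT.
  have [w0|w0] := leP 0 w => //=.
  have dc0 : 0 <= damp e x w * coshR (a * w).
    by rewrite mulr_ge0 ?damp_ge0// (le_trans _ (coshR_ge1 _)).
  case: ifPn => // wl; rewrite -[leLHS]mulr1 ler_pM ?expR_ge0// ?coshR_ge1//.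
  rewrite /damp ler_expR lerN2; apply: (le_trans (damp_exponent_le x e0 w0)).
  by rewrite -[leRHS]expR0 ler_expR oppr_le0 divr_ge0 ?(ltW e0)// subr_ge0 (le_trans wl).
Qed.

End damped_limits.

Section scaled_bessel.
Context (R : realType).
Local Notation mu := (@lebesgue_measure R).
Implicit Types (a e x y w r l v : R).

Lemma Rintegral_scale0y e (h : R -> R) : 0 < e -> measurable_fun setT h ->
  e * \int[mu]_(w in `[0, +oo[) h (e * w) = \int[mu]_(w in `[0, +oo[) h w.
Proof.
move=> e0 mh; rewrite [RHS](Rintegral_scale e0)//; last exact: measurable_funTS.
congr (_ * Rintegral _ _ _); apply/seteqP; split => w /=; rewrite !in_itv /= !andbT.
  by move=> w0; rewrite mulr_ge0// ltW.
by rewrite pmulr_rge0.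
Qed.

Lemma besselKr_scale a e x : 0 < e ->
  e * besselKr (a * e) (expR (- (x / e))) =
  damped_integral (fun w => coshR (a * w)) e x.
Proof.
move=> e0; have e_neq0 : e != 0 by exact: lt0r_neq0.
rewrite besselKr_integral /damped_integral -[RHS](Rintegral_scale0y e0); last first.
  apply: measurable_funM; first exact: measurable_damp_w.
  by apply: measurableT_comp; [exact: measurable_coshR|exact: mulrl_measurable].
congr (_ * _); apply: eq_Rintegral => w _.
have -> : damp e x (e * w) = expR (- (expR (- (x / e)) * coshR w)).
  by rewrite /damp (_ : e * w / e = w)//; field.
by rewrite mulrA.
Qed.

Lemma cos_bessel_scale v e x : 0 < e ->
  e * cos_bessel (e * v) (expR (- (x / e))) =
  damped_integral (fun w => cos (v * w)) e x.
Proof.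
move=> e0; have e_neq0 : e != 0 by exact: lt0r_neq0.
rewrite /cos_bessel /damped_integral -[RHS](Rintegral_scale0y e0); last first.
  apply: measurable_funM; first exact: measurable_damp_w.
  by apply: measurableT_comp; [exact: measurable_cos|exact: mulrl_measurable].
congr (_ * _); apply: eq_Rintegral => w _.
have -> : damp e x (e * w) = expR (- (expR (- (x / e)) * coshR w)).
  by rewrite /damp (_ : e * w / e = w)//; field.
by rewrite mulrA [v * e]mulrC.
Qed.

Lemma integral_FTC2 (f F : R -> R) (x : R) : 0 < x -> continuous f ->
  (forall w : R, is_derive w 1 F (f w)) ->
  (\int[mu]_(w in `[0%R, x]) (f w)%:E = (F x - F 0)%:E)%E.
Proof.
move=> x0 cf dF.
have cF : continuous F.
  by move=> w; apply: differentiable_continuous; apply/derivable1_diffP; have [] := dF w.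
rewrite (@continuous_FTC2 R f F 0 x)//.
- exact: continuous_subspaceT.
- split.
  + by move=> w _; have [] := dF w.
  + by apply: cvg_at_right_filter; exact: cF.
  + by apply: cvg_at_left_filter; exact: cF.
- by move=> w _; rewrite derive1E; apply: derive_val.
Qed.

Lemma Rintegral_FTC2 (f F : R -> R) x : 0 < x -> continuous f ->
  (forall w, is_derive w 1 F (f w)) ->
  \int[mu]_(w in `[0, x]) f w = F x - F 0.
Proof. by move=> x0 cf dF; rewrite /Rintegral (integral_FTC2 x0 cf dF). Qed.

Lemma Rintegral_cos v x : v != 0 -> 0 < x ->
  \int[mu]_(w in `[0, x]) cos (v * w) = sin (v * x) / v.
Proof.
move=> v0 x0.
have cf : continuous (fun w => cos (v * w)).
  move=> w; apply: continuous_comp; last exact: continuous_cos.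
  exact: mulrl_continuous.
have dF w : is_derive w 1 (fun w => sin (v * w) / v) (cos (v * w)).
  by apply: is_derive_eq; rewrite /GRing.scale /=; field.
by rewrite (Rintegral_FTC2 x0 cf dF) mulr0 sin0 mul0r subr0.
Qed.

Lemma Rintegral_coshR a x : a != 0 -> 0 < x ->
  \int[mu]_(w in `[0, x]) coshR (a * w) = sinhR (a * x) / a.
Proof.
move=> a0 x0.
have cf : continuous (fun w => coshR (a * w)).
  move=> w; rewrite /coshR; apply: cvgM; last exact: cvg_cst.
  apply: cvgD; apply: continuous_comp; try exact: continuous_expR.
    exact: mulrl_continuous.
  by apply: continuous_comp; [exact: mulrl_continuous|exact: opp_continuous].
have dF w : is_derive w 1 (fun w => sinhR (a * w) / a) (coshR (a * w)).
  by rewrite /sinhR /coshR; apply: is_derive_eq; rewrite /GRing.scale /=; field.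
rewrite (Rintegral_FTC2 x0 cf dF) /sinhR.
by rewrite mulr0 oppr0 subrr !mul0r subr0.
Qed.

End scaled_bessel.

(** * Calculus on the half-line *)

Section FTC_on_half_line.
Context (R : realType).
Local Notation mu := (@lebesgue_measure R).
Variables (F f : R -> R).
Hypothesis dF : forall r : R, 0 < r -> is_derive r 1 F (f r).
Hypothesis cf : forall r : R, 0 < r -> {for r, continuous f}.

Let itv_n (n : nat) : set R := `[n.+2%:R^-1, n.+2%:R]%classic.

Let lt_n (n : nat) : n.+2%:R^-1 < n.+2%:R :> R.
Proof.
apply: (@lt_trans _ _ 1); last by rewrite ltr1n.
by rewrite invf_lt1// ltr1n.
Qed.

Let FTC_n (n : nat) :
  (\int[mu]_(r in itv_n n) (f r)%:E = (F n.+2%:R - F n.+2%:R^-1)%:E)%E.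
Proof.
have pos r : n.+2%:R^-1 <= r -> 0 < r by apply: lt_le_trans.
have cF r : 0 < r -> {for r, continuous F}.
  move=> r0; apply: differentiable_continuous; apply/derivable1_diffP.
  by have [] := dF r0.
rewrite /itv_n (@continuous_FTC2 R f F)//.
- apply: continuous_in_subspaceT => r; rewrite inE /= in_itv /= => /andP[/pos r0 _].
  exact: cf.
- split.
  + by move=> r; rewrite in_itv /= => /andP[/ltW/pos r0 _]; have [] := dF r0.
  + by apply: cvg_at_right_filter; apply: cF.
  + by apply: cvg_at_left_filter; apply: cF.
- move=> r; rewrite in_itv /= => /andP[/ltW/pos r0 _].
  by rewrite derive1E; have := dF r0 => ?; exact: derive_val.
Qed.

Let itv_sub n : itv_n n `<=` `]0, +oo[.
Proof.
by move=> r; rewrite /itv_n /= !in_itv /= andbT => /andP[+ _]; apply: lt_le_trans.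
Qed.

Let itv_cvg r : 0 < r -> \forall n \near \oo, itv_n n r.
Proof.
move=> r0; have ri0 : 0 < r^-1 by rewrite invr_gt0.
near=> n; rewrite /itv_n /= in_itv /=; apply/andP; split.
  apply: (@le_trans _ _ n.+1%:R^-1); first by rewrite lef_pV2 ?posrE// ler_nat.
  by apply/ltW; near: n; exact: near_infty_natSinv_lt (PosNum r0).
apply: (@le_trans _ _ n.+1%:R); last by rewrite ler_nat.
rewrite -lef_pV2 ?posrE//.
by apply/ltW; near: n; exact: near_infty_natSinv_lt (PosNum ri0).
Unshelve. all: by end_near. Qed.

Let measurable_f : measurable_fun (`]0, +oo[ : set R) f.
Proof.
apply: open_continuous_measurable_fun; first exact: interval_open.
by move=> r; rewrite inE /= in_itv /= andbT => r0; exact: cf.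
Qed.

(** F may be singular at 0, so the theorem is used on [1 / (n + 2), n + 2] and
    dominated convergence extends it to the half-line. *)
Lemma Rintegral_half_line_FTC (A B : R) :
  mu.-integrable `]0, +oo[ (EFin \o f) ->
  F n.+2%:R^-1 @[n --> \oo] --> A -> F n.+2%:R @[n --> \oo] --> B ->
  \int[mu]_(r in `]0, +oo[) f r = B - A.
Proof.
move=> fi FA FB.
have cv1 : (\int[mu]_(r in `]0, +oo[) (f r * \1_(itv_n n) r)) @[n --> \oo] -->
    \int[mu]_(r in `]0, +oo[) f r.
  apply: (@Rintegral_dct R _ _ mu _ _ _ (fun r => `|f r|)) => //.
  - move=> n; apply: measurable_funM => //.
    by apply: measurable_indic; exact: measurable_itv.
  - apply: aeW => r; rewrite /= in_itv /= andbT => r0.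
    apply: cvg_near_cst; near=> n.
    rewrite indicE mem_set ?mulr1//; near: n; exact: itv_cvg.
  - exact: integrable_norm.
  - move=> n r _; rewrite normrM ler_piMr// ger0_norm ?indicE ?ler0n//.
    by rewrite lern1 leq_b1.
have e n : \int[mu]_(r in `]0, +oo[) (f r * \1_(itv_n n) r) = F n.+2%:R - F n.+2%:R^-1.
  rewrite -[RHS](congr1 fine (FTC_n n)) -/(Rintegral _ _ _).
  rewrite Rintegral_mkcond [RHS]Rintegral_mkcond; apply: eq_Rintegral => r _.
  rewrite /patch indicE; case: ifPn => rI; case: ifPn => rn; rewrite ?mulr1 ?mulr0//.
  by move: rI; rewrite (mem_set (itv_sub (set_mem rn))).
have cv2 : (\int[mu]_(r in `]0, +oo[) (f r * \1_(itv_n n) r)) @[n --> \oo] --> B - A.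
  by under eq_fun do rewrite e; exact: cvgB.
exact: cvg_unique cv1 cv2.
Unshelve. all: by end_near. Qed.

(** The integrals over [1 / (n + 2), n + 2] increase, and each is a difference of
    values of F, hence at most 2 M. *)
Lemma ge0_half_line_integrable (M : R) :
  (forall r : R, 0 < r -> 0 <= f r) -> (forall r : R, 0 < r -> `|F r| <= M) ->
  mu.-integrable `]0, +oo[ (EFin \o f).
Proof.
move=> f0 FM; apply/integrableP; split; first exact/measurable_EFinP.
have -> : (\int[mu]_(r in `]0%R, +oo[) `|(EFin \o f) r| =
    \int[mu]_(r in `]0%R, +oo[) (EFin \o f) r)%E.
  by apply: eq_integral => r; rewrite inE /= in_itv /= andbT => r0; rewrite /= ger0_norm ?f0.
pose fn n r := (f r * \1_(itv_n n) r)%:E.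
apply: (@le_lt_trans _ _ (M + M)%:E); last exact: ltry.
have mfn n : measurable_fun (`]0, +oo[ : set R) (fn n).
  apply/measurable_EFinP; apply: measurable_funM => //.
  by apply: measurable_indic; exact: measurable_itv.
have fn0 n r : `]0, +oo[%classic r -> (0 <= fn n r)%E.
  by rewrite /= in_itv /= andbT => r0; rewrite lee_fin mulr_ge0// ?f0// indicE.
have := @cvg_monotone_convergence _ _ R mu `]0, +oo[%classic (measurable_itv _) fn mfn fn0.
have nd r : `]0, +oo[%classic r -> {homo fn ^~ r : n m / (n <= m)%N >-> (n <= m)%E}.
  rewrite /= in_itv /= andbT => r0 n m nm; rewrite lee_fin ler_wpM2l ?f0//.
  rewrite !indicE ler_nat; case: (boolP (r \in itv_n n)) => // /set_mem rn.
  rewrite mem_set//; move: rn; rewrite /itv_n /= !in_itv /= => /andP[n1 n2].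
  rewrite (le_trans n2) ?ler_nat// andbT (le_trans _ n1)//.
  by rewrite lef_pV2 ?posrE// ler_nat.
move=> /(_ nd).
rewrite (_ : (\int[mu]_(r in `]0%R, +oo[) limn (fn ^~ r))%E =
    (\int[mu]_(r in `]0%R, +oo[) (EFin \o f) r)%E); last first.
  apply: eq_integral => r; rewrite inE /= in_itv /= andbT => r0.
  apply/cvg_lim => //; apply: cvg_EFin; first exact: nearW.
  apply: cvg_near_cst; near=> n; rewrite /fn /= indicE mem_set ?mulr1//.
  by near: n; exact: itv_cvg.
move=> cv; rewrite -(cvg_lim _ cv)//; apply: lime_le; first by apply/cvg_ex; eexists; exact: cv.
apply: nearW => n.
have -> : (\int[mu]_(r in `]0%R, +oo[) fn n r)%E = (F n.+2%:R - F n.+2%:R^-1)%:E.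
  rewrite -FTC_n integral_mkcond [RHS]integral_mkcond; apply: eq_integral => r _.
  rewrite /patch /fn indicE; case: ifPn => rI; case: ifPn => rn; rewrite ?mulr1 ?mulr0//.
  by move: rI; rewrite (mem_set (itv_sub (set_mem rn))).
rewrite lee_fin (le_trans (ler_norm _))// (le_trans (ler_normB _ _))//.
by rewrite lerD// FM.
Unshelve. all: by end_near. Qed.

End FTC_on_half_line.

Section elementary_inequalities.
Context (R : realType).
Local Notation mu := (@lebesgue_measure R).
Implicit Types (x y w : R).

Lemma sinhR_ge w : 0 < w -> w <= sinhR w.
Proof.
move=> w0; have := @Rintegral_coshR R 1 w (oner_neq0 _) w0.
rewrite divr1 mul1r => <-.
have ml : mu (`[0, w]%classic : set R) = w%:E.
  by rewrite lebesgue_measure_itv /= lte_fin w0 oppr0 adde0.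
have wE : \int[mu]_(y in `[0, w]) 1 = w.
  by rewrite Rintegral_cst// mul1r; exact: (congr1 fine ml).
rewrite -[X in X <= _]wE.
apply: le_Rintegral => //.
- apply: (@integrable_bounded _ _ _ mu _ (cst 1) 1) => //.
    exact: lebesgue_measure_bounded_itv.
  by move=> y _; rewrite normr1.
- apply: (@integrable_bounded _ _ _ mu _ (fun y => coshR (1 * y)) (expR w)) => //.
  + exact: lebesgue_measure_bounded_itv.
  + apply: measurable_funTS.
    by apply: measurableT_comp; [exact: measurable_coshR|exact: mulrl_measurable].
  + move=> y; rewrite /= in_itv /= mul1r => /andP[y0 yw].
    rewrite ger0_norm ?(le_trans _ (coshR_ge1 _))// (le_trans (coshR_le y0))//.
    by rewrite ler_expR.
- by move=> y _; exact: coshR_ge1.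
Qed.

(** With x = exp(2 s) this says |s| <= |sinh s|. *)
Lemma sqr_ln_le x : 0 < x -> ln x ^+ 2 <= x - 2 + x^-1.
Proof.
move=> x0; pose s := ln x / 2.
have xE : x = expR s ^+ 2.
  by rewrite -expRM_natr /s mulfVK ?lnK// pnatr_eq0.
have -> : ln x = 2 * s by rewrite /s mulrC divfK// pnatr_eq0.
have -> : x - 2 + x^-1 = (2 * sinhR s) ^+ 2.
  rewrite /sinhR xE expRN; have := expR_gt0 s; move: (expR s) => y y0.
  by field; exact: lt0r_neq0.
rewrite -(real_normK (num_real (2 * s))) -(real_normK (num_real (2 * sinhR s))).
rewrite ler_sqr ?nnegrE ?normr_ge0//.
rewrite (normrM 2 s) (normrM 2 (sinhR s)) ler_pM2l ?normr_gt0 ?pnatr_eq0//.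
have [s0|s0|<-] := ltgtP 0 s.
- have h := sinhR_ge s0.
  by rewrite (gtr0_norm s0) (gtr0_norm (lt_le_trans s0 h)).
- have e : sinhR s = - sinhR (- s) by rewrite /sinhR opprK; ring.
  have s0' : 0 < - s by rewrite oppr_gt0.
  have h := sinhR_ge s0'.
  rewrite e normrN -[`|s|]normrN.
  by rewrite (gtr0_norm s0') (gtr0_norm (lt_le_trans s0' h)).
- by rewrite normr0 normr_ge0.
Qed.

Lemma sin_le_pos w : 0 < w -> sin w <= w.
Proof.
move=> w0; have := @Rintegral_cos R 1 w (oner_neq0 _) w0.
rewrite divr1 mul1r => <-.
have ml : mu (`[0, w]%classic : set R) = w%:E.
  by rewrite lebesgue_measure_itv /= lte_fin w0 oppr0 adde0.
have wE : \int[mu]_(y in `[0, w]) 1 = w.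
  by rewrite Rintegral_cst// mul1r; exact: (congr1 fine ml).
rewrite -[X in _ <= X]wE.
apply: le_Rintegral => //.
- apply: (@integrable_bounded _ _ _ mu _ (fun y => cos (1 * y)) 1) => //.
  + exact: lebesgue_measure_bounded_itv.
  + apply: measurable_funTS.
    by apply: measurableT_comp; [exact: measurable_cos|exact: mulrl_measurable].
  + by move=> y _; exact: cos_max.
- apply: (@integrable_bounded _ _ _ mu _ (cst 1) 1) => //.
    exact: lebesgue_measure_bounded_itv.
  by move=> y _; rewrite normr1.
Qed.

(** By cos x = 1 - 2 sin(x / 2)^2 and |sin y| <= |y|. *)
Lemma cos_ge x : 1 - x ^+ 2 / 2 <= cos x.
Proof.
have pos y : 0 < y -> `|sin y| <= y.
  move=> y0; have [s0|s0] := leP 0 (sin y); first by rewrite ger0_norm// sin_le_pos.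
  have [y1|y1] := leP y 1; last by rewrite (le_trans (sin_max y))// ltW.
  move: s0; rewrite ltNge sin_ge0_pi// (ltW y0) (le_trans y1)//.
  by apply: le_trans (pi_ge2 R); rewrite ler1n.
have sin_abs y : sin y ^+ 2 <= y ^+ 2.
  have [y0|y0|<-] := ltgtP 0 y; last by rewrite sin0.
  - by rewrite -(real_normK (num_real (sin y))) ler_sqr ?nnegrE ?normr_ge0 ?(ltW y0)// pos.
  - rewrite -[leLHS]sqrrN -sinN -[leRHS]sqrrN -(real_normK (num_real (sin (- y)))).
    by rewrite ler_sqr ?nnegrE ?normr_ge0// ?oppr_ge0 ?(ltW y0)// pos// oppr_gt0.
have -> : cos x = 1 - 2 * sin (x / 2) ^+ 2.
  rewrite [in LHS](splitr x) -mulr2n cos_mulr2n cos2sin2 mulr2n; ring.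
by have := sin_abs (x / 2); rewrite expr_div_n; lra.
Qed.

End elementary_inequalities.

(** * The modulus of the gamma function on the imaginary axis *)

Section gamma_moments.
Context (R : realType).
Local Notation mu := (@lebesgue_measure R).
Local Notation hl := (`]0, +oo[%classic : set R).
Implicit Types (u r : R) (n : nat).

(** Raise s <= exp(s), for s = r / (2 (n + 1)), to the power n. *)
Lemma exprn_expRN_le n r : 0 <= r ->
  r ^+ n * expR (- r) <= (2 * n.+1%:R) ^+ n * expR (- (r / 2)).
Proof.
move=> r0; have n0 : 0 < 2 * n.+1%:R :> R by rewrite mulr_gt0.
have h : r ^+ n <= (2 * n.+1%:R) ^+ n * expR (r / 2).
  rewrite -ler_pdivrMl ?exprn_gt0// mulrC -expr_div_n.
  apply: (@le_trans _ _ (expR (r / (2 * n.+1%:R)) ^+ n)).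
    apply: lerXn2r; rewrite ?nnegrE ?divr_ge0 ?expR_ge0// ?(ltW n0)//.
    by apply: le_trans (expR_ge1Dx _); rewrite lerDr.
  rewrite -expRM_natl ler_expR.
  rewrite (_ : n%:R * _ = (r / 2) * (n%:R / n.+1%:R)); last first.
    by field; apply: lt0r_neq0; have := ler0n R n; lra.
  by rewrite ler_piMr ?divr_ge0// ler_pdivrMr// mul1r ler_nat.
have -> : expR (- r) = expR (- (r / 2)) * expR (- (r / 2)).
  by rewrite -expRD; congr expR; field.
rewrite mulrA ler_pM2r ?expR_gt0//.
by rewrite expRN -ler_pdivlMr ?invr_gt0 ?expR_gt0// invrK.
Qed.

Lemma integrable_expRN_half : mu.-integrable hl (EFin \o (fun r => expR (- (r / 2)))).
Proof.
apply: (@ge0_half_line_integrable R (fun r => - 2 * expR (- (r / 2))) _ _ _ 2).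
- by move=> r _; apply: is_derive_eq; rewrite /GRing.scale /=; field.
- move=> r _; apply: continuous_comp; last exact: continuous_expR.
  by apply: continuousN; apply: mulrr_continuous.
- by move=> r _; exact: expR_ge0.
- move=> r r0; rewrite normrM normrN ger0_norm// ger0_norm ?expR_ge0//.
  by rewrite -[leRHS]mulr1 ler_pM2l// -[leRHS]expR0 ler_expR oppr_le0 divr_ge0// ltW.
Qed.

Lemma moment_integrable n (k : R -> R) (L : R) :
  measurable_fun hl k -> (forall r, 0 < r -> `|k r| <= L) ->
  mu.-integrable hl (EFin \o (fun r => r ^+ n * (k r * expR (- r)))).
Proof.
move=> mk kL.
have ci := @integrableZl _ _ R mu hl (measurable_itv _) (L * (2 * n.+1%:R) ^+ n) _ integrable_expRN_half.
apply: (@integrable_dominated _ _ _ mu _ _ (fun r => L * (2 * n.+1%:R) ^+ n * expR (- (r / 2)))) => //.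
  apply: measurable_funM; first by apply: measurable_funTS; exact: exprn_measurable.
  apply: measurable_funM => //; apply: measurable_funTS.
  by apply: measurableT_comp => //; exact: measurable_oppr.
move=> r; rewrite /= in_itv /= andbT => r0.
rewrite !normrM normrX (gtr0_norm r0) (ger0_norm (expR_ge0 _)) mulrCA -mulrA.
apply: ler_pM => //; first by rewrite mulr_ge0 ?expR_ge0// exprn_ge0// ltW.
  exact: kL.
exact: exprn_expRN_le (ltW r0).
Qed.

Lemma cvg0_of_le_inv (s : nat -> R) (K : R) :
  (forall m, `|s m| <= K / m.+2%:R) -> s m @[m --> \oo] --> 0.
Proof.
move=> sK; apply/cvgr0Pnorm_le => e e0.
have K0 : 0 < `|K| + 1 by rewrite ltr_wpDl.
have eK : 0 < e / (`|K| + 1) by rewrite divr_gt0.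
near=> m; apply: (le_trans (sK m)).
apply: (@le_trans _ _ ((`|K| + 1) * m.+1%:R^-1)).
  apply: (@le_trans _ _ ((`|K| + 1) * m.+2%:R^-1)).
    by rewrite ler_pM2r ?invr_gt0// ler_wpDr// ler_norm.
  by rewrite ler_pM2l// lef_pV2 ?posrE// ler_nat.
rewrite mulrC -ler_pdivlMr//; apply/ltW; near: m.
exact: near_infty_natSinv_lt (PosNum eK).
Unshelve. all: by end_near. Qed.

(** For k(r) = cos(u ln r) and k(r) = sin(u ln r) these are the real and imaginary
    parts of Gamma(n + 1 + i u). *)
Definition moment n (k : R -> R) : R :=
  \int[mu]_(r in `]0, +oo[) (r ^+ n * (k r * expR (- r))).

(** Integration by parts; for functions k of ln r the derivative has the form
    ka(r) / r, and one recovers the functional equation of the gamma function. *)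
Lemma momentS n (k ka : R -> R) (L : R) :
  (forall r, 0 < r -> is_derive r 1 k (ka r / r)) ->
  (forall r, 0 < r -> {for r, continuous ka}) ->
  (forall r, 0 < r -> `|k r| <= L) -> (forall r, 0 < r -> `|ka r| <= L) ->
  moment n.+1 k = n.+1%:R * moment n k + moment n ka.
Proof.
move=> dk cka kL kaL.
have ck r : 0 < r -> {for r, continuous k}.
  move=> r0; apply: differentiable_continuous; apply/derivable1_diffP.
  by have [] := dk r r0.
have mk : measurable_fun hl k.
  apply: open_continuous_measurable_fun; first exact: interval_open.
  by move=> r; rewrite inE /= in_itv /= andbT => r0; exact: ck.
have mka : measurable_fun hl ka.
  apply: open_continuous_measurable_fun; first exact: interval_open.
  by move=> r; rewrite inE /= in_itv /= andbT => r0; exact: cka.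
pose F r := r ^+ n.+1 * (k r * expR (- r)).
pose f r := n.+1%:R * (r ^+ n * (k r * expR (- r))) + r ^+ n * (ka r * expR (- r))
   - r ^+ n.+1 * (k r * expR (- r)).
have i1 := moment_integrable n mk kL.
have i2 := moment_integrable n mka kaL.
have i3 := moment_integrable n.+1 mk kL.
have i1' := @integrableZl _ _ R mu hl (measurable_itv _) n.+1%:R _ i1.
have FL r : 0 < r -> `|F r| <= L * (r ^+ n.+1 * expR (- r)).
  move=> r0; rewrite /F !normrM normrX (gtr0_norm r0) (ger0_norm (expR_ge0 _)) mulrCA.
  by apply: ler_wpM2r; [rewrite mulr_ge0 ?expR_ge0// exprn_ge0// ltW|exact: kL].
have L0 : 0 <= L by apply: le_trans (kL 1 ltr01).
have iD := @integrableD _ _ R mu hl (measurable_itv _) _ _ i1' i2.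
have cX m r : {for r, continuous (fun r : R => r ^+ m)} by exact: exprn_continuous.
have cE r : {for r, continuous (fun r : R => expR (- r))}.
  by apply: continuous_comp; [exact: opp_continuous|exact: continuous_expR].
have : \int[mu]_(r in `]0, +oo[) f r = 0 - 0.
  apply: (@Rintegral_half_line_FTC R F).
  - move=> r r0; have := dk r r0 => dkr; rewrite /F /f.
    have r_neq0 := lt0r_neq0 r0.
    have dE : is_derive r 1 (fun r => expR (- r)) (- expR (- r)).
      by apply: is_derive_eq; rewrite /GRing.scale /=; ring.
    have dX : is_derive r 1 (fun r => r ^+ n.+1) (n.+1%:R * r ^+ n).
      by apply: (DeriveDef (@exprn_derivable _ _ _ _)); rewrite exp_derive /GRing.scale /= mulr1.
    apply: (is_derive_eq (is_deriveM dX (is_deriveM dkr dE))).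
    rewrite -[(k * _) r]/(k r * expR (- r)) /GRing.scale /= !exprS; field.
    exact: r_neq0.
  - move=> r r0; apply: cvgB; [apply: cvgD|].
    + apply: cvgM; [exact: cvg_cst|apply: cvgM; [exact: cX|apply: cvgM; [exact: ck|exact: cE]]].
    + by apply: cvgM; [exact: cX|apply: cvgM; [exact: cka|exact: cE]].
    + by apply: cvgM; [exact: cX|apply: cvgM; [exact: ck|exact: cE]].
  - exact: (@integrableB _ _ R mu hl (measurable_itv _) _ _ iD i3).
  - apply: (@cvg0_of_le_inv _ L) => m.
    apply: (le_trans (FL _ _)) => //; apply: ler_wpM2l => //.
    have m1 : m.+2%:R^-1 <= 1 :> R by rewrite invf_le1// ler1n.
    rewrite exprS -mulrA ler_piMr// mulr_ile1 ?expR_ge0 ?exprn_ge0//.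
    by rewrite exprn_ile1.
  - apply: (@cvg0_of_le_inv _ (L * ((2 * n.+2%:R) ^+ n.+1 * 2))) => m.
    apply: (le_trans (FL _ _)) => //; rewrite -mulrA; apply: ler_wpM2l => //.
    apply: (le_trans (exprn_expRN_le _ _)) => //; rewrite -mulrA ler_wpM2l//.
    by apply: (le_trans (expRN_le_inv _)); rewrite ?divr_gt0// invf_div.
rewrite subr0 /f RintegralB// RintegralD// RintegralZl// => /eqP.
by rewrite subr_eq0 => /eqP h; rewrite /moment -h.
Qed.

End gamma_moments.

Section gamma_modulus.
Context (R : realType).
Local Notation mu := (@lebesgue_measure R).
Local Notation hl := (`]0, +oo[%classic : set R).
Implicit Types (u r v : R) (n : nat).

Lemma moment0_cst1 : moment 0 (fun=> 1) = 1 :> R.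
Proof.
have -> : moment 0 (fun=> 1) = \int[mu]_(r in `]0, +oo[) expR (- r).
  by apply: eq_Rintegral => r _; rewrite expr0 !mul1r.
rewrite (@Rintegral_half_line_FTC R (fun r => 1 - expR (- r)) _ _ _ 0 1) ?subr0//.
- by move=> r _; apply: is_derive_eq; rewrite /GRing.scale /=; ring.
- move=> r _; apply: continuous_comp; [exact: opp_continuous|exact: continuous_expR].
- have := @moment_integrable R 0 (fun=> 1) 1 (measurable_cst _).
  rewrite (_ : (fun r => _) = (fun r => expR (- r))).
    by apply => r _; rewrite normr1.
  by apply/funext => r; rewrite expr0 !mul1r.
- apply: (@cvg0_of_le_inv R _ 1) => m; rewrite mul1r.
  rewrite ger0_norm; last by rewrite subr_ge0 -[leRHS]expR0 ler_expR oppr_le0.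
  by rewrite lerBlDr -lerBlDl expR_ge1Dx.
- rewrite -[X in _ --> X]subr0; apply: cvgB; first exact: cvg_cst.
  apply: (@cvg0_of_le_inv R _ 1) => m; rewrite mul1r ger0_norm ?expR_ge0//.
  exact: expRN_le_inv.
Qed.

Lemma moment_cst1 n : moment n (fun=> 1) = n`!%:R :> R.
Proof.
elim: n => [|n IH]; first by rewrite moment0_cst1.
have dk r : 0 < r -> is_derive r 1 (fun=> 1 : R) (0 / r).
  by move=> _; rewrite mul0r; exact: is_derive_cst.
rewrite (@momentS R n _ (fun=> 0) 1 dk)//.
- rewrite IH factS natrM (_ : moment n (fun=> 0) = 0) ?addr0//.
  by rewrite /moment /Rintegral integral0_eq// => r _; rewrite mul0r mulr0.
- by move=> r _; exact: cvg_cst.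
- by move=> r _; rewrite normr1.
- by move=> r _; rewrite normr0.
Qed.

Definition cos_moment u n := moment n (fun r => cos (u * ln r)).
Definition sin_moment u n := moment n (fun r => sin (u * ln r)).

Lemma gamma_re_moment u : gamma_re u = cos_moment u 0.
Proof. by apply: eq_Rintegral => r _; rewrite mul1r. Qed.

Lemma gamma_im_moment u : gamma_im u = sin_moment u 0.
Proof. by apply: eq_Rintegral => r _; rewrite mul1r. Qed.

Let measurable_cosln u : measurable_fun hl (fun r => cos (u * ln r)).
Proof.
apply: measurable_funTS; apply: measurableT_comp; first exact: measurable_cos.
by apply: measurable_funM => //; exact: measurable_ln.
Qed.

Let measurable_sinln u : measurable_fun hl (fun r => sin (u * ln r)).
Proof.
apply: measurable_funTS; apply: measurableT_comp; first exact: measurable_sin.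
by apply: measurable_funM => //; exact: measurable_ln.
Qed.

Let cont_uln u r : 0 < r -> {for r, continuous (fun r => u * ln r)}.
Proof.
by move=> r0; apply: cvgM; [exact: cvg_cst|exact: continuous_ln].
Qed.

Lemma momentZ n (a : R) (k : R -> R) :
  mu.-integrable hl (EFin \o (fun r => r ^+ n * (k r * expR (- r)))) ->
  moment n (fun r => a * k r) = a * moment n k.
Proof.
move=> ki; rewrite /moment -RintegralZl//; apply: eq_Rintegral => r _; ring.
Qed.

Lemma cos_momentS u n :
  cos_moment u n.+1 = n.+1%:R * cos_moment u n - u * sin_moment u n.
Proof.
have dk r : 0 < r ->
    is_derive r 1 (fun r => cos (u * ln r)) (- u * sin (u * ln r) / r).
  move=> r0; have dl := is_derive1_ln r0.
  apply: is_derive_eq; rewrite /GRing.scale /=; field.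
  exact: lt0r_neq0.
rewrite /cos_moment (@momentS R n _ (fun r => - u * sin (u * ln r)) (1 + `|u|) dk).
- rewrite momentZ; first by rewrite mulNr.
  by apply: (@moment_integrable R n _ 1) => // r _; exact: sin_max.
- move=> r r0; apply: cvgM; first exact: cvg_cst.
  by apply: continuous_comp; [exact: cont_uln|exact: continuous_sin].
- by move=> r r0; rewrite (le_trans (cos_max _))// lerDl.
- move=> r r0; rewrite normrM normrN (@le_trans _ _ `|u|)//; last by rewrite lerDr.
  by rewrite ler_piMr// sin_max.
Qed.

Lemma sin_momentS u n :
  sin_moment u n.+1 = n.+1%:R * sin_moment u n + u * cos_moment u n.
Proof.
have dk r : 0 < r ->
    is_derive r 1 (fun r => sin (u * ln r)) (u * cos (u * ln r) / r).
  move=> r0; have dl := is_derive1_ln r0.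
  apply: is_derive_eq; rewrite /GRing.scale /=; field.
  exact: lt0r_neq0.
rewrite /sin_moment (@momentS R n _ (fun r => u * cos (u * ln r)) (1 + `|u|) dk).
- rewrite momentZ//.
  by apply: (@moment_integrable R n _ 1) => // r _; exact: cos_max.
- move=> r r0; apply: cvgM; first exact: cvg_cst.
  by apply: continuous_comp; [exact: cont_uln|exact: continuous_cos].
- by move=> r r0; rewrite (le_trans (sin_max _))// lerDl.
- move=> r r0; rewrite normrM (@le_trans _ _ `|u|)//; last by rewrite lerDr.
  by rewrite ler_piMr// cos_max.
Qed.

(** |Gamma(n + 1 + i u)|^2 *)
Definition moment_modulus u n := cos_moment u n ^+ 2 + sin_moment u n ^+ 2.

Lemma moment_modulusS u n :
  moment_modulus u n.+1 = (n.+1%:R ^+ 2 + u ^+ 2) * moment_modulus u n.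
Proof. by rewrite /moment_modulus cos_momentS sin_momentS; ring. Qed.

Lemma moment_modulus_ge0 u n : 0 <= moment_modulus u n.
Proof. by rewrite addr_ge0 ?sqr_ge0. Qed.

Lemma moment_phase n u v : moment n (fun r => cos (u * ln r - v)) =
  cos v * cos_moment u n + sin v * sin_moment u n.
Proof.
rewrite -!momentZ; last 2 first.
- by apply: (@moment_integrable R n _ 1) => // r _; exact: sin_max.
- by apply: (@moment_integrable R n _ 1) => // r _; exact: cos_max.
rewrite /moment -RintegralD//; last 2 first.
- apply: (@moment_integrable R n (fun r => cos v * cos (u * ln r)) 1).
    by apply: measurable_funM.
  by move=> r _; rewrite normrM mulr_ile1// cos_max.
- apply: (@moment_integrable R n (fun r => sin v * sin (u * ln r)) 1).
    by apply: measurable_funM.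
  by move=> r _; rewrite normrM mulr_ile1// sin_max.
by apply: eq_Rintegral => r _; rewrite cosB; ring.
Qed.

(** Gamma(1 + i u) is the mean of the unit complex numbers r^(i u) under the law
    exp(- r) dr. In real terms, if S = c^2 + s^2 then
    c cos + s sin <= (S + 1) / 2 pointwise, and integration gives S <= (S + 1) / 2. *)
Lemma moment_modulus0_le1 u : moment_modulus u 0 <= 1.
Proof.
set c := cos_moment u 0; set s := sin_moment u 0; set S := moment_modulus u 0.
have ik (k : R -> R) (L : R) := @moment_integrable R 0 k L.
have ic := ik _ 1 (measurable_cosln u) (fun r _ => cos_max _).
have is' := ik _ 1 (measurable_sinln u) (fun r _ => sin_max _).
have ice := @integrableZl _ _ R mu hl (measurable_itv _) c _ ic.
have ise := @integrableZl _ _ R mu hl (measurable_itv _) s _ is'.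
have i1 := ik (fun=> (S + 1) / 2) `|(S + 1) / 2| (measurable_cst _) (fun r _ => lexx _).
suff : S <= (S + 1) / 2 by rewrite ler_pdivlMr//; lra.
have -> : (S + 1) / 2 = moment 0 (fun=> (S + 1) / 2).
  have e : moment 0 (fun=> (S + 1) / 2 * 1) = (S + 1) / 2 * 1.
    rewrite (@momentZ 0 _ (fun=> 1)) ?moment0_cst1//.
    by apply: (ik _ 1) => // r _; rewrite normr1.
  by move: e; rewrite mulr1.
rewrite [leLHS](_ : _ = \int[mu]_(r in hl)
    (c * (r ^+ 0 * (cos (u * ln r) * expR (- r))) +
     s * (r ^+ 0 * (sin (u * ln r) * expR (- r))))); last first.
  rewrite RintegralD// /S /moment_modulus -/c -/s !expr2.
  by congr (_ + _); rewrite RintegralZl.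
apply: le_Rintegral => //.
  exact: (@integrableD _ _ R mu hl (measurable_itv _) _ _ ice ise).
move=> r _; rewrite expr0 !mul1r !mulrA -mulrDl ler_pM2r ?expR_gt0//.
have := cos2Dsin2 (u * ln r); rewrite /S /moment_modulus -/c -/s.
move: (cos _) (sin _) => x y xy; rewrite ler_pdivlMr// -subr_ge0.
rewrite (_ : _ - _ = (c - x) ^+ 2 + (s - y) ^+ 2 + (1 - (x ^+ 2 + y ^+ 2))).
  by rewrite xy subrr addr0 addr_ge0 ?sqr_ge0.
by ring.
Qed.

(** The modulus is at least the real part after any rotation of the phase. The
    phase v = u ln N cancels the oscillation at the maximum r = N = n + 1 of
    r^(n + 1) exp(- r), and [cos_ge] with [sqr_ln_le] gives
    cos(u ln(r / N)) >= 1 - (u^2 / 2) (r / N - 2 + N / r),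
    whose integral is explicit in factorials. *)
Lemma moment_modulus_ge u n : u ^+ 2 <= 2 * n.+1%:R ->
  (n.+1`!%:R * (1 - u ^+ 2 / (2 * n.+1%:R))) ^+ 2 <= moment_modulus u n.+1.
Proof.
move=> un; have n0 : 0 < n.+1%:R :> R by [].
have n_neq0 : n.+1%:R != 0 :> R by exact: lt0r_neq0.
set N : R := n.+1%:R in un n0 n_neq0 *.
pose v := u * ln N.
have lower : n.+1`!%:R * (1 - u ^+ 2 / (2 * N)) <= moment n.+1 (fun r => cos (u * ln r - v)).
  have iG m : mu.-integrable hl (EFin \o (fun r => r ^+ m * (1 * expR (- r)))).
    by apply: (@moment_integrable R m (fun=> 1) 1) => // r _; rewrite normr1.
  (* a r^(n + 1) + b r^(n + 2) + c r^n is r^(n + 1) times the lower bound for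
     the cosine *)
  pose a := 1 + u ^+ 2; pose b := - (u ^+ 2 / (2 * N)); pose c := - (u ^+ 2 * N / 2).
  have ia := @integrableZl _ _ R mu hl (measurable_itv _) a _ (iG n.+1).
  have ib := @integrableZl _ _ R mu hl (measurable_itv _) b _ (iG n.+2).
  have ic := @integrableZl _ _ R mu hl (measurable_itv _) c _ (iG n).
  have iab := @integrableD _ _ R mu hl (measurable_itv _) _ _ ia ib.
  have -> : n.+1`!%:R * (1 - u ^+ 2 / (2 * N)) =
      \int[mu]_(r in hl) (a * (r ^+ n.+1 * (1 * expR (- r))) +
        b * (r ^+ n.+2 * (1 * expR (- r))) + c * (r ^+ n * (1 * expR (- r)))).
    rewrite RintegralD// RintegralD// (RintegralZl _ _ (iG _))// (RintegralZl _ _ (iG _))// (RintegralZl _ _ (iG _))//.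
    rewrite -!/(moment _ (fun=> 1)) !moment_cst1 !factS !natrM -/N -natr1 -/N.
    by rewrite /a /b /c; field.
  apply: le_Rintegral => //.
  - exact: (@integrableD _ _ R mu hl (measurable_itv _) _ _ iab ic).
  - apply: (@moment_integrable R n.+1 _ 1); last by move=> r _; exact: cos_max.
    apply: measurable_funTS; apply: measurableT_comp; first exact: measurable_cos.
    apply: measurable_funB => //; apply: measurable_funM => //; exact: measurable_ln.
  - move=> r; rewrite /= in_itv /= andbT => r0.
    rewrite !mul1r !mulrA -!mulrDl ler_pM2r ?expR_gt0//.
    have r_neq0 := lt0r_neq0 r0.
    have lnE : ln r - ln N = ln (r / N) by rewrite ln_div.
    have rN0 : 0 < r / N by rewrite divr_gt0.
    have h1 := cos_ge (u * ln r - v).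
    have h2 := sqr_ln_le rN0.
    have h3 : 1 - u ^+ 2 / 2 * (r / N - 2 + (r / N)^-1) <= cos (u * ln r - v).
      apply: le_trans h1; rewrite /v -mulrBr lnE exprMn lerD2l lerN2.
      rewrite mulrAC; apply: ler_wpM2l h2.
      by rewrite divr_ge0// sqr_ge0.
    have := ler_wpM2l (exprn_ge0 n.+1 (ltW r0)) h3.
    apply: le_trans; rewrite le_eqVlt; apply/orP; left; apply/eqP.
    by rewrite /a /b /c !exprS; field; rewrite addrC natr1 pnatr_eq0 r_neq0.
have pos : 0 <= n.+1`!%:R * (1 - u ^+ 2 / (2 * N)).
  by rewrite mulr_ge0// subr_ge0 ler_pdivrMr ?mul1r// mulr_gt0.
have h4 := lerXn2r 2 pos (le_trans pos lower) lower.
apply: (le_trans h4); rewrite moment_phase /moment_modulus.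
move: (cos_moment u n.+1) (sin_moment u n.+1) => x y.
have := cos2Dsin2 v; move: (cos v) (sin v) => p q pq.
rewrite -subr_ge0 (_ : _ - _ = (q * x - p * y) ^+ 2 + (1 - (p ^+ 2 + q ^+ 2)) * (x ^+ 2 + y ^+ 2)).
  by rewrite pq subrr mul0r addr0 sqr_ge0.
by ring.
Qed.

End gamma_modulus.

Section inverse_gamma_bounds.
Context (R : realType).
Implicit Types (u : R) (n N : nat).

(** |Gamma(1 + i u)|^2 *)
Definition gamma_modulus u : R := gamma_re u ^+ 2 + gamma_im u ^+ 2.

Lemma gamma_modulusE u : gamma_modulus u = moment_modulus u 0.
Proof. by rewrite /gamma_modulus gamma_re_moment gamma_im_moment. Qed.

Lemma moment_modulus_le_start u n :
  moment_modulus u n <= n`!%:R ^+ 2 * (1 + u ^+ 2) ^+ n * moment_modulus u 0.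
Proof.
elim: n => [|n IH]; first by rewrite fact0 expr1n mul1r expr0 mul1r.
rewrite moment_modulusS factS natrM exprMn (exprS _ n).
rewrite [leRHS](_ : _ = (n.+1%:R ^+ 2 * (1 + u ^+ 2)) *
  (n`!%:R ^+ 2 * (1 + u ^+ 2) ^+ n * moment_modulus u 0)); last by ring.
apply: ler_pM IH; rewrite ?moment_modulus_ge0 ?addr_ge0 ?sqr_ge0//.
rewrite mulrDr mulr1 lerD2l ler_peMl ?sqr_ge0//.
by rewrite exprn_ege1// ler1n.
Qed.

(** In the functional equation the first N + 1 factors are estimated by
    j^2 + u^2 <= j^2 (1 + u^2), and the later ones by
    j^2 + u^2 <= j^2 exp(u^2 (1 / (j - 1) - 1 / j)), whose exponents telescope. *)
Lemma moment_modulus_le u N k :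
  moment_modulus u (N.+1 + k) <= (N.+1 + k)`!%:R ^+ 2 * (1 + u ^+ 2) ^+ N.+1 *
    expR (u ^+ 2 * (N.+1%:R^-1 - (N.+1 + k)%:R^-1)) * moment_modulus u 0.
Proof.
elim: k => [|k IH].
  by rewrite addn0 subrr mulr0 expR0 mulr1 moment_modulus_le_start.
rewrite addnS moment_modulusS; set n := (N.+1 + k)%N in IH *.
have n0 : 0 < n%:R :> R by rewrite ltr0n /n addSn.
rewrite factS natrM exprMn.
set E := expR (u ^+ 2 * (N.+1%:R^-1 - n%:R^-1)) in IH.
have -> : expR (u ^+ 2 * (N.+1%:R^-1 - n.+1%:R^-1)) =
    expR (u ^+ 2 * (n%:R^-1 - n.+1%:R^-1)) * E.
  by rewrite -expRD; congr expR; ring.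
rewrite [leRHS](_ : _ = (n.+1%:R ^+ 2 * expR (u ^+ 2 * (n%:R^-1 - n.+1%:R^-1))) *
  (n`!%:R ^+ 2 * (1 + u ^+ 2) ^+ N.+1 * E * moment_modulus u 0)); last by ring.
apply: ler_pM IH; rewrite ?moment_modulus_ge0 ?addr_ge0 ?sqr_ge0//.
have n1 : 0 < n.+1%:R :> R by [].
apply: (@le_trans _ _ (n.+1%:R ^+ 2 * (1 + u ^+ 2 * (n%:R^-1 - n.+1%:R^-1)))); last first.
  by rewrite ler_pM2l ?exprn_gt0// expR_ge1Dx.
rewrite mulrDr mulr1 lerD2l mulrCA ler_peMr ?sqr_ge0//.
rewrite (_ : _ * _ = n.+1%:R / n%:R); last first.
  by rewrite -[n.+1%:R]natr1; field; rewrite natr1 !lt0r_neq0.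
by rewrite ler_pdivlMr// mul1r ler_nat.
Qed.

Lemma gamma_modulus_le1 u : gamma_modulus u <= 1.
Proof. by rewrite gamma_modulusE moment_modulus0_le1. Qed.

(** Compare the lower bound [moment_modulus_ge] with the upper bound
    [moment_modulus_le] at an index n >= u^2, where the former is at least
    (n + 1)!^2 / 4; the factorials cancel. *)
Lemma gamma_modulus_lower u N :
  4^-1 <= (1 + u ^+ 2) ^+ N.+1 * expR (u ^+ 2 / N.+1%:R) * gamma_modulus u.
Proof.
rewrite gamma_modulusE.
(* an index beyond both N and u^2 *)
pose k := Num.truncn (u ^+ 2); pose n := (N + k)%N.
have un : u ^+ 2 <= n.+1%:R.
  have /andP[_ +] := truncn_itv (sqr_ge0 u); move=> /ltW /le_trans; apply.
  by rewrite ler_nat /n ltnS leq_addl.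
have n0 : 0 < n.+1%:R :> R by [].
have h1 : u ^+ 2 <= 2 * n.+1%:R by rewrite (le_trans un)// ler_peMl// ler1n.
have := moment_modulus_ge h1.
have := moment_modulus_le u N k; rewrite addSn -/n => h2 h3.
have f0 : 0 < n.+1`!%:R ^+ 2 :> R by rewrite exprn_gt0// ltr0n fact_gt0.
have half : 2^-1 <= 1 - u ^+ 2 / (2 * n.+1%:R).
  rewrite lerBrDr -lerBrDl (_ : 1 - 2^-1 = 2^-1); last by field.
  by rewrite invfM mulrCA ler_piMr// ler_pdivrMr// mul1r.
rewrite exprMn in h3.
have h4 := le_trans h3 h2.
set E := expR _ in h4; set M := moment_modulus u 0 in h4 *.
rewrite (_ : _ * _ * E * M = n.+1`!%:R ^+ 2 * ((1 + u ^+ 2) ^+ N.+1 * (E * M))) in h4; last by ring.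
rewrite ler_pM2l// in h4.
have q : 4^-1 <= (1 - u ^+ 2 / (2 * n.+1%:R)) ^+ 2.
  have -> : 4^-1 = 2^-1 ^+ 2 :> R by field.
  by have := half; move: (1 - _) => z hz; rewrite !expr2; nra.
apply: (le_trans q); apply: (le_trans h4); rewrite -mulrA.
rewrite ler_wpM2l ?exprn_ge0 ?addr_ge0 ?sqr_ge0// ler_wpM2r ?moment_modulus_ge0//.
rewrite /E ler_expR ler_wpM2l ?sqr_ge0// lerBlDr lerDl.
by rewrite invr_ge0.
Qed.

Lemma gamma_modulus_gt0 u : 0 < gamma_modulus u.
Proof.
have := gamma_modulus_lower u 0.
have p : 0 < (1 + u ^+ 2) ^+ 1 * expR (u ^+ 2 / 1%:R).
  by rewrite mulr_gt0 ?expR_gt0// exprn_gt0// ltr_pwDl// sqr_ge0.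
move=> h; rewrite -(pmulr_rgt0 _ p); apply: lt_le_trans h.
by rewrite invr_gt0.
Qed.

(** A polynomial times exp(u^2 / (N + 1)): since N is arbitrary, the Gaussian
    factor of the heat kernel dominates it. *)
Lemma inv_gamma_modulus_le u N :
  (gamma_modulus u)^-1 <= 4 * ((1 + u ^+ 2) ^+ N.+1 * expR (u ^+ 2 / N.+1%:R)).
Proof.
have g0 := gamma_modulus_gt0 u.
rewrite -[leLHS]mul1r ler_pdivrMr//.
by have := gamma_modulus_lower u N; lra.
Qed.

(** The lower bound is [moment_modulus0_le1]; the upper bound is
    [moment_modulus_ge] at n = 0. *)
Lemma inv_gamma_modulus_near0 u : u ^+ 2 <= 1 ->
  1 <= (gamma_modulus u)^-1 <= (1 + u ^+ 2) / (1 - u ^+ 2 / 2) ^+ 2.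
Proof.
move=> u1; have g0 := gamma_modulus_gt0 u.
apply/andP; split; first by rewrite -[leLHS]invr1 lef_pV2 ?posrE// gamma_modulus_le1.
have h : u ^+ 2 <= 2 * 1%:R by rewrite mulr1; lra.
have := moment_modulus_ge h; rewrite moment_modulusS -gamma_modulusE.
rewrite (_ : 1`! = 1%N)// mul1r mulr1 expr1n => h2.
have d0 : 0 < (1 - u ^+ 2 / 2) ^+ 2 by rewrite exprn_gt0//; lra.
rewrite ler_pdivlMr// ler_pdivrMl//; apply: (le_trans h2).
by rewrite mulrC.
Qed.

Lemma cvg_inv_gamma_modulus (u_ : nat -> R) : u_ n @[n --> \oo] --> 0 ->
  (gamma_modulus (u_ n))^-1 @[n --> \oo] --> (1 : R).
Proof.
move=> u0.
have u20 : u_ n ^+ 2 @[n --> \oo] --> (0 : R).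
  by rewrite -[X in _ --> X](mulr0 0); under eq_fun do rewrite expr2; exact: cvgM.
apply: (@squeeze_cvgr _ _ _ _ (fun=> 1) (fun n => (1 + u_ n ^+ 2) / (1 - u_ n ^+ 2 / 2) ^+ 2)).
- near=> n; apply: inv_gamma_modulus_near0; near: n.
  exact: (cvgr_le _ u20).
- exact: cvg_cst.
- rewrite [X in _ --> X](_ : 1 = (1 + 0) / ((1 - 0 / 2) * (1 - 0 / 2))); last by rewrite mul0r addr0 subr0 mulr1 divr1.
  have hh : (1 - u_ n ^+ 2 / 2) @[n --> \oo] --> (1 - 0 / 2 : R).
    by apply: cvgB; [exact: cvg_cst|apply: cvgM; [exact: u20|exact: cvg_cst]].
  apply: cvgM; first by apply: cvgD; [exact: cvg_cst|exact: u20].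
  apply: cvgV; first by rewrite mul0r subr0 mulr1 oner_neq0.
  by under eq_fun do rewrite expr2; exact: cvgM.
Unshelve. all: by end_near. Qed.

End inverse_gamma_bounds.

(** * The rescaled heat kernel and transition densities *)

Section heat_kernel_limit.
Context (R : realType).
Local Notation mu := (@lebesgue_measure R).
Local Notation hl := (`]0, +oo[%classic : set R).
Implicit Types (e t u v x y : R).

Lemma measurable_cos_bessel :
  measurable_fun setT (fun p : R * R => cos_bessel p.1 p.2).
Proof.
apply: (measurable_Rintegral_param mu (f := fun p : (R * R) * R =>
  expR (- (p.1.2 * coshR p.2)) * cos (p.1.1 * p.2))) => //.
have m11 : measurable_fun setT (fun p : (R * R) * R => p.1.1).
  by apply: measurableT_comp; [exact: measurable_fst|exact: measurable_fst].
have m12 : measurable_fun setT (fun p : (R * R) * R => p.1.2).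
  by apply: measurableT_comp; [exact: measurable_snd|exact: measurable_fst].
have m2 : measurable_fun setT (fun p : (R * R) * R => p.2) by exact: measurable_snd.
apply: measurable_funM.
  do 2 apply: measurableT_comp => //; apply: measurable_funM => //.
  by apply: measurableT_comp; [exact: measurable_coshR|exact: m2].
apply: measurableT_comp; first exact: measurable_cos.
exact: measurable_funM.
Qed.

Lemma measurable_gamma_modulus : measurable_fun setT (@gamma_modulus R).
Proof.
have mul : measurable_fun setT (fun p : R * R => p.1 * ln p.2).
  apply: measurable_funM => //.
  by apply: measurableT_comp; [exact: measurable_ln|exact: measurable_snd].
have mE : measurable_fun setT (fun p : R * R => expR (- p.2)).
  by do 2 apply: measurableT_comp => //.
apply: measurable_funD; apply: measurable_funX.
- apply: (measurable_Rintegral_param mu (f := fun p : R * R => cos (p.1 * ln p.2) * expR (- p.2))) => //.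
  apply: measurable_funM => //.
  by apply: measurableT_comp; [exact: measurable_cos|exact: mul].
- apply: (measurable_Rintegral_param mu (f := fun p : R * R => sin (p.1 * ln p.2) * expR (- p.2))) => //.
  apply: measurable_funM => //.
  by apply: measurableT_comp; [exact: measurable_sin|exact: mul].
Qed.

Lemma measurable_inv_fun d (T : measurableType d) (f : T -> R) :
  measurable_fun setT f -> measurable_fun setT (fun z => (f z)^-1).
Proof.
move=> mf; rewrite (_ : (fun z => _) = (fun z => f z * (fun r => r `^ (-1)) (f z ^+ 2))).
  apply: measurable_funM => //; apply: (measurableT_comp (f := fun r => r `^ (-1))).
    exact: measurable_powR.
  exact: measurable_funX.
apply/funext => z; rewrite powR_inv1 ?sqr_ge0//.
by have [->|z0] := eqVneq (f z) 0; [rewrite invr0 mul0r|field].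
Qed.

Definition heat_integrand t x y u : R :=
  expR (- (t * u ^+ 2 / 4)) *
  (cos_bessel u (expR (- x)) * cos_bessel u (expR (- y))) *
  (u ^+ 2 / gamma_modulus u).

Lemma heat_kernelE t x y :
  heat_kernel t x y = 2 / pi * \int[mu]_(u in `]0, +oo[) heat_integrand t x y u.
Proof.
rewrite /heat_kernel; congr (_ * _); apply: eq_Rintegral => u uhl.
have u0 : 0 < u by move: uhl; rewrite inE /= in_itv /= andbT.
rewrite !besselK_imaginary normc_sq_cGamma//.
by rewrite /heat_integrand /= mulr0 subr0 invf_div.
Qed.

Lemma measurable_heat_integrand t :
  measurable_fun setT (fun p : (R * R) * R => heat_integrand t p.1.1 p.1.2 p.2).
Proof.
have m11 : measurable_fun setT (fun p : (R * R) * R => p.1.1).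
  by apply: measurableT_comp; [exact: measurable_fst|exact: measurable_fst].
have m12 : measurable_fun setT (fun p : (R * R) * R => p.1.2).
  by apply: measurableT_comp; [exact: measurable_snd|exact: measurable_fst].
have m2 : measurable_fun setT (fun p : (R * R) * R => p.2) by exact: measurable_snd.
have mB (z : (R * R) * R -> R) : measurable_fun setT z ->
    measurable_fun setT (fun p => cos_bessel p.2 (expR (- z p))).
  move=> mz.
  rewrite (_ : (fun p => _) = (fun q : R * R => cos_bessel q.1 q.2) \o
    (fun p => (p.2, expR (- z p))))//.
  apply: measurableT_comp; first exact: measurable_cos_bessel.
  apply: measurable_fun_pair => //.
  apply: measurableT_comp; first exact: measurable_expR.
  exact: measurableT_comp.
apply: measurable_funM; first apply: measurable_funM.
- do 2 apply: measurableT_comp => //.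
  by apply: measurable_funM => //; apply: measurable_funM => //; exact: measurable_funX.
- by apply: measurable_funM; exact: mB.
- apply: measurable_funM; first exact: measurable_funX.
  apply: measurable_inv_fun.
  by apply: measurableT_comp; [exact: measurable_gamma_modulus|exact: m2].
Qed.

Lemma measurable_heat_kernel t :
  measurable_fun setT (fun p : R * R => heat_kernel t p.1 p.2).
Proof.
under eq_fun do rewrite heat_kernelE.
apply: measurable_funM => //.
apply: (measurable_Rintegral_param mu (f := fun p : (R * R) * R => heat_integrand t p.1.1 p.1.2 p.2)) => //.
exact: measurable_heat_integrand.
Qed.

(** The integrand of the heat kernel after the substitution u = e v; the powers of
    e from the two Bessel functions and from the gamma factor cancel. *)
Definition scaled_heat_integrand e t x y v : R :=
  expR (- (t * v ^+ 2 / 4)) *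
  (damped_integral (fun w => cos (v * w)) e x *
   damped_integral (fun w => cos (v * w)) e y) *
  (v ^+ 2 / gamma_modulus (e * v)).

Definition scaled_heat_kernel e t x y : R :=
  2 / pi * \int[mu]_(v in `]0, +oo[) scaled_heat_integrand e t x y v.

Lemma heat_kernel_scale e t x y : 0 < e ->
  e^-1 * heat_kernel (t / e ^+ 2) (x / e) (y / e) = scaled_heat_kernel e t x y.
Proof.
move=> e0; rewrite /scaled_heat_kernel; have e_neq0 := lt0r_neq0 e0.
rewrite heat_kernelE (Rintegral_scale e0)//; last first.
  apply: measurable_funTS.
  exact: (measurable_fun_pair2 (x / e, y / e) (measurable_heat_integrand _)).
rewrite mulrCA mulKf//; congr (_ * _).
rewrite (_ : _ @^-1` _ = hl); last first.
  by apply/seteqP; split => v; rewrite /= !in_itv /= !andbT pmulr_rgt0.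
apply: eq_Rintegral => v _; rewrite /scaled_heat_integrand -!cos_bessel_scale//.
rewrite /heat_integrand.
rewrite (_ : t / e ^+ 2 * (e * v) ^+ 2 / 4 = t * v ^+ 2 / 4); last by field.
move: (cos_bessel _ _) (cos_bessel _ _) (gamma_modulus _)^-1 (expR _) => c1 c2 g E.
by ring.
Qed.

End heat_kernel_limit.

Section scaled_heat_kernel_limit.
Context (R : realType).
Local Notation mu := (@lebesgue_measure R).
Local Notation hl := (`]0, +oo[%classic : set R).
Implicit Types (e t u v x y : R).

Lemma polynomial_gaussian_dominated (c : R) (m : nat) : 0 < c ->
  exists2 C : R, 0 <= C & forall v,
    (1 + v ^+ 2) ^+ m * expR (- (c * v ^+ 2)) <= C * expR (- v).
Proof.
move=> c0; have c_neq0 := lt0r_neq0 c0.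
pose Cm : R := (2 * m.+1%:R) ^+ m.
exists (expR c / c ^+ m * Cm * expR (1 / (2 * c))).
  have cm : 0 < c ^+ m by rewrite exprn_gt0.
  by rewrite !mulr_ge0 ?expR_ge0 ?invr_ge0 ?exprn_ge0 ?mulr_ge0 ?(ltW c0).
move=> v; have v0 : 0 < 1 + v ^+ 2 by rewrite ltr_pwDl// sqr_ge0.
have := @exprn_expRN_le R m (c * (1 + v ^+ 2)) (mulr_ge0 (ltW c0) (ltW v0)).
rewrite -/Cm exprMn => h.
have -> : expR (- (c * v ^+ 2)) = expR c * expR (- (c * (1 + v ^+ 2))).
  by rewrite -expRD; congr expR; ring.
have h1 : (1 + v ^+ 2) ^+ m * (expR c * expR (- (c * (1 + v ^+ 2)))) <=
    expR c / c ^+ m * (Cm * expR (- (c * (1 + v ^+ 2) / 2))).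
  rewrite mulrCA -mulrA ler_pM2l ?expR_gt0// ler_pdivlMl ?exprn_gt0//.
  by rewrite mulrA.
apply: (le_trans h1); rewrite -!mulrA ler_pM2l ?expR_gt0// ler_pM2l ?invr_gt0 ?exprn_gt0//.
rewrite ler_wpM2l ?exprn_ge0 ?mulr_ge0// -expRD ler_expR.
(* c v^2 / 2 - v is bounded below by completing the square *)
rewrite -subr_ge0 (_ : _ - _ = (c * v - 1) ^+ 2 / (2 * c) + c / 2); last by field.
by rewrite addr_ge0 ?divr_ge0 ?sqr_ge0 ?mulr_ge0// ltW.
Qed.

Lemma abs_cos_le v w : `|cos (v * w)| <= coshR (0 * w) :> R.
Proof. by rewrite (le_trans (cos_max _))// coshR_ge1. Qed.

Lemma measurable_cosM v : measurable_fun setT (fun w : R => cos (v * w)).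
Proof.
by apply: measurableT_comp; [exact: measurable_cos|exact: mulrl_measurable].
Qed.

(** With 1 / (N + 1) <= t / 8 half of the Gaussian factor exp(- t v^2 / 4) survives
    the growth of 1 / |Gamma(1 + i e v)|^2. *)
Lemma scaled_heat_integrand_dominated t r : 0 < t -> exists2 C : R, 0 <= C &
  forall e x y v, 0 < e -> e <= 1 -> x <= r -> y <= r ->
    `|scaled_heat_integrand e t x y v| <= C * expR (- v).
Proof.
move=> t0; have [K KP] := damped_integral_bounded (0 : R) r.
have K0 : 0 <= K.
  apply: le_trans (KP (fun w => cos (0 * w)) 1 r (measurable_cosM 0) (abs_cos_le 0) ltr01 (lexx _) (lexx _)).
  exact: normr_ge0.
pose N := Num.truncn (8 / t).
have Nt : N.+1%:R^-1 <= t / 8.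
  rewrite -[leRHS]invrK invf_div lef_pV2 ?posrE ?divr_gt0//.
  by have /andP[_ /ltW] := truncn_itv (divr_ge0 (ler0n R 8) (ltW t0)).
have [C C0 CP] := polynomial_gaussian_dominated N.+2 (divr_gt0 t0 (ltr0n R 8)).
exists (K * K * (4 * C)); first by rewrite !mulr_ge0.
move=> e x y v e0 e1 xr yr.
have hx : `|damped_integral (fun w => cos (v * w)) e x| <= K.
  by apply: KP => //; [exact: measurable_cosM|exact: abs_cos_le].
have hy : `|damped_integral (fun w => cos (v * w)) e y| <= K.
  by apply: KP => //; [exact: measurable_cosM|exact: abs_cos_le].
rewrite /scaled_heat_integrand; move: hx hy.
move: (damped_integral _ e x) (damped_integral _ e y) => dx dy hx hy.
have g0 := gamma_modulus_gt0 (e * v).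
rewrite (normrM (_ * _)) (normrM (expR _)) (normrM dx) (normrM (v ^+ 2)).
rewrite (ger0_norm (expR_ge0 _)) (ger0_norm (sqr_ge0 v)).
rewrite (@gtr0_norm _ (gamma_modulus _)^-1) ?invr_gt0//.
rewrite mulrAC mulrC -[leRHS]mulrA.
apply: ler_pM; [exact: mulr_ge0| |exact: ler_pM|].
  apply: mulr_ge0; first exact: expR_ge0.
  by apply: mulr_ge0; [exact: sqr_ge0|rewrite invr_ge0 ltW].
have ev : (e * v) ^+ 2 <= v ^+ 2.
  by rewrite exprMn ler_piMl ?sqr_ge0// exprn_ile1// ltW.
have h1 := inv_gamma_modulus_le (e * v) N.
have h2 : (gamma_modulus (e * v))^-1 <=
    4 * ((1 + v ^+ 2) ^+ N.+1 * expR (v ^+ 2 * (t / 8))).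
  apply: (le_trans h1); rewrite ler_pM2l//; apply: ler_pM.
  - by rewrite exprn_ge0// addr_ge0 ?sqr_ge0.
  - exact: expR_ge0.
  - by apply: lerXn2r; rewrite ?nnegrE ?addr_ge0 ?sqr_ge0// lerD2l.
  - by rewrite ler_expR; apply: ler_pM => //; exact: sqr_ge0.
apply: (@le_trans _ _ (expR (- (t * v ^+ 2 / 4)) * ((1 + v ^+ 2) *
    (4 * ((1 + v ^+ 2) ^+ N.+1 * expR (v ^+ 2 * (t / 8))))))).
  rewrite ler_pM2l ?expR_gt0//; apply: ler_pM h2; rewrite ?sqr_ge0 ?invr_ge0 ?(ltW g0)//.
  by rewrite lerDr.
have -> : expR (v ^+ 2 * (t / 8)) = expR (t * v ^+ 2 / 4) * expR (- (t / 8 * v ^+ 2)).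
  by rewrite -expRD; congr expR; field.
have E1 : expR (- (t * v ^+ 2 / 4)) * expR (t * v ^+ 2 / 4) = 1.
  by rewrite -expRD addNr expR0.
rewrite (_ : _ * _ = 4 * ((1 + v ^+ 2) ^+ N.+2 * expR (- (t / 8 * v ^+ 2))) *
  (expR (- (t * v ^+ 2 / 4)) * expR (t * v ^+ 2 / 4))); last by rewrite (exprS _ N.+1); ring.
by rewrite E1 mulr1 -[leRHS]mulrA ler_pM2l.
Qed.

Lemma measurable_scaled_heat_integrand e t x y : 0 < e ->
  measurable_fun setT (scaled_heat_integrand e t x y).
Proof.
move=> e0.
have mD z : measurable_fun setT (fun v => damped_integral (fun w => cos (v * w)) e z).
  apply: (measurable_Rintegral_param mu (f := fun p : R * R => damp e z p.2 * cos (p.1 * p.2))) => //.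
  apply: measurable_funM.
    by apply: measurableT_comp; [exact: measurable_damp_w|exact: measurable_snd].
  by apply: measurableT_comp; [exact: measurable_cos|exact: measurable_funM].
apply: measurable_funM; first apply: measurable_funM.
- do 2 apply: measurableT_comp => //.
  by apply: measurable_funM => //; apply: measurable_funM => //; exact: measurable_funX.
- by apply: measurable_funM; exact: mD.
- apply: measurable_funM; first exact: measurable_funX.
  apply: measurable_inv_fun.
  by apply: measurableT_comp; [exact: measurable_gamma_modulus|exact: mulrl_measurable].
Qed.

Lemma integrable_expRN_open : mu.-integrable hl (EFin \o (fun v => expR (- v))).
Proof.
apply: (@integrableS _ _ R mu `[0, +oo[%classic hl _ (measurable_itv _) (measurable_itv _) _ (@integrable_expRN R)).
by move=> v; rewrite /= !in_itv /= !andbT; exact: ltW.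
Qed.

(** The damped integrals of cos(v w) tend to sin(v x) / v and sin(v y) / v, and
    the factor v^2 cancels the denominators. *)
Lemma cvg_scaled_heat_kernel t x y (e_ : nat -> R) : 0 < t -> 0 < x -> 0 < y ->
  (forall n, 0 < e_ n) -> (forall n, e_ n <= 1) -> e_ n @[n --> \oo] --> 0 ->
  scaled_heat_kernel (e_ n) t x y @[n --> \oo] --> g_kernel t x y.
Proof.
rewrite /scaled_heat_kernel.
move=> t0 x0 y0 e0 e1 ecvg.
pose r := Num.max x y.
have [C C0 CP] := scaled_heat_integrand_dominated r t0.
rewrite /g_kernel; apply: cvgM; first exact: cvg_cst.
apply: (@Rintegral_dct R _ _ mu hl _ _ (fun v => C * expR (- v))) => //.
- move=> n; exact: (measurable_funTS (measurable_scaled_heat_integrand _ _ _ (e0 n))).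
- apply: measurable_funTS; apply: measurable_funM; first apply: measurable_funM.
  + do 2 apply: measurableT_comp => //.
    by apply: measurable_funM => //; apply: measurable_funM => //; exact: measurable_funX.
  + by apply: measurableT_comp; [exact: measurable_sin|exact: mulrl_measurable].
  + by apply: measurableT_comp; [exact: measurable_sin|exact: mulrl_measurable].
- apply: aeW => v; rewrite /= in_itv /= andbT => v0.
  have v_neq0 := lt0r_neq0 v0.
  have cvD z : 0 < z -> damped_integral (fun w => cos (v * w)) (e_ n) z @[n --> \oo] -->
      sin (v * z) / v.
    move=> z0; rewrite -Rintegral_cos//.
    by apply: (cvg_damped_integral (a := 0)) => //; [exact: measurable_cosM|exact: abs_cos_le].
  have cvG : (gamma_modulus (e_ n * v))^-1 @[n --> \oo] --> (1 : R).
    apply: cvg_inv_gamma_modulus; rewrite -(mul0r v).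
    by apply: cvgM; [exact: ecvg|exact: cvg_cst].
  rewrite (_ : expR _ * _ * _ = expR (- (t * v ^+ 2 / 4)) *
    (sin (v * x) / v * (sin (v * y) / v)) * (v ^+ 2 * 1)); last first.
    rewrite [x * v]mulrC [y * v]mulrC; move: (expR _) (sin _) (sin _) => E s1 s2.
    by field.
  apply: cvgM; last by apply: cvgM; [exact: cvg_cst|exact: cvG].
  by apply: cvgM; [exact: cvg_cst|apply: cvgM; exact: cvD].
- have := @integrableZl _ _ R mu hl (measurable_itv _) C _ integrable_expRN_open.
  exact.
- by move=> n v _; apply: CP => //; rewrite le_max lexx ?orbT.
Qed.

End scaled_heat_kernel_limit.

Section rescaled_transition_density.
Context (R : realType).
Local Notation mu := (@lebesgue_measure R).
Implicit Types (a e s t x y lo hi : R).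

Lemma bounded_cvg_onI (T : Type) (I : set T) (f_ : nat -> T -> R) (f : T -> R) (K : R) :
  (forall (n : nat) (z : T), I z -> `|f_ n z| <= K) ->
  (forall z : T, I z -> f_ ^~ z @ \oo --> f z) -> bounded_cvg_on I f_ f.
Proof.
move=> fK ff; split; [by exists K| |by []].
exists K => z Iz; have := ff z Iz => /cvg_norm fx.
by apply: (cvgr_to_le fx); apply: nearW => n; exact: fK.
Qed.

Lemma measurable_besselKr a : measurable_fun setT (besselKr a).
Proof.
rewrite (_ : besselKr a = fun x => \int[mu]_(w in `[0, +oo[) (expR (- (x * coshR w)) * coshR (a * w))).
  apply: (measurable_Rintegral_param mu (f := fun p : R * R =>
    expR (- (p.1 * coshR p.2)) * coshR (a * p.2))) => //.
  apply: measurable_funM.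
    do 2 apply: measurableT_comp => //; apply: measurable_funM => //.
    by apply: measurableT_comp; [exact: measurable_coshR|exact: measurable_snd].
  by apply: measurableT_comp; [exact: measurable_coshR|exact: measurable_funM].
by apply/funext => x; exact: besselKr_integral.
Qed.

Lemma measurable_Z_trans_density a s t :
  measurable_fun setT (fun p : R * R => Z_trans_density a s t p.1 p.2).
Proof.
have mK (z : R * R -> R) : measurable_fun setT z ->
    measurable_fun setT (fun p => besselKr a (expR (- z p))).
  move=> mz; apply: measurableT_comp; first exact: measurable_besselKr.
  by apply: measurableT_comp; [exact: measurable_expR|exact: measurableT_comp].
apply: measurable_funM; last exact: measurable_heat_kernel.
apply: measurable_funM; first by apply: measurable_funM => //; exact: mK.
by apply: measurable_inv_fun; apply: measurable_funM => //; exact: mK.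
Qed.

Definition cosh_damped a e x : R := damped_integral (fun w => coshR (a * w)) e x.

Lemma cvg_cosh_damped a (e_ : nat -> R) x : a != 0 -> 0 < x ->
  (forall n, 0 < e_ n) -> (forall n, e_ n <= 1) -> e_ n @[n --> \oo] --> 0 ->
  cosh_damped a (e_ n) x @[n --> \oo] --> sinhR (a * x) / a.
Proof.
move=> a0 x0 e0 e1 ecvg; rewrite -Rintegral_coshR//.
by apply: (cvg_damped_integral (a := a)) => //; [exact: measurable_coshRM|exact: abs_coshR_le].
Qed.

Lemma sinhR_div_gt0 a x : a != 0 -> 0 < x -> 0 < sinhR (a * x) / a.
Proof.
have pos (b y : R) : 0 < b -> 0 < y -> 0 < sinhR (b * y) / b.
  by move=> b0 y0; rewrite divr_gt0// (lt_le_trans _ (sinhR_ge _)) ?mulr_gt0.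
rewrite neq_lt => /orP[a0|a0] x0; last exact: pos.
have -> : sinhR (a * x) / a = sinhR (- a * x) / - a.
  have a0' : a != 0 by rewrite lt_eqF.
  by rewrite /sinhR mulNr opprK; field; rewrite ?oppr_eq0 ?a0'.
by apply: pos => //; rewrite oppr_gt0.
Qed.

Lemma scaled_Z_trans_density a e s t x y : 0 < e ->
  e^-1 * Z_trans_density (a * e) (s / e ^+ 2) (t / e ^+ 2) (x / e) (y / e) =
  expR (- (a ^+ 2 * t / 4)) * cosh_damped a e y /
    (expR (- (a ^+ 2 * s / 4)) * cosh_damped a e x) *
  scaled_heat_kernel e (t - s) x y.
Proof.
move=> e0; have e_neq0 := lt0r_neq0 e0.
have hk := heat_kernel_scale (t - s) x y e0.
have ky := besselKr_scale a y e0; have kx := besselKr_scale a x e0.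
rewrite /cosh_damped -hk -ky -kx.
rewrite /Z_trans_density -mulrBl.
have E z : (a * e) ^+ 2 * (z / e ^+ 2) / 4 = a ^+ 2 * z / 4 by field.
rewrite !E.
move: (heat_kernel _ _ _) (besselKr _ _) (besselKr _ _) => h k1 k2.
move: (expR _) (expR _) => E1 E2; rewrite !invfM.
by move: (k1^-1) (E1^-1) => k1' E1'; field.
Qed.

Lemma scaled_heat_kernel_bounded t r : 0 < t -> exists K : R,
  forall e x y, 0 < e -> e <= 1 -> x <= r -> y <= r ->
    `|scaled_heat_kernel e t x y| <= K.
Proof.
move=> t0; have [C C0 CP] := scaled_heat_integrand_dominated r t0.
have iC : mu.-integrable `]0, +oo[ (EFin \o (fun v : R => C * expR (- v))).
  exact: (@integrableZl _ _ R mu `]0, +oo[%classic (measurable_itv _) C _ (@integrable_expRN_open R)).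
exists (`|2 / pi| * \int[mu]_(v in `]0, +oo[) (C * expR (- v))) => e x y e0 e1 xr yr.
have mh := measurable_scaled_heat_integrand t x y e0.
have ih : mu.-integrable `]0, +oo[ (EFin \o scaled_heat_integrand e t x y).
  apply: (@integrable_dominated _ _ _ mu _ _ (fun v => C * expR (- v))) => //.
    exact: (measurable_funTS mh).
  by move=> v _; exact: CP.
rewrite /scaled_heat_kernel normrM ler_wpM2l//.
apply: (le_trans (le_normr_Rintegral _ _)) => //.
apply: le_Rintegral => //; first by have /integrable_norm := ih; exact.
by move=> v _; exact: CP.
Qed.

(** Numerator and denominator converge to sinh(a y) / a and sinh(a x) / a up to
    exponential factors; on [lo, hi] the denominator is bounded below by
    [damped_integral_lower]. *)
Lemma bounded_cvg_trans_density a (e_ : nat -> R) s t lo hi : a != 0 -> 0 < lo -> s < t ->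
  (forall n, 0 < e_ n) -> (forall n, e_ n <= 1) -> e_ n @[n --> \oo] --> 0 ->
  bounded_cvg_on (`[lo, hi] `*` `[lo, hi])
    (fun n p => (e_ n)^-1 * Z_trans_density (a * e_ n) (s / e_ n ^+ 2) (t / e_ n ^+ 2)
                  (p.1 / e_ n) (p.2 / e_ n))
    (fun p => rho_trans_density a s t p.1 p.2).
Proof.
move=> a0 lo0 st e0 e1 ecvg.
have ts0 : 0 < t - s by rewrite subr_gt0.
have [K1 K1P] := damped_integral_bounded a hi.
have [K2 K2P] := scaled_heat_kernel_bounded hi ts0.
have KP n z : z <= hi -> `|cosh_damped a (e_ n) z| <= K1.
  by move=> zhi; apply: K1P => //; [exact: measurable_coshRM|exact: abs_coshR_le].
pose L := expR (- (a ^+ 2 * s / 4)) * (lo * expR (-1)).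
have L0 : 0 < L by rewrite !mulr_gt0 ?expR_gt0.
apply: (@bounded_cvg_onI _ _ _ _ (expR (- (a ^+ 2 * t / 4)) * K1 / L * K2)).
- move=> n [x y] [/=]; rewrite !in_itv /= => /andP[lox xhi] /andP[loy yhi].
  rewrite scaled_Z_trans_density// normrM.
  have low := damped_integral_lower a (e0 n) (e1 n) lo0 lox.
  have low' : L <= expR (- (a ^+ 2 * s / 4)) * cosh_damped a (e_ n) x.
    by rewrite ler_pM2l ?expR_gt0.
  apply: ler_pM => //; last exact: K2P.
  rewrite normrM normrV ?unitfE ?gt_eqF// ?(lt_le_trans L0)//.
  apply: ler_pM => //.
    by rewrite normrM (ger0_norm (expR_ge0 _)) ler_pM2l ?expR_gt0// KP.
  rewrite lef_pV2 ?posrE//; last by rewrite gtr0_norm (lt_le_trans L0).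
  by rewrite gtr0_norm// (lt_le_trans L0).
- move=> [x y] [/=]; rewrite !in_itv /= => /andP[lox xhi] /andP[loy yhi].
  have x0 := lt_le_trans lo0 lox; have y0 := lt_le_trans lo0 loy.
  under eq_fun do rewrite scaled_Z_trans_density//.
  have -> : rho_trans_density a s t x y =
    expR (- (a ^+ 2 * t / 4)) * (sinhR (a * y) / a) /
    (expR (- (a ^+ 2 * s / 4)) * (sinhR (a * x) / a)) * g_kernel (t - s) x y.
    rewrite /rho_trans_density; congr (_ * _).
    have sx := sinhR_div_gt0 a0 x0.
    have sx0 : sinhR (a * x) != 0.
      by apply: contraTneq sx => ->; rewrite mul0r ltxx.
    have E0 : expR (- (a ^+ 2 * s / 4)) != 0 by rewrite gt_eqF ?expR_gt0.
    move: (sinhR (a * x)) (sinhR (a * y)) (expR (- (a ^+ 2 * s / 4)))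
      (expR (- (a ^+ 2 * t / 4))) sx0 E0 => p q E F p0 E0.
    by field; rewrite a0 p0 E0.
  apply: cvgM; last exact: cvg_scaled_heat_kernel.
  apply: cvgM; first by apply: cvgM; [exact: cvg_cst|exact: cvg_cosh_damped].
  apply: cvgV.
    by rewrite mulf_neq0// ?gt_eqF ?expR_gt0 ?sinhR_div_gt0.
  by apply: cvgM; [exact: cvg_cst|exact: cvg_cosh_damped].
Qed.

End rescaled_transition_density.

(** * The rescaled initial density *)

Section real_gamma_near_zero.
Context (R : realType).
Local Notation mu := (@lebesgue_measure R).
Local Notation hl := (`]0, +oo[%classic : set R).
Implicit Types (r x y z : R).

(** 1 + r dominates r^x for all exponents x in (0, 1] at once. *)
Lemma expR_ln_le x r : 0 < x -> x <= 1 -> 0 < r -> expR (x * ln r) <= 1 + r.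
Proof.
move=> x0 x1 r0; have [l0|l0] := leP 0 (ln r).
  apply: (@le_trans _ _ r); last by rewrite lerDr.
  by rewrite -[leRHS]lnK ?posrE// ler_expR ler_piMl.
apply: (@le_trans _ _ 1); last by rewrite lerDl ltW.
by rewrite -[leRHS]expR0 ler_expR nmulr_lle0 ?(ltW x0).
Qed.

Let derive_rx x r : 0 < r ->
  is_derive r 1 (fun r => expR (x * ln r) * expR (- r))
    (x * (expR ((x - 1) * ln r) * expR (- r)) - expR (x * ln r) * expR (- r)).
Proof.
move=> r0; have dl := is_derive1_ln r0; have r_neq0 := lt0r_neq0 r0.
apply: is_derive_eq; rewrite /GRing.scale /=.
have -> : expR ((x - 1) * ln r) = expR (x * ln r) / r.
  by rewrite mulrBl mul1r expRD expRN lnK ?posrE.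
by field.
Qed.

Let continuous_rx x r : 0 < r -> {for r, continuous (fun r => expR (x * ln r) * expR (- r))}.
Proof.
move=> r0; apply: cvgM.
  apply: continuous_comp; last exact: continuous_expR.
  by apply: cvgM; [exact: cvg_cst|exact: continuous_ln].
by apply: continuous_comp; [exact: opp_continuous|exact: continuous_expR].
Qed.

Let continuous_E r : {for r, continuous (fun r : R => expR (- r))}.
Proof. by apply: continuous_comp; [exact: opp_continuous|exact: continuous_expR]. Qed.

Let poly_exp_le1 r : 0 <= r -> (1 + r) * expR (- r) <= 1.
Proof.
by move=> r0; rewrite expRN ler_pdivrMr ?expR_gt0// mul1r expR_ge1Dx.
Qed.

Let integrable_dom : mu.-integrable hl (EFin \o (fun r => (1 + r) * expR (- r))).
Proof.
have l1 (r : R) : 0 < r -> `|(fun=> 1 : R) r| <= 1 by rewrite normr1.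
have i0 := @moment_integrable R 0 (fun=> 1) 1 (measurable_cst _) l1.
have i1 := @moment_integrable R 1 (fun=> 1) 1 (measurable_cst _) l1.
have := @integrableD _ _ R mu hl (measurable_itv _) _ _ i0 i1.
rewrite (_ : (_ \+ _)%E = EFin \o (fun r => (1 + r) * expR (- r)))//.
by apply/funext => r; rewrite /= -EFinD expr0 expr1 !mul1r mulrDl mul1r.
Qed.

Let measurable_rx x : measurable_fun setT (fun r : R => expR (x * ln r) * expR (- r)).
Proof.
apply: measurable_funM; last by do 2 apply: measurableT_comp => //.
apply: measurableT_comp => //; apply: measurable_funM => //; exact: measurable_ln.
Qed.

Let integrable_rx x : 0 < x -> x <= 1 ->
  mu.-integrable hl (EFin \o (fun r => expR (x * ln r) * expR (- r))).
Proof.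
move=> x0 x1; apply: (@integrable_dominated _ _ _ mu _ _ (fun r => (1 + r) * expR (- r))) => //.
  exact: (measurable_funTS (measurable_rx x)).
move=> r; rewrite /= in_itv /= andbT => r0.
by rewrite ger0_norm ?mulr_ge0 ?expR_ge0// ler_pM2r ?expR_gt0// expR_ln_le.
Qed.

(** x r^(x - 1) exp(- r) is singular at 0, but up to an integrable term it is the
    derivative of r^x exp(- r). Adding (1 + r) exp(- r), the derivative of
    - (2 + r) exp(- r), makes that derivative nonnegative, so that boundedness of
    the primitive gives integrability. *)
Let integrable_rx1 x : 0 < x -> x <= 1 ->
  mu.-integrable hl (EFin \o (fun r => x * (expR ((x - 1) * ln r) * expR (- r)))).
Proof.
move=> x0 x1.
pose F r := expR (x * ln r) * expR (- r) - (2 + r) * expR (- r).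
pose f r := x * (expR ((x - 1) * ln r) * expR (- r)) - expR (x * ln r) * expR (- r)
  + (1 + r) * expR (- r).
have g0 r : 0 <= x * (expR ((x - 1) * ln r) * expR (- r)).
  by rewrite !mulr_ge0 ?expR_ge0// ltW.
have h0 r : 0 < r -> 0 <= (1 + r) * expR (- r) - expR (x * ln r) * expR (- r).
  by move=> r0; rewrite -mulrBl mulr_ge0 ?expR_ge0// subr_ge0 expR_ln_le.
have mg : measurable_fun setT (fun r => x * (expR ((x - 1) * ln r) * expR (- r))).
  by apply: measurable_funM => //; exact: measurable_rx.
apply: (@integrable_dominated _ _ _ mu _ _ f) => //.
- exact: (measurable_funTS mg).
- apply: (@ge0_half_line_integrable R F f _ _ 3).
  + move=> r r0; have d1 := derive_rx x r0.
    have d2 : is_derive r 1 (fun r : R => (2 + r) * expR (- r)) (- ((1 + r) * expR (- r))).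
      by apply: is_derive_eq; rewrite /GRing.scale /=; ring.
    have := is_deriveB d1 d2; rewrite opprK; exact.
  + move=> r r0; apply: cvgD; [apply: cvgB|].
    * by apply: cvgM; [exact: cvg_cst|exact: continuous_rx].
    * exact: continuous_rx.
    * apply: cvgM; last exact: continuous_E.
      by apply: cvgD; [exact: cvg_cst|exact: cvg_id].
  + move=> r r0; rewrite /f -addrA addr_ge0//.
    by rewrite addrC h0.
  + move=> r r0; rewrite /F.
    have p1 := poly_exp_le1 (ltW r0).
    have p2 : expR (x * ln r) * expR (- r) <= (1 + r) * expR (- r).
      by rewrite ler_pM2r ?expR_gt0// expR_ln_le.
    have p3 : 0 <= expR (x * ln r) * expR (- r) by rewrite mulr_ge0 ?expR_ge0.
    have p4 : expR (- r) <= 1 by rewrite -[leRHS]expR0 ler_expR oppr_le0 ltW.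
    have p5 : (2 + r) * expR (- r) = expR (- r) + (1 + r) * expR (- r) by ring.
    have p6 := expR_ge0 (- r).
    rewrite p5 ler_norml; apply/andP; split; lra.
- move=> r; rewrite /= in_itv /= andbT => r0.
  by rewrite ger0_norm// /f -addrA lerDl addrC h0.
Qed.

Let cvg_rx_at0 x : 0 < x -> expR (x * ln (m.+2%:R^-1)) @[m --> \oo] --> (0 : R).
Proof.
move=> x0; apply/cvgr0Pnorm_le => eps eps0.
near=> m; rewrite ger0_norm ?expR_ge0// -[leRHS]lnK ?posrE// ler_expR.
rewrite lnV ?posrE// mulrN lerNl -ler_pdivrMl//.
rewrite -ler_expR lnK ?posrE//.
apply: (@le_trans _ _ m%:R); last by rewrite ler_nat -addn2 leq_addr.
by near: m; exact: nbhs_infty_ger.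
Unshelve. all: by end_near. Qed.

Lemma Gammar_functional x : 0 < x -> x <= 1 ->
  x * Gammar x = \int[mu]_(r in `]0, +oo[) (expR (x * ln r) * expR (- r)).
Proof.
move=> x0 x1; have i1 := integrable_rx1 x0 x1; have i2 := integrable_rx x0 x1.
have i3 : mu.-integrable hl (EFin \o (fun r => expR ((x - 1) * ln r) * expR (- r))).
  have := @integrableZl _ _ R mu hl (measurable_itv _) x^-1 _ i1.
  rewrite (_ : (fun r => _) = EFin \o (fun r => expR ((x - 1) * ln r) * expR (- r)))//.
  by apply/funext => r; rewrite /= -EFinM mulKf// lt0r_neq0.
rewrite Gammar_integral// -RintegralZl//.
apply/eqP; rewrite -subr_eq0 -RintegralB//; apply/eqP.
rewrite -[RHS](subrr 0).
apply: (@Rintegral_half_line_FTC R (fun r => expR (x * ln r) * expR (- r))).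
- by move=> r r0; exact: derive_rx.
- move=> r r0; apply: cvgB; last exact: continuous_rx.
  by apply: cvgM; [exact: cvg_cst|exact: continuous_rx].
- exact: (@integrableB _ _ R mu hl (measurable_itv _) _ _ i1 i2).
- apply: (@squeeze_cvgr _ _ _ _ (fun=> 0) (fun m => expR (x * ln (m.+2%:R^-1)))).
  + apply: nearW => m; apply/andP; split; first by rewrite mulr_ge0 ?expR_ge0.
    apply: ler_piMr; first exact: expR_ge0.
    by rewrite -[leRHS]expR0 ler_expR oppr_le0.
  + exact: cvg_cst.
  + exact: cvg_rx_at0.
- apply: (@cvg0_of_le_inv R _ ((2 * 2%:R) ^+ 1 * 2 + 1)) => m.
  set r : R := m.+2%:R; have r0 : 0 < r by [].
  rewrite ger0_norm ?mulr_ge0 ?expR_ge0//.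
  apply: (@le_trans _ _ ((1 + r) * expR (- r))).
    by rewrite ler_pM2r ?expR_gt0// expR_ln_le.
  have h1 := exprn_expRN_le 1 (ltW r0).
  have h2 : expR (- (r / 2)) <= 2 / r.
    by apply: (le_trans (expRN_le_inv _)); rewrite ?divr_gt0// invf_div.
  have h3 := expRN_le_inv r0.
  have h4 := le_trans h1 (ler_wpM2l (exprn_ge0 1 (mulr_ge0 (ler0n R 2) (ler0n R 2))) h2).
  have -> : (1 + r) * expR (- r) = expR (- r) + r ^+ 1 * expR (- r) by rewrite expr1; ring.
  have -> : ((2 * 2%:R) ^+ 1 * 2 + 1) / r = r^-1 + (2 * 2%:R) ^+ 1 * (2 / r) by ring.
  exact: lerD.
Qed.

(** x Gamma(x) is the integral of r^x exp(- r), and r^x tends to 1. *)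
Lemma cvg_xGammar (x_ : nat -> R) : (forall n, 0 < x_ n) -> (forall n, x_ n <= 1) ->
  x_ n @[n --> \oo] --> 0 -> x_ n * Gammar (x_ n) @[n --> \oo] --> (1 : R).
Proof.
move=> x0 x1 xcvg; under eq_fun do rewrite Gammar_functional//.
rewrite -(moment0_cst1 R).
apply: (@Rintegral_dct R _ _ mu hl _ _ (fun r => (1 + r) * expR (- r))) => //.
- by move=> n; exact: (measurable_funTS (measurable_rx _)).
- by apply: measurable_funTS; apply: measurable_funM => //; apply: measurable_funM => //; do 2 apply: measurableT_comp => //.
- apply: aeW => r _; rewrite expr0 mul1r.
  apply: cvgM; last exact: cvg_cst.
  rewrite -expR0; apply: continuous_cvg; first exact: continuous_expR.
  by rewrite -[X in _ --> X](mul0r (ln r)); apply: cvgM; [exact: xcvg|exact: cvg_cst].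
- move=> n r; rewrite /= in_itv /= andbT => r0.
  by rewrite ger0_norm ?mulr_ge0 ?expR_ge0// ler_pM2r ?expR_gt0// expR_ln_le.
Qed.

Lemma cvg_scaled_Gammar (e_ : nat -> R) z : 0 < z -> (forall n, 0 < e_ n) ->
  e_ n @[n --> \oo] --> 0 -> e_ n * Gammar (e_ n * z) @[n --> \oo] --> z^-1.
Proof.
move=> z0 e0 ecvg; have z_neq0 := lt0r_neq0 z0.
have xcvg : e_ n * z @[n --> \oo] --> (0 : R).
  by rewrite -(mul0r z); apply: cvgM; [exact: ecvg|exact: cvg_cst].
have [N _ NP] : \forall n \near \oo, e_ n * z <= 1 by exact: (cvgr_le _ xcvg).
rewrite -(cvg_shiftn N).
have xN : e_ (n + N)%N * z @[n --> \oo] --> (0 : R).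
  by rewrite (cvg_shiftn N (fun n => e_ n * z)).
have := cvg_xGammar (x_ := fun n => e_ (n + N)%N * z) _ _ xN.
move=> /(_ (fun n => mulr_gt0 (e0 _) z0) (fun n => NP _ (leq_addl _ _))) h.
rewrite (_ : (fun n => _) = (fun n => e_ (n + N)%N * z * Gammar (e_ (n + N)%N * z) * z^-1)).
  by have := cvgM h (cvg_cst z^-1); rewrite mul1r; exact.
by apply/funext => n; rewrite /= mulrAC mulfK.
Qed.

End real_gamma_near_zero.

Section rescaled_initial_density.
Context (R : realType).
Local Notation mu := (@lebesgue_measure R).
Implicit Types (a c e x lo hi : R).

Lemma measurable_Z_init_density a c : measurable_fun setT (Z_init_density a c : R -> R).
Proof.
apply: measurable_funM; last first.
  apply: measurableT_comp; first exact: measurable_besselKr.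
  by do 2 apply: measurableT_comp => //.
by apply: measurable_funM => //; do 3 apply: measurableT_comp => //.
Qed.

Lemma measurable_mu_density a c : measurable_fun setT (mu_density a c : R -> R).
Proof.
apply: measurable_funM; last by apply: measurable_indic.
apply: measurable_funM => //; apply: measurable_funB; do 3 apply: measurableT_comp => //.
Qed.

Definition init_prefactor a c e : R :=
  4 / (2 `^ (c * e) * (e * Gammar (e * ((c - a) / 2))) * (e * Gammar (e * ((a + c) / 2)))).

Lemma scaled_Z_init_density a c e x : 0 < e ->
  e^-1 * Z_init_density (a * e) (c * e) (x / e) =
  init_prefactor a c e * expR (- (c * x)) * cosh_damped a e x.
Proof.
move=> e0; have e_neq0 := lt0r_neq0 e0; have kx := besselKr_scale a x e0.
rewrite /cosh_damped -kx /Z_init_density /init_prefactor.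
have -> : (c * e - a * e) / 2 = e * ((c - a) / 2) by ring.
have -> : (a * e + c * e) / 2 = e * ((a + c) / 2) by ring.
have -> : c * e * (x / e) = c * x by field.
move: (besselKr _ _) (Gammar _) (Gammar _) (_ `^ _) (expR _) => k g1 g2 p E.
rewrite !invfM; move: (g1^-1) (g2^-1) (p^-1) => g1' g2' p'; by field.
Qed.

Lemma cvg_init_prefactor a c (e_ : nat -> R) : 0 < a + c -> 0 < c - a ->
  (forall n, 0 < e_ n) -> e_ n @[n --> \oo] --> 0 ->
  init_prefactor a c (e_ n) @[n --> \oo] --> c ^+ 2 - a ^+ 2.
Proof.
move=> ac0 ca0 e0 ecvg.
have p0 : (c - a) / 2 > 0 by rewrite divr_gt0.
have q0 : (a + c) / 2 > 0 by rewrite divr_gt0.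
have G1 := cvg_scaled_Gammar p0 e0 ecvg; have G2 := cvg_scaled_Gammar q0 e0 ecvg.
have P1 : 2 `^ (c * e_ n) @[n --> \oo] --> (1 : R).
  rewrite (_ : (fun n => _) = (fun n => expR (c * e_ n * ln 2))); last first.
    by apply/funext => n; rewrite /powR pnatr_eq0.
  have h : c * e_ n * ln 2 @[n --> \oo] --> (0 : R).
    have := cvgM (cvgM (cvg_cst c) ecvg) (cvg_cst (ln 2 : R)).
    by rewrite mulr0 mul0r; exact.
  by have := continuous_cvg _ (@continuous_expR R 0) h; rewrite expR0; exact.
have h := cvgM (cvgM P1 G1) G2.
have nz : 1 * ((c - a) / 2)^-1 * ((a + c) / 2)^-1 != 0.
  by rewrite mul1r mulf_neq0// invr_eq0 gt_eqF.
have := cvgM (cvg_cst (4 : R)) (cvgV nz (h _ _)).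
have -> : 4 * (1 * ((c - a) / 2)^-1 * ((a + c) / 2)^-1)^-1 = c ^+ 2 - a ^+ 2.
  by field; rewrite !gt_eqF.
exact.
Qed.

Lemma bounded_cvg_init_density a c (e_ : nat -> R) lo hi : a != 0 -> 0 < a + c -> 0 < c - a ->
  0 < lo -> (forall n, 0 < e_ n) -> (forall n, e_ n <= 1) -> e_ n @[n --> \oo] --> 0 ->
  bounded_cvg_on `[lo, hi]
    (fun n x => (e_ n)^-1 * Z_init_density (a * e_ n) (c * e_ n) (x / e_ n))
    (mu_density a c).
Proof.
move=> a0 ac0 ca0 lo0 e0 e1 ecvg.
have pre := cvg_init_prefactor ac0 ca0 e0 ecvg.
have [M [Mr MP]] := cvg_seq_bounded (cvgP _ pre).
have {}MP n : `|init_prefactor a c (e_ n)| <= M + 1 by apply: MP; rewrite ?ltrDl.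
have [K KP] := damped_integral_bounded a hi.
have c0 : 0 < c by lra.
apply: (@bounded_cvg_onI _ _ _ _ _ ((M + 1) * 1 * K)).
- move=> n x; rewrite /= in_itv /= => /andP[lox xhi].
  rewrite scaled_Z_init_density// normrM; apply: ler_pM => //.
    rewrite normrM; apply: ler_pM => //.
    rewrite ger0_norm ?expR_ge0// -[leRHS]expR0 ler_expR oppr_le0 mulr_ge0 ?ltW//.
    exact: lt_le_trans lo0 lox.
  by apply: KP => //; [exact: measurable_coshRM|exact: abs_coshR_le].
- move=> x; rewrite /= in_itv /= => /andP[lox xhi].
  have x0 := lt_le_trans lo0 lox.
  under eq_fun do rewrite scaled_Z_init_density//.
  have -> : mu_density a c x = (c ^+ 2 - a ^+ 2) * expR (- (c * x)) * (sinhR (a * x) / a).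
    rewrite /mu_density indicE mem_set /= ?in_itv /= ?x0// mulr1 /sinhR.
    have -> : (a - c) * x = a * x + - (c * x) by ring.
    have -> : - ((a + c) * x) = - (a * x) + - (c * x) by ring.
    rewrite !expRD; move: (expR _) (expR _) (expR _) => E1 E2 E3; by field.
  apply: cvgM; last exact: cvg_cosh_damped.
  by apply: cvgM; [exact: pre|exact: cvg_cst].
Qed.

Lemma measurable_g_kernel t : measurable_fun setT (fun p : R * R => g_kernel t p.1 p.2).
Proof.
apply: measurable_funM => //.
apply: (measurable_Rintegral_param mu (f := fun z : (R * R) * R =>
  expR (- (t * z.2 ^+ 2 / 4)) * sin (z.1.1 * z.2) * sin (z.1.2 * z.2))) => //.
have ms (k : (R * R) * R -> R) : measurable_fun setT k ->
    measurable_fun setT (fun z => sin (k z * z.2)).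
  move=> mk; apply: measurableT_comp; first exact: measurable_sin.
  exact: measurable_funM.
apply: measurable_funM; first apply: measurable_funM.
- do 2 apply: measurableT_comp => //; apply: measurable_funM => //.
  by apply: measurable_funM => //; apply: measurable_funX.
- by apply: ms; apply: measurableT_comp.
- by apply: ms; apply: measurableT_comp.
Qed.

Lemma measurable_rho_trans_density a s t :
  measurable_fun setT (fun p : R * R => rho_trans_density a s t p.1 p.2).
Proof.
have mS (z : R * R -> R) : measurable_fun setT z ->
    measurable_fun setT (fun p => sinhR (a * z p)).
  move=> mz; apply: measurable_funM => //; apply: measurable_funB.
    by apply: measurableT_comp => //; apply: measurable_funM.
  by do 2 apply: measurableT_comp => //; apply: measurable_funM.
apply: measurable_funM; last exact: measurable_g_kernel.
apply: measurable_funM; first by apply: measurable_funM => //; exact: mS.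
by apply: measurable_inv_fun; apply: measurable_funM => //; exact: mS.
Qed.

End rescaled_initial_density.

(** * The cosine transform of the Gaussian *)

Section gaussian_cosine_transform.
Context (R : realType) (s : R) (s0 : 0 < s).
Local Notation mu := (@lebesgue_measure R).
Local Notation hl := (`]0, +oo[%classic : set R).
Implicit Types (b u : R).

Let gauss u : R := expR (- (s * u ^+ 2)).

Let measurable_gauss : measurable_fun setT gauss.
Proof.
by do 2 apply: measurableT_comp => //; apply: measurable_funM => //; apply: measurable_funX.
Qed.

Let gauss_bound : exists2 C : R, 0 <= C & forall u, (1 + u ^+ 2) * gauss u <= C * expR (- u).
Proof.
by have [C C0 CP] := polynomial_gaussian_dominated 1 s0; exists C => // u; exact: CP.
Qed.

Let integrable_gauss_poly (k : R -> R) (L : R) : measurable_fun setT k ->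
  (forall u, `|k u| <= L * (1 + u ^+ 2)) ->
  mu.-integrable hl (EFin \o (fun u => k u * gauss u)).
Proof.
move=> mk kL; have [C C0 CP] := gauss_bound.
have L0 : 0 <= L by have := le_trans (normr_ge0 _) (kL 0); rewrite expr0n addr0 mulr1.
apply: (@integrable_dominated _ _ _ mu _ _ (fun u => (L * C) * expR (- u))) => //.
- by apply: measurable_funTS; exact: measurable_funM.
- exact: (@integrableZl _ _ R mu hl (measurable_itv _) (L * C) _ (@integrable_expRN_open R)).
- move=> u _; rewrite normrM (ger0_norm (expR_ge0 _)).
  apply: (le_trans (ler_wpM2r (expR_ge0 _) (kL u))).
  by rewrite -!mulrA; apply: ler_wpM2l => //; exact: CP.
Qed.

Definition gaussian_cosine b : R := \int[mu]_(u in hl) (cos (b * u) * expR (- (s * u ^+ 2))).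

Lemma integrable_gaussian_cosine b : mu.-integrable hl (EFin \o (fun u => cos (b * u) * expR (- (s * u ^+ 2)))).
Proof.
apply: (@integrable_gauss_poly _ 1); first exact: measurable_cosM.
by move=> u; rewrite (le_trans (cos_max _))// mul1r lerDl sqr_ge0.
Qed.

Let measurable_sinM b : measurable_fun setT (fun u => sin (b * u)).
Proof.
by apply: measurableT_comp; [exact: measurable_sin|exact: mulrl_measurable].
Qed.

Let abs_le_sqr u : `|u| <= 1 * (1 + u ^+ 2).
Proof.
rewrite mul1r -(real_normK (num_real u)); have := sqr_ge0 (`|u| - 1).
rewrite sqrrB expr1n mulr1; move: (`|u|) (normr_ge0 u) => v v0 h; nra.
Qed.

Let integrable_usin b : mu.-integrable hl (EFin \o (fun u => (u * sin (b * u)) * gauss u)).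
Proof.
apply: (@integrable_gauss_poly _ 1); first exact: measurable_funM.
move=> u; rewrite normrM; apply: le_trans (abs_le_sqr u).
by rewrite ler_piMr// sin_max.
Qed.

Let derive_gauss u : is_derive u 1 gauss (- (2 * s * u) * gauss u).
Proof.
have d2 : is_derive u 1 (fun r : R => r ^+ 2) (2 * u).
  apply: is_derive_eq; rewrite /GRing.scale /=; ring.
have d1 : is_derive u 1 (fun r : R => - (s * r ^+ 2)) (- (2 * s * u)).
  apply: is_derive_eq; rewrite /GRing.scale /=; ring.
rewrite /gauss; apply: is_derive_eq; rewrite /GRing.scale /=; ring.
Qed.

Let usin_integral b : \int[mu]_(u in hl) ((u * sin (b * u)) * gauss u) =
  b / (2 * s) * gaussian_cosine b.
Proof.
have i1 := integrable_usin b.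
have i2 := @integrableZl _ _ R mu hl (measurable_itv _) (b / (2 * s)) _ (integrable_gaussian_cosine b).
have -> : b / (2 * s) * gaussian_cosine b =
    \int[mu]_(u in hl) (b / (2 * s) * (cos (b * u) * gauss u)).
  by rewrite RintegralZl//; exact: integrable_gaussian_cosine.
apply/eqP; rewrite eq_sym -subr_eq0 -RintegralB//; apply/eqP; rewrite -[RHS](subrr 0).
have s_neq0 := lt0r_neq0 s0.
have cs u : {for u, continuous (fun r : R => sin (b * r))}.
  apply: continuous_comp; [|exact: continuous_sin].
  by apply: cvgM; [exact: cvg_cst|exact: cvg_id].
have cc u : {for u, continuous (fun r : R => cos (b * r))}.
  apply: continuous_comp; [|exact: continuous_cos].
  by apply: cvgM; [exact: cvg_cst|exact: cvg_id].
have cg u : {for u, continuous gauss}.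
  apply: differentiable_continuous; apply/derivable1_diffP.
  by have := derive_gauss u => -[].
apply: (@Rintegral_half_line_FTC R (fun u => sin (b * u) * gauss u / (2 * s))).
- move=> u _; have dg := derive_gauss u.
  have ds : is_derive u 1 (fun r : R => sin (b * r)) (b * cos (b * u)).
    have db : is_derive u 1 (fun r : R => b * r) b.
      by apply: is_derive_eq; rewrite /GRing.scale /=; ring.
    by apply: is_derive_eq; rewrite /GRing.scale /=; ring.
  by apply: is_derive_eq; rewrite /GRing.scale /=; field.
- move=> u _; apply: cvgB; first by apply: cvgM; [exact: cvg_cst|exact: (cvgM (cc u) (cg u))].
  by apply: cvgM (cg u); apply: cvgM (cs u); exact: cvg_id.
- exact: (@integrableB _ _ R mu hl (measurable_itv _) _ _ i2 i1).
- have cF0 : {for 0, continuous (fun u : R => sin (b * u) * gauss u / (2 * s))}.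
    by apply: cvgM; [exact: (cvgM (cs 0) (cg 0))|exact: cvg_cst].
  have inv0 : m.+2%:R^-1 @[m --> \oo] --> (0 : R).
    by apply: (@cvg0_of_le_inv R _ 1) => m; rewrite mul1r ger0_norm.
  have := continuous_cvg _ cF0 inv0.
  by rewrite mulr0 sin0 !mul0r; exact.
- have [C C0 CP] := gauss_bound.
  apply: (@cvg0_of_le_inv R _ (C / (2 * s))) => m.
  set u : R := m.+2%:R; have u0 : 0 < u by [].
  have s2 : 0 < (2 * s)^-1 by rewrite invr_gt0 mulr_gt0.
  rewrite normrM (gtr0_norm s2) mulrAC ler_pM2r// normrM (ger0_norm (expR_ge0 _)).
  apply: (@le_trans _ _ (gauss u)); first by rewrite ler_piMl ?expR_ge0 ?sin_max.
  apply: (@le_trans _ _ ((1 + u ^+ 2) * gauss u)).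
    by rewrite ler_peMl ?expR_ge0// lerDl sqr_ge0.
  by apply: (le_trans (CP u)); rewrite ler_wpM2l ?expRN_le_inv.
Qed.

(** Differentiation under the integral sign followed by integration by parts: the
    transform satisfies the differential equation of a Gaussian. *)
Lemma derive_gaussian_cosine b :
  is_derive b 1 gaussian_cosine (- (b / (2 * s)) * gaussian_cosine b).
Proof.
pose f b u := cos (b * u) * gauss u.
have d1f (c u : R) : is_derive c 1 (f ^~ u) (- ((u * sin (c * u)) * gauss u)).
  have db : is_derive c 1 (fun r : R => r * u) u.
    by apply: is_derive_eq; rewrite /GRing.scale /=; ring.
  by apply: is_derive_eq; rewrite /GRing.scale /=; ring.
have partialE (c u : R) : partial1of2 f c u = - ((u * sin (c * u)) * gauss u).
  by rewrite partial1of2E; have := d1f c u => -[_ ->].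
have I : b \in `]b - 1, b + 1[ by rewrite in_itv /= ltrBlDr ltrDl ltr01.
have h := @cvg_differentiation_under_integral R _ _ mu f hl (measurable_itv _) b (b - 1) (b + 1) I
  (fun c _ => integrable_gaussian_cosine c) _ (fun u => `|u| * gauss u) _ _ _.
have {}h : h^-1 *: (gaussian_cosine (h + b) - gaussian_cosine b) @[h --> 0^'] -->
  - (b / (2 * s)) * gaussian_cosine b.
  have -> : - (b / (2 * s)) * gaussian_cosine b = \int[mu]_(u in hl) partial1of2 f b u.
    under eq_Rintegral do rewrite partialE.
    rewrite mulNr -usin_integral -mulN1r -RintegralZl//.
    by apply: eq_Rintegral => u _; rewrite mulN1r.
  apply: h.
  - by move=> x y _ _; have := d1f x y => -[].
  - by move=> y; rewrite mulr_ge0 ?expR_ge0.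
  - apply: (@integrable_gauss_poly (fun u => `|u|) 1); first exact: normr_measurable.
    by move=> u; rewrite normr_id; exact: abs_le_sqr.
  - move=> x y _ _; rewrite partialE normrN normrM (ger0_norm (expR_ge0 _)).
    by rewrite ler_wpM2r ?expR_ge0// normrM ler_piMr// sin_max.
apply: DeriveDef.
  apply/cvg_ex; exists (- (b / (2 * s)) * gaussian_cosine b) => /=.
  by under eq_fun do rewrite scaler1.
apply/cvg_lim => //; rewrite /=.
by under eq_fun do rewrite scaler1.
Qed.

(** Multiplied by exp(b^2 / (4 s)) the transform has derivative 0, so it is
    determined by its value at b = 0, the Gauss integral. *)
Lemma gaussian_cosineE b :
  gaussian_cosine b = Num.sqrt (pi / s) / 2 * expR (- (b ^+ 2 / (4 * s))).
Proof.
have s_neq0 := lt0r_neq0 s0.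
pose H b := gaussian_cosine b * expR (b ^+ 2 / (4 * s)).
have H0 : H b = H 0.
  apply: is_derive_0_is_cst => c; have dg := derive_gaussian_cosine c.
  have d2 : is_derive c 1 (fun r : R => r ^+ 2 / (4 * s)) (c / (2 * s)).
    by apply: is_derive_eq; rewrite /GRing.scale /=; field.
  by apply: is_derive_eq; rewrite /GRing.scale /=; ring.
have G0 : gaussian_cosine 0 = Num.sqrt (pi / s) / 2.
  pose e := (Num.sqrt s)^-1.
  have e0 : 0 < e by rewrite invr_gt0 sqrtr_gt0.
  have e2 : s * e ^+ 2 = 1 by rewrite exprVn sqr_sqrtr ?(ltW s0)// mulfV.
  have mg : measurable_fun setT (fun u : R => gauss u).
    exact: measurable_gauss.
  have h := Rintegral_scale0y e0 mg.
  rewrite /gaussian_cosine (Rintegral_itv_obnd_cbnd (integrable_gaussian_cosine 0)).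
  under eq_Rintegral do rewrite mul0r cos0 mul1r.
  rewrite -h (_ : \int[mu]_(w in _) _ = Num.sqrt pi / 2).
    by rewrite /e sqrtrM ?pi_ge0// sqrtrV ?(ltW s0)//; ring.
  rewrite -[RHS]/(fine (Num.sqrt pi / 2)%:E) -integral0y_gauss; apply: eq_Rintegral => u _.
  by rewrite /gauss /gauss_fun exprMn mulrA e2 mul1r.
move: H0; rewrite /H expr0n /= mul0r expR0 mulr1 G0 => <-.
by rewrite expRN mulfK// gt_eqF ?expR_gt0.
Qed.

End gaussian_cosine_transform.

Lemma sinM_sin (R : realType) (p q : R) : sin p * sin q = 2^-1 * (cos (p - q) - cos (p + q)).
Proof. by rewrite cosB cosD; field. Qed.

Lemma g_kernelE (R : realType) (t x y : R) : 0 < t ->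
  g_kernel t x y = (Num.sqrt (pi * t))^-1 *
    (expR (- ((x - y) ^+ 2 / t)) - expR (- ((x + y) ^+ 2 / t))).
Proof.
move=> t0; have t4 : 0 < t / 4 by rewrite divr_gt0.
have t_neq0 := lt0r_neq0 t0.
have i1 := integrable_gaussian_cosine t4 (x - y).
have i2 := integrable_gaussian_cosine t4 (x + y).
have pi0 := pi_gt0 R; have pi_neq0 := lt0r_neq0 pi0.
have sq : Num.sqrt (pi / (t / 4)) = 2 * pi * (Num.sqrt (pi * t))^-1.
  have st0 : Num.sqrt (pi * t) != 0 by rewrite gt_eqF// sqrtr_gt0 mulr_gt0.
  apply: (mulIf st0); rewrite mulfVK// -sqrtrM ?divr_ge0 ?(ltW pi0) ?(ltW t4) ?(ltW t0)//.
  have -> : pi / (t / 4) * (pi * t) = (2 * pi) ^+ 2 by field.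
  by rewrite sqrtr_sqr gtr0_norm ?mulr_gt0.
have -> : g_kernel t x y =
    2 / pi * (2^-1 * (gaussian_cosine (t / 4) (x - y) - gaussian_cosine (t / 4) (x + y))).
  rewrite /g_kernel; congr (_ * _); rewrite /gaussian_cosine -RintegralB// -RintegralZl//; last first.
    exact: (@integrableB _ _ R (@lebesgue_measure R) `]0, +oo[%classic (measurable_itv _) _ _ i1 i2).
  apply: eq_Rintegral => u _; rewrite -mulrA sinM_sin -mulrBl -mulrDl.
  have -> : t / 4 * u ^+ 2 = t * u ^+ 2 / 4 by ring.
  ring.
rewrite !gaussian_cosineE// sq.
have t4E : 4 * (t / 4) = t by field.
rewrite t4E; move: (expR _) (expR _) (Num.sqrt _) => E1 E2 r; move: (r^-1) => r'.
by move: (@pi R) pi_neq0 => p p0; field.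
Qed.

(** * Sums of independent exponential variables *)

Section joint_law.
Context (R : realType) d (Om : measurableType d) (P : probability Om R).
Variables X Y : {RV P >-> R}.
Hypothesis XY : independent_RV2 X Y.

(** The joint law and the product of the marginal laws agree on rectangles. *)
Lemma independent_joint_law (S : set (R * R)) : measurable S ->
  P ((fun w => (X w, Y w)) @^-1` S) =
  (\int[distribution P X]_x distribution P Y (xsection S x))%E.
Proof.
move=> mS; pose W := ((fun w => (X w, Y w)) : Om -> R * R).
have mW : measurable_fun setT W by apply: (@measurable_fun_pair _ _ _ _ _ _ X Y); exact: measurable_funPT.
pose W' : {mfun Om >-> (R * R)%type} := HB.pack W (isMeasurableFun.Build _ _ _ _ _ mW).
have := @product_measure_unique _ _ _ _ R (distribution P X) (distribution P Y) (distribution P W') _ S mS.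
by move=> /(_ XY) h; rewrite -[LHS]/(distribution P W' S) -h.
Qed.

End joint_law.

Section sum_of_two_exponentials.
Context (R : realType) (p q : R).
Hypotheses (p0 : 0 < p) (q0 : 0 < q) (pq : p != q).
Local Notation mu := (@lebesgue_measure R).
Local Notation e := (exponential_pdf (1 : R)).
Implicit Types x y z : R.

Let exp_pdfE x : 0 <= x -> e x = expR (- x).
Proof. by move=> x0; rewrite exponential_pdfE// mul1r mulN1r. Qed.

Let exp_pdf_ge0 x : 0 <= e x.
Proof. exact: exponential_pdf_ge0. Qed.

(** The density of p E + q E' for independent E and E' that are exponential with
    mean 1. *)
Definition hypoexponential_pdf z : R :=
  (expR (- (z / p)) - expR (- (z / q))) / (p - q) * \1_(`]0, +oo[%classic : set R) z.

(** For z > 0 the integrand lives on [0, z / p], where it is a multiple of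
    exp((p / q - 1) x); for z <= 0 it vanishes except possibly at x = 0. *)
Let convolution z :
  (\int[mu]_x (q^-1 * e ((z - p * x) / q) * e x)%:E = (hypoexponential_pdf z)%:E)%E.
Proof.
have p_neq0 := lt0r_neq0 p0; have q_neq0 := lt0r_neq0 q0.
have pq0 : p - q != 0 by rewrite subr_eq0.
have [z0|z0] := ltP 0 z; last first.
  rewrite /hypoexponential_pdf indicE memNset /=; last by rewrite in_itv /= andbT; apply/negP; rewrite -leNgt.
  rewrite mulr0.
  apply: (etrans _ (integral_set1 (fun x => (q^-1 * e ((z - p * x) / q) * e x)%:E) 0)).
  rewrite [RHS]integral_mkcond; apply: eq_integral => x _; rewrite patchE.
  case: ifPn => // xnot0; have x0 : x != 0.
    by apply: contra xnot0 => /eqP ->; rewrite inE.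
  have [xneg|xpos|x0'] := ltgtP x 0; last by rewrite x0' eqxx in x0.
  - by rewrite (lt0_exponential_pdf _ xneg) mulr0.
  - rewrite (@lt0_exponential_pdf _ _ ((z - p * x) / q)) ?mulr0 ?mul0r//.
    rewrite pmulr_llt0 ?invr_gt0// subr_lt0 (le_lt_trans z0)// mulr_gt0//.
rewrite /hypoexponential_pdf indicE mem_set /= ?in_itv /= ?z0// mulr1.
have [k k_def k0] : exists2 k, k = p / q - 1 & k != 0.
  by exists (p / q - 1) => //; rewrite subr_eq0 (can2_eq (divfK _) (mulfK _))// mul1r.
pose F x := q^-1 * expR (- (z / q)) * (expR (k * x) / k).
pose f x := q^-1 * expR (- (z / q)) * expR (k * x).
have cf : continuous f.
  move=> x; apply: cvgM; first exact: cvg_cst.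
  by apply: continuous_comp; [exact: mulrl_continuous|exact: continuous_expR].
have dF x : is_derive x 1 F (f x).
  by rewrite /F; apply: is_derive_eq; rewrite /GRing.scale /= /f; field; rewrite k0 q_neq0.
have zp : 0 < z / p by rewrite divr_gt0.
transitivity (\int[mu]_(x in `[0%R, (z / p)%R]) (f x)%:E)%E; last first.
  rewrite (integral_FTC2 zp cf dF) /F mulr0 expR0; congr EFin.
  have -> : expR (- (z / p)) = expR (- (z / q)) * expR (k * (z / p)).
    by rewrite -expRD; congr expR; rewrite k_def; field; rewrite p_neq0 q_neq0.
  have kE : k * q = p - q by rewrite k_def; field.
  rewrite -kE; move: (expR _) (expR _) => E1 E2; by field; rewrite k0 q_neq0.
rewrite [RHS]integral_mkcond; apply: eq_integral => x _; rewrite patchE.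
case: ifPn; rewrite ?inE ?notin_setE /= in_itv /=.
  move=> /andP[x0 xz]; rewrite !exp_pdfE//; last first.
    by rewrite divr_ge0 ?(ltW q0)// subr_ge0 mulrC -ler_pdivlMr.
  rewrite -mulrA -expRD /f -mulrA -expRD; congr (_ * expR _)%:E.
  by rewrite k_def; field.
move=> /negP; rewrite negb_and -!ltNge => /orP[x0|xz].
  by rewrite (lt0_exponential_pdf _ x0) mulr0.
rewrite (@lt0_exponential_pdf _ _ ((z - p * x) / q)) ?mulr0 ?mul0r//.
by rewrite pmulr_llt0 ?invr_gt0// subr_lt0 mulrC -ltr_pdivrMr.
Qed.

(** Given X = x, substitute z = p x + q y; exchanging the integrals over x and z
    leaves the convolution of the two densities. *)
Lemma sum_exponentials_law d (Om : measurableType d) (P : probability Om R)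
    (X Y : {RV P >-> R}) (B : set R) : independent_RV2 X Y -> is_exp1 X -> is_exp1 Y ->
  measurable B ->
  P ((fun w => p * X w + q * Y w) @^-1` B) = density_law hypoexponential_pdf B.
Proof.
move=> XY eX eY mB.
have me : measurable_fun setT e by exact: measurable_exponential_pdf.
have mB1 : measurable_fun setT (\1_B : R -> R) by apply: measurable_indic.
pose S : set (R * R) := (fun z : R * R => p * z.1 + q * z.2) @^-1` B.
have mpq : measurable_fun setT (fun z : R * R => p * z.1 + q * z.2).
  by apply: measurable_funD; exact: measurable_funM.
have mS : measurable S by rewrite -[X in measurable X]setTI; exact: mpq.
rewrite -[LHS]/(P ((fun w => (X w, Y w)) @^-1` S)) (independent_joint_law XY mS).
pose g (z : R * R) : \bar R := (\1_B z.2 * (q^-1 * e ((z.2 - p * z.1) / q) * e z.1))%:E.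
have mgR : measurable_fun setT (fun z : R * R =>
    \1_B z.2 * (q^-1 * e ((z.2 - p * z.1) / q) * e z.1)).
  apply: measurable_funM; first exact: measurableT_comp.
  apply: measurable_funM; last exact: measurableT_comp.
  apply: measurable_funM => //; apply: measurableT_comp => //.
  by apply: measurable_funM => //; apply: measurable_funB => //; exact: measurable_funM.
have mg : measurable_fun setT g by exact/measurable_EFinP.
have g0 (z : R * R) : (0 <= g z)%E by rewrite lee_fin !mulr_ge0// invr_ge0 ltW.
pose h x : R := \int[mu]_y (\1_B (p * x + q * y) * e y).
have mh : measurable_fun setT h.
  apply: (measurable_Rintegral_param mu (f := fun z : R * R => \1_B (p * z.1 + q * z.2) * e z.2)) => //.
  by apply: measurable_funM; exact: measurableT_comp.
have hI x : (\int[mu]_y (\1_B (p * x + q * y) * e y)%:E = distribution P Y (xsection S x))%E.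
  rewrite eY; last exact: measurable_xsection.
  rewrite /exponential_prob [RHS]integral_mkcond; apply: eq_integral => y _.
  rewrite patchE indicE mem_xsection /S /=.
  have -> : ((x, y) \in (fun z : R * R => p * z.1 + q * z.2) @^-1` B) = (p * x + q * y \in B).
    by apply/idP/idP; rewrite !inE.
  by case: (_ \in B); rewrite ?mul1r ?mul0r.
have hE x : (h x)%:E = distribution P Y (xsection S x).
  by rewrite -hI /h /Rintegral fineK// hI fin_num_measure//; exact: measurable_xsection.
have h0 x : 0 <= h x by apply: Rintegral_ge0 => y _; rewrite mulr_ge0.
have -> : (\int[distribution P X]_x distribution P Y (xsection S x) =
    \int[mu]_x (h x * e x)%:E)%E.
  have dX A : measurable A -> A `<=` setT ->
      distribution P X (setT `&` id @^-1` A) = (\int[mu]_(x in A) (e x)%:E)%E.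
    by move=> mA _; rewrite setTI eX.
  have := @ge0_integral_comp_density R _ _ (distribution P X) id setT setT
    (@measurable_id _ _ _) measurableT measurableT e h me exp_pdf_ge0 dX mh h0.
  by rewrite setTI => <-; apply: eq_integral => x _; rewrite hE.
have -> : (\int[mu]_x (h x * e x)%:E = \int[mu]_x \int[mu]_z g (x, z))%E.
  apply: eq_integral => x _.
  have mgx : measurable_fun setT (fun z => g (x, z)).
    exact: (measurable_fun_pair2 _ mg).
  rewrite (integral_affine (p * x) q0 measurableT mgx) preimage_setT.
  have -> : (\int[mu]_z g (x, (q * z + p * x)%R) =
      (q^-1 * e x)%:E * \int[mu]_y (\1_B (p * x + q * y) * e y)%:E)%E.
    transitivity (\int[mu]_y ((q^-1 * e x)%:E * (\1_B (p * x + q * y) * e y)%:E))%E.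
      apply: eq_integral => y _; rewrite /g /= -EFinM; congr EFin.
      have -> : (q * y + p * x - p * x) / q = y by rewrite addrK mulrC mulKf ?lt0r_neq0.
      by rewrite [q * y + _]addrC; ring.
    rewrite ge0_integralZl//=.
    - apply/measurable_EFinP; apply: measurable_funM => //.
      apply: measurableT_comp => //; apply: measurable_funD => //; exact: measurable_funM.
    - by move=> y _; rewrite lee_fin mulr_ge0.
    - by rewrite lee_fin mulr_ge0// invr_ge0 ltW.
  rewrite hI -hE -!EFinM; congr EFin.
  by rewrite [RHS]mulrA mulVKf ?lt0r_neq0// mulrC.
rewrite (@fubini_tonelli _ _ _ _ R mu mu g mg g0).
rewrite /density_law [RHS]integral_mkcond; apply: eq_integral => z _.
rewrite patchE /g /=.
under eq_integral do rewrite EFinM.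
rewrite ge0_integralZl//=.
- rewrite convolution indicE.
  by case: ifPn => zB; rewrite ?mul1e ?mul0e.
- apply/measurable_EFinP; apply: measurable_funM => //; apply: measurable_funM => //.
  apply: measurableT_comp => //; apply: measurable_funM => //; exact: measurable_funB.
- by move=> x _; rewrite lee_fin !mulr_ge0// invr_ge0 ltW.
Qed.

End sum_of_two_exponentials.

Lemma mu_densityE (R : realType) (a c x : R) : a < 0 -> 0 < a + c ->
  mu_density a c x = hypoexponential_pdf (a + c)^-1 (c - a)^-1 x.
Proof.
move=> a0 ac0; rewrite /mu_density /hypoexponential_pdf; congr (_ * _).
have ac : a + c != 0 by rewrite gt_eqF.
have ca : c - a != 0 by rewrite gt_eqF//; lra.
have a_neq0 : a != 0 by rewrite lt_eqF.
rewrite !invrK [x * (a + c)]mulrC.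
have -> : - (x * (c - a)) = (a - c) * x by ring.
have -> : (a + c)^-1 - (c - a)^-1 = - (2 * a) / ((a + c) * (c - a)).
  by field; rewrite ac ca.
by move: (expR _) (expR _) => E1 E2; field; rewrite ac ca a_neq0.
Qed.

(** * The scaling limit *)

(** If the convergence failed, some neighborhood of l would be missed at
    arbitrarily large arguments, and a sequence of these could be chosen with
    u(n) >= n + 1; in particular the sequences to be tested may be taken in
    [1, oo). *)
Lemma cvg_pinfty_of_seq (R : realType) (T : topologicalType) (f : R -> T) (l : T) :
  (forall u : nat -> R, (forall n, n.+1%:R <= u n) -> f (u n) @[n --> \oo] --> l) ->
  f x @[x --> +oo%R] --> l.
Proof.
move=> h U Ul; apply: contrapT => nU.
have step (n : nat) : exists x, n.+1%:R <= x /\ ~ U (f x).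
  apply: contrapT => /forallNP H; apply: nU; exists n.+1%:R; split => // x /ltW nx.
  by apply: contrapT => Ux; apply: (H x).
have [u uP] := choice step.
have [N _ NU] := h u (fun n => proj1 (uP n)) U Ul.
by case: (proj2 (uP N)); apply: (NU N) => /=.
Qed.

Lemma rescaled_fdd_cvg (R : realType) (a c : R) : 0 < a + c -> a < 0 ->
  forall (d : R -> R -> measure_display)
    (Om : forall alpha gamma : R, measurableType (d alpha gamma))
    (P : forall alpha gamma : R, probability (Om alpha gamma) R)
    (Z : forall alpha gamma : R, R -> Om alpha gamma -> R),
  (forall alpha gamma : R, `|alpha| < gamma ->
    markov_process (P alpha gamma) (Z alpha gamma) setT
      (density_law (Z_init_density alpha gamma)) (Z_trans_density alpha)) ->
  forall (d' : measure_display) (Om' : measurableType d') (P' : probability Om' R)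
    (rho : R -> Om' -> R),
  markov_process P' rho `]0, +oo[ (density_law (mu_density a c)) (rho_trans_density a) ->
  fdd_cvg (fun T : R => P (a / Num.sqrt T) (c / Num.sqrt T))
    (fun T t w => (Num.sqrt T)^-1 * Z (a / Num.sqrt T) (c / Num.sqrt T) (t * T) w)
    P' rho.
Proof.
move=> ac0 a0 d Om P Z hZ d' Om' P' rho hrho N t t0 g cg [M gM].
have a_neq0 : a != 0 by rewrite lt_eqF.
have ca0 : 0 < c - a by lra.
apply: cvg_pinfty_of_seq => u nu.
have u0 n : 0 < u n by apply: lt_le_trans (nu n).
have u1 n : 1 <= u n by apply: le_trans (nu n); rewrite ler1n.
pose e_ n := (Num.sqrt (u n))^-1.
have e0 n : 0 < e_ n by rewrite invr_gt0 sqrtr_gt0.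
have e1 n : e_ n <= 1.
  by rewrite invf_le1 ?sqrtr_gt0// -[leLHS]sqrtr1 ler_wsqrtr.
have e2 n s : s / e_ n ^+ 2 = s * u n.
  by rewrite exprVn sqr_sqrtr ?invrK// ltW.
have ecvg : e_ n @[n --> \oo] --> 0.
  have h : (u n)^-1 @[n --> \oo] --> 0.
    apply: (@cvg0_of_le_inv R _ 2) => m; rewrite ger0_norm ?invr_ge0 ?(ltW (u0 _))//.
    apply: (@le_trans _ _ m.+1%:R^-1); first by rewrite lef_pV2 ?posrE.
    rewrite ler_pdivlMr// ler_pdivrMl// -natrM ler_nat; lia.
  have -> : e_ = (fun n => Num.sqrt (u n)^-1).
    by apply/funext => n; rewrite sqrtrV// ltW.
  have := continuous_cvg _ (@sqrt_continuous R 0) h; rewrite sqrtr0; exact.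
pose q_ n s t x y : R := (e_ n)^-1 *
  Z_trans_density (a * e_ n) (s * u n) (t * u n) (x / e_ n) (y / e_ n).
pose f_ n x : R := (e_ n)^-1 * Z_init_density (a * e_ n) (c * e_ n) (x / e_ n).
have mq_ n s r : measurable_fun setT (fun p : R * R => q_ n s r p.1 p.2).
  apply: measurable_funM => //.
  apply: (measurableT_comp (f := fun p : R * R =>
    Z_trans_density (a * e_ n) (s * u n) (r * u n) p.1 p.2)
    (g := fun p : R * R => (p.1 / e_ n, p.2 / e_ n))).
    exact: measurable_Z_trans_density.
  by apply: measurable_fun_pair; apply: measurable_funM.
have scaled n : markov_process (P (a / Num.sqrt (u n)) (c / Num.sqrt (u n)))
    (fun t w => e_ n * Z (a / Num.sqrt (u n)) (c / Num.sqrt (u n)) (t * u n) w)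
    setT (density_law (f_ n)) (q_ n).
  apply: markov_process_scale => //.
  - exact: measurable_Z_init_density.
  - move=> s r x _ _.
    exact: (measurable_fun_pair2 _ (measurable_Z_trans_density (a * e_ n) s r)).
  - by apply: hZ; rewrite normrM (gtr0_norm (e0 n)) ltr_pM2r// ltr0_norm//; lra.
apply: (cvg_expectation_of_densities scaled hrho _ _ _ _ _ _ t0 cg gM).
- move=> n; apply: measurable_funM => //.
  by apply: measurableT_comp; [exact: measurable_Z_init_density|exact: measurable_funM].
- exact: measurable_mu_density.
- by move=> lo hi lo0; exact: bounded_cvg_init_density.
- by move=> n s r _ _; exact: mq_.
- by move=> s r _ _; exact: measurable_rho_trans_density.
- move=> lo hi s r lo0 _ sr.
  have -> : (fun n (p : R * R) => q_ n s r p.1 p.2) = (fun n p => (e_ n)^-1 *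
      Z_trans_density (a * e_ n) (s / e_ n ^+ 2) (r / e_ n ^+ 2) (p.1 / e_ n) (p.2 / e_ n)).
    by apply/funext => n; apply/funext => p; rewrite /q_ !e2.
  exact: bounded_cvg_trans_density.
Qed.

Theorem theorem2p8 (R : realType) (a c : R) (hac : 0 < a + c) (ha : a < 0)
  (d : R -> R -> measure_display)
  (Om : forall alpha gamma : R, measurableType (d alpha gamma))
  (P : forall alpha gamma : R, probability (Om alpha gamma) R)
  (Z : forall alpha gamma : R, R -> Om alpha gamma -> R)
  (hZ : forall alpha gamma : R, `|alpha| < gamma ->
    markov_process (P alpha gamma) (Z alpha gamma) setT
      (density_law (Z_init_density alpha gamma)) (Z_trans_density alpha))
  (d' : measure_display) (Om' : measurableType d') (P' : probability Om' R)
  (rho : R -> Om' -> R)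
  (hrho : markov_process P' rho `]0, +oo[
    (density_law (mu_density a c)) (rho_trans_density a)) :
  [/\ fdd_cvg (fun T : R => P (a / Num.sqrt T) (c / Num.sqrt T))
        (fun T t w =>
           (Num.sqrt T)^-1 * Z (a / Num.sqrt T) (c / Num.sqrt T) (t * T) w)
        P' rho,
      forall t x y : R, 0 < t -> 0 < x -> 0 < y ->
        g_kernel t x y =
        (Num.sqrt (pi * t))^-1 *
        (expR (- ((x - y) ^+ 2 / t)) - expR (- ((x + y) ^+ 2 / t))) &
      forall (d1 : measure_display) (Om1 : measurableType d1)
        (P1 : probability Om1 R) (X Y : {RV P1 >-> R}),
        independent_RV2 X Y -> is_exp1 X -> is_exp1 Y ->
        forall B : set R, measurable B ->
          P1 ((fun w => (a + c)^-1 * X w + (c - a)^-1 * Y w) @^-1` B) =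
          density_law (mu_density a c) B].
Proof.
split.
- exact: rescaled_fdd_cvg.
- by move=> t x y t0 _ _; exact: g_kernelE.
- move=> d1 Om1 P1 X Y XY eX eY B mB.
  have ca0 : 0 < c - a by lra.
  rewrite (sum_exponentials_law (p := (a + c)^-1) (q := (c - a)^-1)) ?invr_gt0//; last first.
    rewrite (inj_eq invr_inj) addrC -subr_eq0; apply/eqP => h; lra.
  by apply: eq_integral => x _; rewrite mu_densityE.
Qed.
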